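(* Let $M$ be an $\mathcal{A}ct_{>0}$-infinitesimal bimodule. Then $$Ibimod^{h}_{\mathcal{A}ct_{>0}}(\mathcal{A}ct;M)\simeq Ibimod^{h}_{As_{>0}}(As;M_{c})\simeq sTot(M_{c}).$$
   Context: Conventions. ''Space'' means compactly generated Hausdorff space; $\simeq$ denotes weak homotopy equivalence (possibly through a zigzag). Operads. For a set $S$, an $S$-sequence is a family of spaces $O(s_1,\dots,s_n;s_{n+1})$, $n\ge 0$, $s_i\in S$. A (non-symmetric) $S$-operad is an $S$-sequence with partial compositions $\circ_i$ and units $\ast_s\in O(s;s)$ satisfying the usual axioms. For an $\{o;c\}$-sequence $M$ write $M(n;c)=M(c,\dots,c;c)$ ($n$ inputs $c$), $M(n;o)=M(c,\dots,c,o;o)$ ($n-1$ inputs $c$ followed by one input $o$), $M_c^n=M(n;c)$ and $M_c=\{M_c^n\}_{n\ge0}$. $\mathcal{A}ct$ is the $\{o;c\}$-operad with $\mathcal{A}ct(n;c)=\{\ast_{n;c}\}$ for $n\ge0$, $\mathcal{A}ct(n;o)=\{\ast_{n;o}\}$ for $n>0$, and empty otherwise; $\mathcal{A}ct_{>0}$ is its suboperad consisting of $\ast_{n;c}$, $\ast_{n;o}$ for $n>0$; compositions are the unique ones. Their restrictions to the colour $c$ are $As$ and $As_{>0}$. Infinitesimal bimodules. An infinitesimal bimodule over an $S$-operad $O$ is an $S$-sequence $M$ with operations $\circ_i:O(s_1,\dots,s_n;s_{n+1})\times M(s'_1,\dots,s'_m;s_i)\to M(s_1,\dots,s_{i-1},s'_1,\dots,s'_m,s_{i+1},\dots,s_n;s_{n+1})$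 and $\circ^i:M(s_1,\dots,s_n;s_{n+1})\times O(s'_1,\dots,s'_m;s_i)\to M(s_1,\dots,s_{i-1},s'_1,\dots,s'_m,s_{i+1},\dots,s_n;s_{n+1})$ satisfying the associativity and unit relations of operadic partial compositions in which exactly one factor lies in $M$. An operad under $O$ is an $O$-infinitesimal bimodule; in particular $\mathcal{A}ct$ is one over $\mathcal{A}ct_{>0}$ and $As$ is one over $As_{>0}$. If $M$ is an $\mathcal{A}ct_{>0}$-infinitesimal bimodule, $M_c$ is an $As_{>0}$-infinitesimal bimodule by restriction. Semi-cosimplicial structure. A semi-cosimplicial space is a family $\{X^n\}_{n\ge 0}$ with $d^i:X^n\to X^{n+1}$, $0\le i\le n+1$, satisfying $d^jd^i=d^id^{j-1}$ for $i<j$; $sTot(X^\bullet)$ is the space of natural transformations from the semi-cosimplicial space of standard simplices to $X^\bullet$. On $M_c$: $d^0x=\ast_{2;c}\circ_2x$, $d^ix=x\circ^i\ast_{2;c}$ ($1\le i\le n$), $d^{n+1}x=\ast_{2;c}\circ_1x$ for $x\in M_c^n$. Derived mapping spaces. The category $Ibimod_O$ carries the model structure whose weak equivalences and fibrations are componentwise weak homotopy equivalences and Serre fibrations; all objects are fibrant. $Ibimod^h_O(A;B)$ is the space of $O$-infinitesimal bimodule maps from a cofibrant replacement of $A$ to $B$ (well defined up to weak equivalence). *)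

(* Defs.v *)
From HB Require Import structures.
From mathcomp Require Import all_boot all_order all_algebra.
From mathcomp Require Import all_classical all_reals.
From mathcomp Require Import topology normedtype.
From mathcomp Require Import zify.
From Stdlib Require Import Relation_Operators.
Import Order.TTheory GRing.Theory Num.Theory.
Import numFieldNormedType.Exports.

Set Implicit Arguments.
Unset Strict Implicit.
Unset Printing Implicit Defensive.

Local Open Scope classical_set_scope.
Local Open Scope ring_scope.

Definition compactly_generated (T : topologicalType) :=
  forall U : set T,
    (forall K : set T, compact K -> open (U : set (subspace K))) -> open U.

Record space := Space {
  space_top :> topologicalType ;
  space_hausdorff : hausdorff_space space_top ;
  space_cg : compactly_generated space_top }.

(* The k-ification: [T] retopologised by the sets whose trace on every compact
   subset [K] of [T] is relatively open in [K]. *)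
Definition kify (T : Type) : Type := T.

Section Kify.
Variable T : topologicalType.

Definition kopen : set (set T) :=
  [set U : set T | forall K : set T, compact K -> open (U : set (subspace K))].

Let kopenT : kopen setT.
Proof. by move=> K _; exact: openT. Qed.

Let kopenI : setI_closed kopen.
Proof. by move=> A B oA oB K cK; apply: openI; [exact: oA|exact: oB]. Qed.

Let kopen_bigU (I : Type) (f : I -> set T) :
  (forall i, kopen (f i)) -> kopen (\bigcup_i f i).
Proof. by move=> of_ K cK; apply: bigcup_open => i _; exact: of_. Qed.

HB.instance Definition _ := Choice.on (kify T).
HB.instance Definition _ :=
  isOpenTopological.Build (kify T) kopenT kopenI kopen_bigU.

Lemma kify_openE : (open : set (set (kify T))) = kopen.
Proof. by []. Qed.

Lemma kify_open (U : set T) : open U -> open (U : set (kify T)).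
Proof. by rewrite kify_openE; move=> oU K _; exact: open_subspaceW. Qed.

Lemma kify_id_continuous : continuous (id : kify T -> T).
Proof. by apply/continuousP => A oA; exact: kify_open. Qed.

Lemma kify_compact (K : set T) : compact K <-> compact (K : set (kify T)).
Proof.
split=> cK F PF FK; last first.
  have [x [Kx xF]] := cK F PF FK; exists x; split=> // A B FA nB.
  by apply: xF => //; exact: (kify_id_continuous nB).
have [x [Kx xF]] := cK F PF FK; exists x; split=> // A B FA.
rewrite nbhsE => -[V [+ Vx] VB]; rewrite kify_openE => oV.
have /open_subspaceP[W oW WV] := oV K cK.
have nW : nbhs x W.
  have : (V `&` K) x by [].
  by rewrite -WV => -[Wx _]; exact: open_nbhs_nbhs.
have [y [[Ay Ky] Wy]] := xF _ _ (filterI FA FK) nW.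
exists y; split=> //; apply: VB.
have : (W `&` K) y by [].
by rewrite WV => -[].
Qed.

Lemma kify_hausdorff : hausdorff_space T -> hausdorff_space (kify T).
Proof.
move=> hT p q pq; apply: hT => A B nA nB.
by apply: pq; exact: kify_id_continuous.
Qed.

Lemma kify_cg : compactly_generated (kify T).
Proof.
move=> U Uo; rewrite kify_openE => K cK.
have /open_subspaceP[V + VU] := Uo K ((kify_compact K).1 cK).
rewrite kify_openE => oV.
have /open_subspaceP[W oW WV] := oV K cK.
by apply/open_subspaceP; exists W => //; rewrite WV.
Qed.

End Kify.

Definition kspace (T : topologicalType) (hT : hausdorff_space T) : space :=
  Space (kify_hausdorff hT) (@kify_cg T).

Lemma hausdorff_injective_family (T : topologicalType) (I : Type)
    (U : I -> topologicalType) (h : forall i, T -> U i) :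
  (forall i, hausdorff_space (U i)) -> (forall i, continuous (h i)) ->
  (forall x y, (forall i, h i x = h i y) -> x = y) -> hausdorff_space T.
Proof.
move=> hU ch inj p q pq; apply: inj => i; apply: hU => A B nA nB.
have [x [Ax Bx]] := pq _ _ (ch i _ _ nA) (ch i _ _ nB).
by exists (h i x).
Qed.

Lemma compact_cg (T : topologicalType) :
  compact [set: T] -> compactly_generated T.
Proof.
move=> cT U /(_ _ cT) /open_subspaceP[V oV].
by rewrite !setIT => <-.
Qed.

Lemma compact_set_type (T : topologicalType) (A : set T) :
  compact A -> compact [set: A].
Proof.
move=> cA F PF _.
have FA : (set_val @ F) A.
  by rewrite /fmap /=; apply: (filterS _ filterT) => x _; exact: set_valP.
have [x [Ax xF]] := cA _ _ FA.
exists (exist _ x (mem_set Ax)); split=> // B C FB [_ [[W oW <-] Wx] WC].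
have FvB : (set_val @ F) (set_val @` B).
  by rewrite /fmap /=; apply: (filterS _ FB) => b Bb; exists b.
have [_ [[b Bb <-] Wb]] : (set_val @` B) `&` W !=set0.
  by apply: xF => //; apply: open_nbhs_nbhs.
by exists b; split=> //; exact: WC.
Qed.

Lemma set_type_hausdorff (T : topologicalType) (A : set T) :
  hausdorff_space T -> hausdorff_space A.
Proof.
move=> hT; apply: (@hausdorff_injective_family _ unit (fun=> T)
  (fun=> set_val)) => // [_|x y /(_ tt)]; first exact: initial_continuous.
exact: val_inj.
Qed.

Definition kprod_subproof (X Y : space) : hausdorff_space (X * Y)%type.
Proof.
apply: (@hausdorff_injective_family _ bool
  (fun b => if b then X : topologicalType else Y)
  (fun b => if b return X * Y -> (if b then X : topologicalType else Y)
            then fst else snd)).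
- by case; exact: space_hausdorff.
- by case=> x; [exact: cvg_fst|exact: cvg_snd].
- by move=> [a b] [c d] e; congr pair; [exact: (e true)|exact: (e false)].
Qed.

(* The product in the category of spaces. *)
Definition kprod (X Y : space) : space := kspace (@kprod_subproof X Y).

Section MappingSpace.
Variables (I : Type) (X Y : I -> space).
Variable P : set (forall i, X i -> Y i).

Definition cfamily : set (prod_topology (fun i => {compact-open, X i -> Y i})) :=
  [set f | (forall i, continuous (f i)) /\ P f].

Lemma map_space_subproof : hausdorff_space cfamily.
Proof.
pose h (j : {i & X i}) (f : cfamily) : Y (projT1 j) :=
  set_val f (projT1 j) (projT2 j).
apply: (@hausdorff_injective_family _ _ (fun j => Y (projT1 j)) h).
- by move=> j; exact: space_hausdorff.
- move=> [i x]; rewrite /h /=; apply/continuousP => A oA.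
  have oE : open ([set g | g @` [set x] `<=` A] : set {compact-open, X i -> Y i}).
    by apply: compact_open_open => //; exact: compact_set1.
  have ci : continuous (fun f : prod_topology (fun i => {compact-open, X i -> Y i}) => f i).
    move=> f; have /cvg_sup/(_ i) : f --> f by apply: cvg_id.
    move=> fi; apply: cvg_trans (@initial_continuous _ _
       (fun f : prod_topology (fun i => {compact-open, X i -> Y i}) => f i) f).
    exact: cvg_app.
  have := (continuousP _).1 (@initial_continuous _ _
    (set_val : cfamily -> prod_topology (fun i => {compact-open, X i -> Y i}))) _
    ((continuousP _).1 ci _ oE).
  congr open; apply/seteqP; split=> f /=.
    by move/(_ (set_val f i x)); apply; exists x.
  by move=> Af _ [_ -> <-].
- move=> f g fg; apply: val_inj; apply: functional_extensionality_dep => i.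
  by apply/funext => x; exact: (fg (existT _ i x)).
Qed.

(* The space of the families of continuous maps [f i : X i -> Y i] that satisfy
   [P], as a subspace of the product of the mapping spaces, all formed in the
   category of spaces.  One k-ification at the end suffices: it depends only on
   the continuous maps from compact Hausdorff spaces, which k-ifying the mapping
   spaces or the product does not change. *)
Definition map_space : space := kspace map_space_subproof.

Definition mapf (f : map_space) : forall i, X i -> Y i := set_val (f : cfamily).

End MappingSpace.

Arguments mapf {I X Y P} f i x.

Definition cube_set (R : realType) (n : nat) : set 'rV[R]_n :=
  [set t | forall i, 0 <= t ord0 i <= 1].

Definition cube (R : realType) (n : nat) : topologicalType := @cube_set R n.

Definition cube_boundary (R : realType) (n : nat) : set (cube R n) :=
  [set t | exists i, (set_val t : 'rV[R]_n) ord0 i \in [:: 0; 1]].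

Definition itv_set (R : realType) : set R := [set t | 0 <= t <= 1].

Definition itv (R : realType) : topologicalType := @itv_set R.

Lemma itv0_subproof (R : realType) : itv_set (0 : R).
Proof. by rewrite /itv_set /= lexx ler01. Qed.

Lemma itv1_subproof (R : realType) : itv_set (1 : R).
Proof. by rewrite /itv_set /= lexx ler01. Qed.

Definition itv0 (R : realType) : itv R := exist _ 0 (mem_set (itv0_subproof R)).
Definition itv1 (R : realType) : itv R := exist _ 1 (mem_set (itv1_subproof R)).

Section Homotopy.
Variable R : realType.
Notation I := (itv R).
Notation cube := (cube R).

Definition path_joined (X : topologicalType) (x y : X) :=
  exists2 g : I -> X, continuous g & g (itv0 R) = x /\ g (itv1 R) = y.

Definition pi0 (X : topologicalType) : set (set X) :=
  [set path_joined x | x in [set: X]].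

Definition pi0_map (X Y : topologicalType) (phi : X -> Y) (C : set X) : set Y :=
  [set y | exists2 x, C x & path_joined (phi x) y].

Section Pi.
Variables (n : nat) (X : topologicalType) (x0 : X).

Definition loops : set (cube n -> X) :=
  [set f | continuous f /\ forall t, @cube_boundary R n t -> f t = x0].

Definition homotopic_rel (f g : cube n -> X) :=
  exists2 H : cube n * I -> X, continuous H &
    [/\ forall t, H (t, itv0 R) = f t, forall t, H (t, itv1 R) = g t &
        forall t s, @cube_boundary R n t -> H (t, s) = x0].

(* [pi n X x0] is the set of the classes of maps (I^n, boundary) -> (X, x0)
   under homotopy relative to the boundary. *)
Definition pi : set (set (cube n -> X)) := [set homotopic_rel f | f in loops].

End Pi.

Definition pi_map (n : nat) (X Y : topologicalType) (x0 : X) (phi : X -> Y)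
    (C : set (cube n -> X)) : set (cube n -> Y) :=
  [set g | exists2 f, C f & homotopic_rel (phi x0) (phi \o f) g].

(* The maps induced on homotopy groups are automatically group homomorphisms,
   so bijectivity is all that has to be required of them. *)
Definition weak_equivalence (X Y : topologicalType) (phi : X -> Y) :=
  [/\ continuous phi,
      set_bij (@pi0 X) (@pi0 Y) (pi0_map phi) &
      forall (n : nat) (x0 : X), (0 < n)%N ->
        set_bij (@pi n X x0) (@pi n Y (phi x0)) (@pi_map n X Y x0 phi)].

Definition serre_fibration (X Y : topologicalType) (p : X -> Y) :=
  continuous p /\
  forall (n : nat) (h : cube n -> X) (H : cube n * I -> Y),
    continuous h -> continuous H -> (forall t, H (t, itv0 R) = p (h t)) ->
    exists2 G : cube n * I -> X, continuous G &
      (forall t, G (t, itv0 R) = h t) /\ (forall z, p (G z) = H z).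

(* Finite zigzags of weak homotopy equivalences. *)
Definition weakly_equivalent : space -> space -> Prop :=
  clos_refl_sym_trans space
    (fun X Y => exists phi : X -> Y, weak_equivalence phi).

End Homotopy.

(* An operation [A(l; s) x B(w; a) -> C(r; s)] that grafts an element of [B] on
   the input of colour [a] standing between the inputs [u] and [v], i.e. the
   partial composition at position [size u + 1].  The equations on the lists of
   inputs are arguments, so that the relations below need no transport. *)
Definition pcomp (S : Type) (A B C : seq S -> S -> space) :=
  forall (u v w l r : seq S) (a s : S),
    l = u ++ a :: v -> r = u ++ w ++ v -> A l s -> B w a -> C r s.

Section PartialCompositions.
Variable S : Type.
Implicit Types A B C D : seq S -> S -> space.

Definition pcomp_continuous A B C (c : pcomp A B C) :=
  forall u v w l r a s (el : l = u ++ a :: v) (er : r = u ++ w ++ v),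
    continuous (fun z : kprod (A l s) (B w a) => c _ _ _ _ _ _ _ el er z.1 z.2).

(* (x o_i y) o_(i - 1 + j) z = x o_i (y o_j z) *)
Definition pcomp_seq A B C AB BC ABC (cAB : pcomp A B AB) (cAB_C : pcomp AB C ABC)
    (cBC : pcomp B C BC) (cA_BC : pcomp A BC ABC) :=
  forall u v u' v' t l w w' r q a b s
    (e1 : l = u ++ a :: v) (e2 : r = u ++ w ++ v)
    (e3 : r = (u ++ u') ++ b :: (v' ++ v)) (e4 : q = (u ++ u') ++ t ++ (v' ++ v))
    (e5 : w = u' ++ b :: v') (e6 : w' = u' ++ t ++ v')
    (e7 : q = u ++ w' ++ v) (x : A l s) (y : B w a) (z : C t b),
    cAB_C _ _ _ _ _ _ _ e3 e4 (cAB _ _ _ _ _ _ _ e1 e2 x y) z =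
    cA_BC _ _ _ _ _ _ _ e1 e7 x (cBC _ _ _ _ _ _ _ e5 e6 y z).

(* (x o_i y) o_(k - 1 + m) z = (x o_k z) o_i y for i < k, where y has m inputs *)
Definition pcomp_par A B C AB AC ABC (cAB : pcomp A B AB) (cAB_C : pcomp AB C ABC)
    (cAC : pcomp A C AC) (cAC_B : pcomp AC B ABC) :=
  forall u v t p q l r1 r2 r a b s
    (e1 : l = u ++ a :: (v ++ b :: t)) (e2 : r1 = u ++ p ++ (v ++ b :: t))
    (e3 : r1 = (u ++ p ++ v) ++ b :: t) (e4 : r = (u ++ p ++ v) ++ q ++ t)
    (e5 : l = (u ++ a :: v) ++ b :: t) (e6 : r2 = (u ++ a :: v) ++ q ++ t)
    (e7 : r2 = u ++ a :: (v ++ q ++ t)) (e8 : r = u ++ p ++ (v ++ q ++ t))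
    (x : A l s) (y : B p a) (z : C q b),
    cAB_C _ _ _ _ _ _ _ e3 e4 (cAB _ _ _ _ _ _ _ e1 e2 x y) z =
    cAC_B _ _ _ _ _ _ _ e7 e8 (cAC _ _ _ _ _ _ _ e5 e6 x z) y.

Definition pcomp_unitl A B (unit : forall s, A [:: s] s) (c : pcomp A B B) :=
  forall l s (e1 : [:: s] = [::] ++ s :: [::]) (e2 : l = [::] ++ l ++ [::])
    (x : B l s), c _ _ _ _ _ _ _ e1 e2 (unit s) x = x.

Definition pcomp_unitr A B (unit : forall s, B [:: s] s) (c : pcomp A B A) :=
  forall u v l a s (e1 : l = u ++ a :: v) (e2 : l = u ++ [:: a] ++ v)
    (x : A l s), c _ _ _ _ _ _ _ e1 e2 x (unit a) = x.

End PartialCompositions.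

Record operad (S : Type) := Operad {
  op_space :> seq S -> S -> space ;
  op_unit : forall s, op_space [:: s] s ;
  op_comp : pcomp op_space op_space op_space ;
  op_continuous : pcomp_continuous op_comp ;
  op_seq : pcomp_seq op_comp op_comp op_comp op_comp ;
  op_par : pcomp_par op_comp op_comp op_comp op_comp ;
  op_unitl : pcomp_unitl op_unit op_comp ;
  op_unitr : pcomp_unitr op_unit op_comp }.

Record operad_map (S : Type) (O P : operad S) := OperadMap {
  opm_fun :> forall l s, O l s -> P l s ;
  opm_continuous : forall l s, continuous (@opm_fun l s) ;
  opm_unit : forall s, opm_fun (op_unit O s) = op_unit P s ;
  opm_comp : forall u v w l r a s (e1 : l = u ++ a :: v) (e2 : r = u ++ w ++ v)
    (x : O l s) (y : O w a),
    opm_fun (op_comp e1 e2 x y) =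
    op_comp e1 e2 (opm_fun x) (opm_fun y) }.

(* [ib_lcomp] is o |-> x o_i m (infinitesimal left action) and [ib_rcomp] is
   m o^i x (right action). *)
Record ibimod (S : Type) (O : operad S) := Ibimod {
  ib_space :> seq S -> S -> space ;
  ib_lcomp : pcomp O ib_space ib_space ;
  ib_rcomp : pcomp ib_space O ib_space ;
  ib_lcontinuous : pcomp_continuous ib_lcomp ;
  ib_rcontinuous : pcomp_continuous ib_rcomp ;
  ib_seq_l : pcomp_seq ib_rcomp ib_rcomp (@op_comp S O) ib_rcomp ;
  ib_seq_m : pcomp_seq ib_lcomp ib_rcomp ib_rcomp ib_lcomp ;
  ib_seq_r : pcomp_seq (@op_comp S O) ib_lcomp ib_lcomp ib_lcomp ;
  ib_par_l : pcomp_par ib_rcomp ib_rcomp ib_rcomp ib_rcomp ;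
  ib_par_m : pcomp_par ib_lcomp ib_rcomp (@op_comp S O) ib_lcomp ;
  ib_par_r : pcomp_par (@op_comp S O) ib_lcomp ib_lcomp ib_rcomp ;
  ib_unitl : pcomp_unitl (@op_unit S O) ib_lcomp ;
  ib_unitr : pcomp_unitr (@op_unit S O) ib_rcomp }.

Section IbimodMaps.
Variables (S : Type) (O : operad S).
Implicit Types M N : ibimod O.

Definition ibimod_law M N
    : set (forall i : seq S * S, M i.1 i.2 -> N i.1 i.2) :=
  [set f |
    (forall u v w l r a s (e1 : l = u ++ a :: v) (e2 : r = u ++ w ++ v)
       (x : O l s) (m : M w a),
       f (r, s) (ib_lcomp e1 e2 x m) = ib_lcomp e1 e2 x (f (w, a) m)) /\
    (forall u v w l r a s (e1 : l = u ++ a :: v) (e2 : r = u ++ w ++ v)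
       (m : M l s) (x : O w a),
       f (r, s) (ib_rcomp e1 e2 m x) = ib_rcomp e1 e2 (f (l, s) m) x)].

(* The space of maps of infinitesimal bimodules; its points are the
   morphisms of the category Ibimod_O. *)
Definition Ibimod_map M N : space := map_space (@ibimod_law M N).

End IbimodMaps.

Section Derived.
Variables (R : realType) (S : Type) (O : operad S).
Implicit Types M N A : ibimod O.

Definition ib_weq M N (f : Ibimod_map M N) :=
  forall i, weak_equivalence R (mapf f i).

Definition ib_fib M N (f : Ibimod_map M N) :=
  forall i, serre_fibration R (mapf f i).

(* The initial infinitesimal bimodule is empty, so an object is cofibrant when
   maps out of it lift along all trivial fibrations. *)
Definition ib_cofibrant M :=
  forall (X Y : ibimod O) (p : Ibimod_map X Y) (g : Ibimod_map M Y),
    ib_fib p -> ib_weq p ->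
    exists h : Ibimod_map M X, forall i x, mapf p i (mapf h i x) = mapf g i x.

Record cofibrant_replacement A := CofibrantReplacement {
  cr_obj : ibimod O ;
  cr_map : Ibimod_map cr_obj A ;
  cr_cofibrant : ib_cofibrant cr_obj ;
  cr_weq : ib_weq cr_map }.

(* The derived mapping space is only defined up to weak equivalence; this is the
   model of it given by the cofibrant replacement [Q] of the source. *)
Definition Ibimod_h A (Q : cofibrant_replacement A) M : space :=
  Ibimod_map (cr_obj Q) M.

End Derived.

Lemma kify_continuous (T U : topologicalType) (f : T -> U) :
  continuous f -> continuous (f : kify T -> kify U).
Proof.
move=> cf; apply/continuousP => A; rewrite !kify_openE => oA K cK.
have cfK : compact (f @` K).
  by apply: continuous_compact => //; exact: continuous_subspaceT.
have /open_subspaceP[W oW WA] := oA _ cfK.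
apply/open_subspaceP; exists (f @^-1` W); first exact: ((continuousP _).1 cf).
apply/seteqP; split=> x [Wx Kx]; split=> //=.
  by have [] : (A `&` f @` K) (f x) by rewrite -WA; split=> //; exists x.
by have [] : (W `&` f @` K) (f x) by rewrite WA; split=> //; exists x.
Qed.

Lemma kprod_continuous (X X' Y Y' : space) (f : X -> X') (g : Y -> Y') :
  continuous f -> continuous g ->
  continuous ((fun z => (f z.1, g z.2)) : kprod X Y -> kprod X' Y').
Proof.
move=> cf cg; apply: (@kify_continuous (X * Y)%type (X' * Y')%type).
move=> z; apply: cvg_pair.
  by apply: (@continuous_comp (X * Y)%type X X' fst f); [exact: cvg_fst|exact: cf].
by apply: (@continuous_comp (X * Y)%type Y Y' snd g); [exact: cvg_snd|exact: cg].
Qed.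

Section UnderOperad.
Variables (S : Type) (O P : operad S) (phi : operad_map O P).

Definition under_lcomp : pcomp O P P :=
  fun u v w l r a s e1 e2 x y => op_comp e1 e2 (phi _ _ x) y.

Definition under_rcomp : pcomp P O P :=
  fun u v w l r a s e1 e2 x y => op_comp e1 e2 x (phi _ _ y).

Lemma under_lcontinuous : pcomp_continuous under_lcomp.
Proof.
move=> u v w l r a s e1 e2 z.
apply: (@continuous_comp (kprod (O l s) (P w a)) (kprod (P l s) (P w a)) _
  (fun z => (phi _ _ z.1, z.2)) (fun z => op_comp e1 e2 z.1 z.2)).
  apply: (@kprod_continuous _ _ _ _ (phi l s) id); last by move=> ?.
  exact: opm_continuous.
exact: op_continuous.
Qed.

Lemma under_rcontinuous : pcomp_continuous under_rcomp.
Proof.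
move=> u v w l r a s e1 e2 z.
apply: (@continuous_comp (kprod (P l s) (O w a)) (kprod (P l s) (P w a)) _
  (fun z => (z.1, phi _ _ z.2)) (fun z => op_comp e1 e2 z.1 z.2)).
  apply: (@kprod_continuous _ _ _ _ id (phi w a)); first by move=> ?.
  exact: opm_continuous.
exact: op_continuous.
Qed.

Definition under_ibimod : ibimod O.
Proof.
apply: (@Ibimod S O P under_lcomp under_rcomp under_lcontinuous
  under_rcontinuous).
- abstract (by move=> *; rewrite /under_rcomp opm_comp; exact: op_seq).
- abstract (by move=> *; exact: op_seq).
- abstract (by move=> *; rewrite /under_lcomp opm_comp; exact: op_seq).
- abstract (by move=> *; exact: op_par).
- abstract (by move=> *; rewrite /under_lcomp opm_comp; exact: op_par).
- abstract (by move=> *; rewrite /under_lcomp opm_comp; exact: op_par).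
- abstract (by move=> l s e1 e2 x; rewrite /under_lcomp opm_unit; exact: op_unitl).
- abstract (by move=> u v l a s e1 e2 x; rewrite /under_rcomp opm_unit; exact: op_unitr).
Defined.

End UnderOperad.

Section Restriction.
Variables (S' S : Type) (f : S' -> S).

Lemma map_splice u (a : S') v l :
  l = u ++ a :: v -> map f l = map f u ++ f a :: map f v.
Proof. by move=> ->; rewrite map_cat. Qed.

Lemma map_splices u w v r :
  r = u ++ w ++ v -> map f r = map f u ++ map f w ++ map f v.
Proof. by move=> ->; rewrite !map_cat. Qed.

Definition restr_pcomp (A B C : seq S -> S -> space) (c : pcomp A B C) :
  pcomp (fun l s => A (map f l) (f s)) (fun l s => B (map f l) (f s))
        (fun l s => C (map f l) (f s)) :=
  fun u v w l r a s e1 e2 x y =>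
    c _ _ _ _ _ _ _ (map_splice e1) (map_splices e2) x y.

Lemma restr_continuous A B C (c : pcomp A B C) :
  pcomp_continuous c -> pcomp_continuous (restr_pcomp c).
Proof. by move=> cc u v w l r a s e1 e2; apply: cc. Qed.

Lemma restr_seq A B C AB BC ABC (cAB : pcomp A B AB) (cAB_C : pcomp AB C ABC)
    (cBC : pcomp B C BC) (cA_BC : pcomp A BC ABC) :
  pcomp_seq cAB cAB_C cBC cA_BC ->
  pcomp_seq (restr_pcomp cAB) (restr_pcomp cAB_C) (restr_pcomp cBC)
            (restr_pcomp cA_BC).
Proof.
move=> h u v u' v' t l w w' r q a b s e1 e2 e3 e4 e5 e6 e7 x y z.
rewrite /restr_pcomp.
move: (map_splice e3) (map_splices e4); rewrite !map_cat => e3' e4'.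
exact: h.
Qed.

Lemma restr_par A B C AB AC ABC (cAB : pcomp A B AB) (cAB_C : pcomp AB C ABC)
    (cAC : pcomp A C AC) (cAC_B : pcomp AC B ABC) :
  pcomp_par cAB cAB_C cAC cAC_B ->
  pcomp_par (restr_pcomp cAB) (restr_pcomp cAB_C) (restr_pcomp cAC)
            (restr_pcomp cAC_B).
Proof.
move=> h u v t p q l r1 r2 r a b s e1 e2 e3 e4 e5 e6 e7 e8 x y z.
rewrite /restr_pcomp.
move: (map_splice e1) (map_splices e2) (map_splice e3) (map_splices e4)
  (map_splice e5) (map_splices e6) (map_splice e7) (map_splices e8).
rewrite !map_cat /= ?map_cat /=.
by move=> *; exact: h.
Qed.

Definition restr_operad (O : operad S) : operad S'.
Proof.
apply: (@Operad S' (fun l s => O (map f l) (f s)) (fun s => op_unit O (f s))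
  (restr_pcomp (@op_comp S O))).
- abstract (exact/restr_continuous/op_continuous).
- abstract (exact/restr_seq/op_seq).
- abstract (exact/restr_par/op_par).
- abstract (by move=> l s e1 e2 x; exact: op_unitl).
- abstract (by move=> u v l a s e1 e2 x; exact: op_unitr).
Defined.

Definition restr_operad_map (O P : operad S) (phi : operad_map O P) :
  operad_map (restr_operad O) (restr_operad P).
Proof.
apply: (@OperadMap S' (restr_operad O) (restr_operad P)
  (fun l s => phi (map f l) (f s))).
- abstract (by move=> l s; exact: (@opm_continuous _ _ _ phi (map f l) (f s))).
- abstract (by move=> s; exact: (@opm_unit _ _ _ phi (f s))).
- move=> u v w l r a s e1 e2 x y.
  exact: (opm_comp phi (map_splice e1) (map_splices e2) x y).
Defined.

Definition restr_ibimod (O : operad S) (M : ibimod O) : ibimod (restr_operad O).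
Proof.
apply: (@Ibimod S' (restr_operad O) (fun l s => M (map f l) (f s))
  (restr_pcomp (@ib_lcomp S O M)) (restr_pcomp (@ib_rcomp S O M))).
- abstract (exact/restr_continuous/ib_lcontinuous).
- abstract (exact/restr_continuous/ib_rcontinuous).
- abstract (exact/restr_seq/ib_seq_l).
- abstract (exact/restr_seq/ib_seq_m).
- abstract (exact/restr_seq/ib_seq_r).
- abstract (exact/restr_par/ib_par_l).
- abstract (exact/restr_par/ib_par_m).
- abstract (exact/restr_par/ib_par_r).
- abstract (by move=> l s e1 e2 x; exact: ib_unitl).
- abstract (by move=> u v l a s e1 e2 x; exact: ib_unitr).
Defined.

End Restriction.

Section PointOperad.
Variables (S : Type) (P : seq S -> S -> Prop).

Definition pt_if_set (Q : Prop) : set bool := [set b | b = true /\ Q].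

Lemma pt_if_eq Q (x y : pt_if_set Q) : x = y.
Proof.
by apply: val_inj; have [-> _] := set_valP x; have [-> _] := set_valP y.
Qed.

Lemma pt_if_hausdorff Q : hausdorff_space (pt_if_set Q).
Proof. by move=> x y _; exact: pt_if_eq. Qed.

Lemma pt_if_cg Q : compactly_generated (pt_if_set Q).
Proof.
apply: compact_cg => F PF FT; have [x _] := filter_ex FT.
exists x; split=> // A B FA nB; have [y Ay] := filter_ex FA.
by exists x; split; [rewrite (pt_if_eq x y)|exact: nbhs_singleton].
Qed.

(* A point if [Q] holds, and the empty space otherwise. *)
Definition pt_if (Q : Prop) : space := Space (@pt_if_hausdorff Q) (@pt_if_cg Q).

Definition pt (Q : Prop) (q : Q) : pt_if Q :=
  exist _ true (mem_set (conj erefl q : pt_if_set Q true)).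

Lemma pt_ifP Q (x : pt_if Q) : Q.
Proof. by have [] := set_valP x. Qed.

Lemma pt_if_continuous (T : topologicalType) Q (g : T -> pt_if Q) : continuous g.
Proof.
move=> x; suff -> : g = cst (g x) by exact: cst_continuous.
by apply/funext => y; exact: pt_if_eq.
Qed.

Hypothesis P_unit : forall s, P [:: s] s.
Hypothesis P_comp : forall u v w a s,
  P (u ++ a :: v) s -> P w a -> P (u ++ w ++ v) s.

Lemma point_comp_subproof u v w l r a s :
  l = u ++ a :: v -> r = u ++ w ++ v -> P l s -> P w a -> P r s.
Proof. by move=> -> ->; exact: P_comp. Qed.

(* The operad with O(l; s) a point when [P l s] and empty otherwise. *)
Definition point_operad : operad S.
Proof.
apply: (@Operad S (fun l s => pt_if (P l s)) (fun s => pt (P_unit s))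
  (fun u v w l r a s e1 e2 x y =>
     pt (point_comp_subproof e1 e2 (pt_ifP x) (pt_ifP y)))).
- abstract (by move=> *; exact: pt_if_continuous).
- abstract (by move=> *; exact: pt_if_eq).
- abstract (by move=> *; exact: pt_if_eq).
- abstract (by move=> *; exact: pt_if_eq).
- abstract (by move=> *; exact: pt_if_eq).
Defined.

End PointOperad.

Section PointOperadMap.
Variables (S : Type) (P P' : seq S -> S -> Prop).
Variables (P1 : forall s, P [:: s] s)
  (PC : forall u v w a s, P (u ++ a :: v) s -> P w a -> P (u ++ w ++ v) s)
  (P1' : forall s, P' [:: s] s)
  (PC' : forall u v w a s, P' (u ++ a :: v) s -> P' w a -> P' (u ++ w ++ v) s).
Hypothesis PP' : forall l s, P l s -> P' l s.

Definition point_operad_map :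
  operad_map (point_operad P1 PC) (point_operad P1' PC').
Proof.
apply: (@OperadMap S (point_operad P1 PC) (point_operad P1' PC')
  (fun l s x => pt (PP' (pt_ifP x)))).
- abstract (by move=> *; exact: pt_if_continuous).
- abstract (by move=> *; exact: pt_if_eq).
- abstract (by move=> *; exact: pt_if_eq).
Defined.

End PointOperadMap.

Variant color := colO | colC.

Definition act_arity (l : seq color) (s : color) : Prop :=
  match s with
  | colC => exists n, l = nseq n colC
  | colO => exists n, l = rcons (nseq n colC) colO
  end.

Definition act_pos_arity (l : seq color) (s : color) : Prop :=
  act_arity l s /\ (0 < size l)%N.

Lemma nseq_catP n u (a : color) v : nseq n colC = u ++ a :: v ->
  [/\ u = nseq (size u) colC, a = colC & v = nseq (size v) colC].
Proof.
elim: u n => [|b u IH] [|n] //= [].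
  by move=> <- <-; rewrite size_nseq.
by move=> <- /IH[<- -> <-].
Qed.

Lemma act_arity_comp u v w a s :
  act_arity (u ++ a :: v) s -> act_arity w a -> act_arity (u ++ w ++ v) s.
Proof.
case: s => /= -[n e].
- case/lastP: v e => [|v b].
    rewrite cats1 cats0 => /rcons_inj[-> ->] [m ->].
    by exists (n + m)%N; rewrite -rcons_cat -nseqD.
  rewrite -rcons_cons -rcons_cat => /rcons_inj[/esym/nseq_catP[-> -> ->] ->].
  move=> [m ->]; exists (size u + (m + size v))%N.
  by rewrite !nseqD !rcons_cat.
- have [-> -> ->] := nseq_catP (esym e); move=> [m ->].
  by exists (size u + (m + size v))%N; rewrite !nseqD.
Qed.

Lemma act_arity_unit s : act_arity [:: s] s.
Proof. by case: s; [exists 0%N|exists 1%N]. Qed.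

Lemma act_pos_arity_comp u v w a s :
  act_pos_arity (u ++ a :: v) s -> act_pos_arity w a ->
  act_pos_arity (u ++ w ++ v) s.
Proof.
move=> [h _] [hw w0]; split; first exact: act_arity_comp h hw.
by rewrite !size_cat addnC -addnA addn_gt0 w0.
Qed.

Lemma act_pos_arity_unit s : act_pos_arity [:: s] s.
Proof. by split; [exact: act_arity_unit|]. Qed.

Definition Act : operad color := point_operad act_arity_unit act_arity_comp.

Definition Act_pos : operad color :=
  point_operad act_pos_arity_unit act_pos_arity_comp.

Definition Act_pos_incl : operad_map Act_pos Act :=
  @point_operad_map _ _ _ _ _ _ _ (fun l s => @proj1 _ _).

Definition Act_ib : ibimod Act_pos := under_ibimod Act_pos_incl.

Definition to_c (_ : unit) : color := colC.

Definition As : operad unit := restr_operad to_c Act.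
Definition As_pos : operad unit := restr_operad to_c Act_pos.

Definition As_pos_incl : operad_map As_pos As :=
  restr_operad_map to_c Act_pos_incl.

Definition As_ib : ibimod As_pos := under_ibimod As_pos_incl.

(* M_c, with component M(n; c) at the list [nseq n tt]. *)
Definition restr_c (M : ibimod Act_pos) : ibimod As_pos := restr_ibimod to_c M.

Record semicosimplicial := SemiCosimplicial {
  sc_space :> nat -> space ;
  sc_d : forall n, 'I_n.+2 -> sc_space n -> sc_space n.+1 ;
  sc_continuous : forall n i, continuous (@sc_d n i) ;
  (* d^j d^i = d^i d^(j - 1) for i < j *)
  sc_law : forall n (i : 'I_n.+2) (j : 'I_n.+3) (i' : 'I_n.+3) (j' : 'I_n.+2)
    (x : sc_space n),
    (i < j)%N -> i' = i :> nat -> j = j'.+1 :> nat ->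
    sc_d j (sc_d i x) = sc_d i' (sc_d j' x) }.

Definition sc_map_law (X Y : semicosimplicial) : set (forall n, X n -> Y n) :=
  [set f | forall n (i : 'I_n.+2) x, f n.+1 (sc_d i x) = sc_d i (f n x)].

Section Simplices.
Variable R : realType.

Definition simplex_set (n : nat) : set 'rV[R]_n.+1 :=
  [set x | (forall i, 0 <= x ord0 i) /\ \sum_i x ord0 i = 1].

Lemma simplex_compact n : compact (@simplex_set n).
Proof.
have cI : compact [set v : 'rV[R]_n.+1 | forall i, `[0, 1]%classic (v ord0 i)].
  have := @rV_compact R n.+1 (fun=> [set` `[0, 1]]).
  by apply=> _; exact: segment_compact.
apply: subclosed_compact cI _; last first.
  move=> x [x0 x1] i; rewrite /= in_itv /= x0 /= -x1 (bigD1 i) //= lerDl.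
  by apply: sumr_ge0.
have -> : @simplex_set n =
    (\bigcap_i ((fun x : 'rV[R]_n.+1 => x ord0 i) @^-1` [set y | 0 <= y])) `&`
    ((fun x : 'rV[R]_n.+1 => \sum_i x ord0 i) @^-1` [set y | y = 1]).
  by apply/seteqP; split=> x [x0 x1]; split=> // i; [move=> _|]; exact: x0.
apply: closedI.
  apply: closed_bigI => i _; apply: preimage_closed; last exact: closed_ge.
  by move=> x _; exact: coord_continuous.
apply: preimage_closed; last exact: closed_eq.
move=> x _; apply: (cvg_big (@add_continuous _) (nbhs_filter x)) => i _.
exact: coord_continuous.
Qed.

Lemma simplex_hausdorff n : hausdorff_space (@simplex_set n).
Proof. by apply: set_type_hausdorff; exact: norm_hausdorff. Qed.

Lemma simplex_cg n : compactly_generated (@simplex_set n).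
Proof. by apply/compact_cg/compact_set_type; exact: simplex_compact. Qed.

Definition simplex (n : nat) : space :=
  Space (@simplex_hausdorff n) (@simplex_cg n).

Definition simplex_val n (x : simplex n) : 'rV[R]_n.+1 :=
  set_val (x : @simplex_set n).

Lemma simplex_val_inj n : injective (@simplex_val n).
Proof. by move=> x y; exact: val_inj. Qed.

(* The i-th face inclusion: a coordinate 0 is inserted at position i. *)
Definition face_row n (i : 'I_n.+2) (x : 'rV[R]_n.+1) : 'rV[R]_n.+2 :=
  \row_j (if unlift i j is Some k then x ord0 k else 0).

Lemma face_subproof n (i : 'I_n.+2) (x : simplex n) :
  @simplex_set n.+1 (face_row i (simplex_val x)).
Proof.
have [x0 x1] := set_valP (x : @simplex_set n); split=> [j|].
  by rewrite mxE; case: unlift.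
rewrite (bigD1_ord i) //= mxE unlift_none add0r -[RHS]x1.
by apply: eq_bigr => k _; rewrite mxE liftK.
Qed.

Definition face n (i : 'I_n.+2) (x : simplex n) : simplex n.+1 :=
  (exist _ (face_row i (simplex_val x)) (mem_set (face_subproof i x))
    : @simplex_set n.+1).

Lemma face_continuous n (i : 'I_n.+2) : continuous (@face n i).
Proof.
apply: continuous_comp_initial.
have cf : continuous (@face_row n i).
  move=> x B [P Px PB].
  have : \forall y \near x, forall j, P ord0 j (face_row i y ord0 j).
    apply: (@filter_forall _ _ _ _ (nbhs_filter x)) => j; have := Px ord0 j; rewrite !mxE.
    case e : (unlift i j) => [k|] Pj.
      apply: (@filterS _ _ (nbhs_filter x) _ _ _ (coord_continuous Pj)) => y Py.
      by rewrite mxE e.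
    by apply: (@filterE _ _ (nbhs_filter x)) => y; rewrite mxE e; exact: nbhs_singleton.
  by apply: (@filterS _ _ (nbhs_filter x)) => y Py; apply: PB => a b; rewrite (ord1 a).
move=> x; apply: (@continuous_comp _ _ _ (@simplex_val n) (@face_row n i)).
  exact: initial_continuous.
exact: cf.
Qed.

Lemma face_law n (i : 'I_n.+2) (j : 'I_n.+3) (i' : 'I_n.+3) (j' : 'I_n.+2)
    (x : simplex n) :
  (i < j)%N -> i' = i :> nat -> j = j'.+1 :> nat ->
  face j (face i x) = face i' (face j' x).
Proof.
move=> ij ei ej; apply: simplex_val_inj; apply/rowP => m.
rewrite /simplex_val /= !mxE.
case: (unliftP j m) => [k mk|mj].
  rewrite mxE; case: (unliftP i k) => [p kp|ki].
    have -> : m = lift i' (lift j' p).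
      apply: val_inj; rewrite mk kp /= /bump ei ej; move: (p : nat) ij => q.
      by rewrite ej ltnS => ij'; lia.
    by rewrite liftK mxE liftK.
  have -> : m = i'.
    by apply: val_inj; rewrite mk ki /= ei /bump; lia.
  by rewrite unlift_none.
have -> : m = lift i' j' by apply: val_inj; rewrite mj /= /bump ei; lia.
by rewrite liftK mxE unlift_none.
Qed.

Definition Delta : semicosimplicial :=
  SemiCosimplicial face_continuous face_law.

Definition sTot (X : semicosimplicial) : space :=
  map_space (@sc_map_law Delta X).

End Simplices.

Lemma unit_seq_eq (l l' : seq unit) : size l = size l' -> l = l'.
Proof. by elim: l l' => [|[] l IH] [|[] l'] //= [/IH ->]. Qed.

Definition star2_arity : act_pos_arity [:: colC; colC] colC :=
  conj (ex_intro _ 2%N erefl) isT.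

Definition star2 : As_pos [:: tt; tt] tt := pt star2_arity.

Section Cosimplicial.
Variable N : ibimod As_pos.

Definition cosimp_space (n : nat) : space := N (nseq n tt) tt.

Lemma cosimp_left_subproof n :
  nseq n.+1 tt = [:: tt] ++ nseq n tt ++ [::].
Proof. by rewrite cats0. Qed.

Lemma cosimp_right_subproof n :
  nseq n.+1 tt = [::] ++ nseq n tt ++ [:: tt].
Proof. by apply: unit_seq_eq; rewrite /= size_cat /= size_nseq addn1. Qed.

Lemma cosimp_inner1_subproof n k : (k < n)%N ->
  nseq n tt = nseq k tt ++ tt :: nseq (n - k.+1) tt.
Proof.
by move=> kn; apply: unit_seq_eq; rewrite size_cat /= !size_nseq; lia.
Qed.

Lemma cosimp_inner2_subproof n k : (k < n)%N ->
  nseq n.+1 tt = nseq k tt ++ [:: tt; tt] ++ nseq (n - k.+1) tt.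
Proof.
by move=> kn; apply: unit_seq_eq; rewrite !size_cat /= !size_nseq; lia.
Qed.

(* star2 o_2 x *)
Definition d_first n (x : cosimp_space n) : cosimp_space n.+1 :=
  ib_lcomp (erefl : [:: tt; tt] = [:: tt] ++ tt :: [::])
    (cosimp_left_subproof n) star2 x.

(* star2 o_1 x *)
Definition d_last n (x : cosimp_space n) : cosimp_space n.+1 :=
  ib_lcomp (erefl : [:: tt; tt] = [::] ++ tt :: [:: tt])
    (cosimp_right_subproof n) star2 x.

(* x o^(k+1) star2 *)
Definition d_inner n k (kn : (k < n)%N) (x : cosimp_space n) :
    cosimp_space n.+1 :=
  ib_rcomp (cosimp_inner1_subproof kn) (cosimp_inner2_subproof kn) x star2.

Definition coface n (i : 'I_n.+2) (x : cosimp_space n) : cosimp_space n.+1 :=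
  match nat_of_ord i with
  | 0 => d_first x
  | k.+1 => if pselect (k < n)%N is left kn then d_inner kn x else d_last x
  end.

Lemma lcomp_congr l w r u v u' v'
    (e1 : l = u ++ tt :: v) (e2 : r = u ++ w ++ v)
    (e1' : l = u' ++ tt :: v') (e2' : r = u' ++ w ++ v')
    (y y' : As_pos l tt) (x x' : N w tt) :
  x = x' -> size u = size u' -> ib_lcomp e1 e2 y x = ib_lcomp e1' e2' y' x'.
Proof.
move=> -> /unit_seq_eq uu; subst u'.
have vv : v = v'.
  apply: unit_seq_eq; have := congr1 size e1; rewrite {1}e1' !size_cat /=; lia.
subst v'; rewrite (eq_irrelevance e1 e1') (eq_irrelevance e2 e2').
by rewrite (pt_if_eq y y').
Qed.

Lemma rcomp_congr l w r u v u' v'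
    (e1 : l = u ++ tt :: v) (e2 : r = u ++ w ++ v)
    (e1' : l = u' ++ tt :: v') (e2' : r = u' ++ w ++ v')
    (y y' : As_pos w tt) (x x' : N l tt) :
  x = x' -> size u = size u' -> ib_rcomp e1 e2 x y = ib_rcomp e1' e2' x' y'.
Proof.
move=> -> /unit_seq_eq uu; subst u'.
have vv : v = v'.
  apply: unit_seq_eq; have := congr1 size e1; rewrite {1}e1' !size_cat /=; lia.
subst v'; rewrite (eq_irrelevance e1 e1') (eq_irrelevance e2 e2').
by rewrite (pt_if_eq y y').
Qed.

Lemma cofaceE0 n (i : 'I_n.+2) x : i = 0%N :> nat -> coface i x = d_first x.
Proof. by rewrite /coface => ->. Qed.

Lemma cofaceEi n (i : 'I_n.+2) k (kn : (k < n)%N) x :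
  i = k.+1 :> nat -> coface i x = d_inner kn x.
Proof.
rewrite /coface => ->; case: pselect => // kn'.
by rewrite (bool_irrelevance kn' kn).
Qed.

Lemma cofaceEl n (i : 'I_n.+2) x : i = n.+1 :> nat -> coface i x = d_last x.
Proof. by rewrite /coface => ->; case: pselect => // h; exfalso; move: h; rewrite ltnn. Qed.

Lemma space_kcontinuous (X : space) (T : topologicalType) (f : X -> T) :
  continuous f -> continuous (f : X -> kify T).
Proof.
move=> cf; apply/continuousP => A oA; apply: space_cg => K cK.
have /continuousP := kify_continuous cf; move=> /(_ _ oA).
by rewrite kify_openE; exact.
Qed.

Lemma kprod_pairl_continuous (X Y : space) (x : X) :
  continuous ((fun y => (x, y)) : Y -> kprod X Y).
Proof.
apply: (@space_kcontinuous Y (X * Y)%type) => y.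
by apply: cvg_pair; [exact: cvg_cst|exact: cvg_id].
Qed.

Lemma kprod_pairr_continuous (X Y : space) (y : Y) :
  continuous ((fun x => (x, y)) : X -> kprod X Y).
Proof.
apply: (@space_kcontinuous X (X * Y)%type) => x.
by apply: cvg_pair; [exact: cvg_id|exact: cvg_cst].
Qed.

Lemma coface_continuous n (i : 'I_n.+2) : continuous (@coface n i).
Proof.
have cl l u v w r (e1 : l = u ++ tt :: v) (e2 : r = u ++ w ++ v) y :
    continuous (ib_lcomp e1 e2 y : N w tt -> N r tt).
  move=> x; apply: (@continuous_comp (N w tt) (kprod (As_pos l tt) (N w tt)) (N r tt)
    (fun x => (y, x))
    (fun z : kprod (As_pos l tt) (N w tt) => ib_lcomp e1 e2 z.1 z.2)).
    exact: kprod_pairl_continuous.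
  exact: ib_lcontinuous.
have cr l u v w r (e1 : l = u ++ tt :: v) (e2 : r = u ++ w ++ v)
    (y : As_pos w tt) :
    continuous ((fun x => ib_rcomp e1 e2 x y) : N l tt -> N r tt).
  move=> x; apply: (@continuous_comp (N l tt) (kprod (N l tt) (As_pos w tt)) (N r tt)
    (fun x => (x, y))
    (fun z : kprod (N l tt) (As_pos w tt) => ib_rcomp e1 e2 z.1 z.2)).
    exact: kprod_pairr_continuous.
  exact: ib_rcontinuous.
rewrite /coface; case: (nat_of_ord i) => [|k]; first exact: cl.
by case: pselect => kn; [exact: cr|exact: cl].
Qed.

Section Laws.
Variable n : nat.
Implicit Type x : cosimp_space n.

Ltac usz := apply: unit_seq_eq; rewrite ?(size_cat, size_nseq) /=
  ?(size_cat, size_nseq) /= ?(size_cat, size_nseq) /=; lia.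
Ltac usz2 := rewrite ?(size_cat, size_nseq) /= ?(size_cat, size_nseq) /=; lia.

Lemma d_first_first (h : (0 < n.+1)%N) x :
  d_inner h (d_first x) = d_first (d_first x).
Proof.
have ax1 := @ib_par_r _ _ N [::] [::] [::] [:: tt; tt] (nseq n tt) [:: tt; tt]
  [:: tt; tt; tt] (nseq n.+1 tt) (nseq n.+2 tt) tt tt tt
  ltac:(usz) ltac:(usz) ltac:(usz) ltac:(usz) ltac:(usz) ltac:(usz) ltac:(usz) ltac:(usz)
  star2 star2 x.
have ax2 := @ib_seq_r _ _ N [:: tt] [::] [:: tt] [::] (nseq n tt) [:: tt; tt] [:: tt; tt]
  (nseq n.+1 tt) [:: tt; tt; tt] (nseq n.+2 tt) tt tt tt
  ltac:(usz) ltac:(usz) ltac:(usz) ltac:(usz) ltac:(usz) ltac:(usz) ltac:(usz)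
  star2 star2 x.
apply: (etrans _ (etrans (esym ax1) (etrans _ (etrans ax2 _)))).
- by apply: rcomp_congr; [apply: lcomp_congr => //; usz2|usz2].
- by apply: lcomp_congr => //; usz2.
- by apply: lcomp_congr; [apply: lcomp_congr => //; usz2|usz2].
Qed.

Lemma d_last_last (h : (n < n.+1)%N) x :
  d_last (d_last x) = d_inner h (d_last x).
Proof.
have ax1 := @ib_seq_r _ _ N [::] [:: tt] [::] [:: tt] (nseq n tt) [:: tt; tt] [:: tt; tt]
  (nseq n.+1 tt) [:: tt; tt; tt] (nseq n.+2 tt) tt tt tt
  ltac:(usz) ltac:(usz) ltac:(usz) ltac:(usz) ltac:(usz) ltac:(usz) ltac:(usz)
  star2 star2 x.
have ax2 := @ib_par_m _ _ N [::] [::] [::] (nseq n tt) [:: tt; tt] [:: tt; tt]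
  (nseq n.+1 tt) [:: tt; tt; tt] (nseq n.+2 tt) tt tt tt
  ltac:(usz) ltac:(usz) ltac:(usz) ltac:(usz) ltac:(usz) ltac:(usz) ltac:(usz) ltac:(usz)
  star2 x star2.
apply: (etrans _ (etrans (esym ax1) (etrans _ (etrans (esym ax2) _)))).
- by apply: lcomp_congr; [apply: lcomp_congr => //; usz2|usz2].
- by apply: lcomp_congr => //; usz2.
- by apply: rcomp_congr; [apply: lcomp_congr => //; usz2|usz2].
Qed.

Lemma d_first_last x : d_last (d_first x) = d_first (d_last x).
Proof.
have ax1 := @ib_seq_r _ _ N [::] [:: tt] [:: tt] [::] (nseq n tt) [:: tt; tt] [:: tt; tt]
  (nseq n.+1 tt) [:: tt; tt; tt] (nseq n.+2 tt) tt tt tt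
  ltac:(usz) ltac:(usz) ltac:(usz) ltac:(usz) ltac:(usz) ltac:(usz) ltac:(usz)
  star2 star2 x.
have ax2 := @ib_seq_r _ _ N [:: tt] [::] [::] [:: tt] (nseq n tt) [:: tt; tt] [:: tt; tt]
  (nseq n.+1 tt) [:: tt; tt; tt] (nseq n.+2 tt) tt tt tt
  ltac:(usz) ltac:(usz) ltac:(usz) ltac:(usz) ltac:(usz) ltac:(usz) ltac:(usz)
  star2 star2 x.
apply: (etrans _ (etrans (esym ax1) (etrans _ (etrans ax2 _)))).
- by apply: lcomp_congr; [apply: lcomp_congr => //; usz2|usz2].
- by apply: lcomp_congr => //; usz2.
- by apply: lcomp_congr; [apply: lcomp_congr => //; usz2|usz2].
Qed.

Lemma d_inner_first k (h : (k.+1 < n.+1)%N) (h' : (k < n)%N) x :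
  d_inner h (d_first x) = d_first (d_inner h' x).
Proof.
have ax := @ib_seq_m _ _ N [:: tt] [::] (nseq k tt) (nseq (n - k.+1) tt) [:: tt; tt] [:: tt; tt] (nseq n tt)
  (nseq n.+1 tt) (nseq n.+1 tt) (nseq n.+2 tt) tt tt tt
  ltac:(usz) ltac:(usz) ltac:(usz) ltac:(usz) ltac:(usz) ltac:(usz) ltac:(usz)
  star2 x star2.
apply: (etrans _ (etrans ax _)).
- by apply: rcomp_congr; [apply: lcomp_congr => //; usz2|usz2].
- by apply: lcomp_congr; [apply: rcomp_congr => //; usz2|usz2].
Qed.

Lemma d_inner_last k (h : (k < n.+1)%N) (h' : (k < n)%N) x :
  d_last (d_inner h' x) = d_inner h (d_last x).
Proof.
have ax := @ib_seq_m _ _ N [::] [:: tt] (nseq k tt) (nseq (n - k.+1) tt) [:: tt; tt] [:: tt; tt] (nseq n tt)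
  (nseq n.+1 tt) (nseq n.+1 tt) (nseq n.+2 tt) tt tt tt
  ltac:(usz) ltac:(usz) ltac:(usz) ltac:(usz) ltac:(usz) ltac:(usz) ltac:(usz)
  star2 x star2.
apply: (etrans _ (etrans (esym ax) _)).
- by apply: lcomp_congr; [apply: rcomp_congr => //; usz2|usz2].
- by apply: rcomp_congr; [apply: lcomp_congr => //; usz2|usz2].
Qed.

Lemma d_inner_same k (h : (k < n)%N) (h1 : (k.+1 < n.+1)%N)
    (h2 : (k < n.+1)%N) x :
  d_inner h1 (d_inner h x) = d_inner h2 (d_inner h x).
Proof.
have ax1 := @ib_seq_l _ _ N (nseq k tt) (nseq (n - k.+1) tt) [:: tt] [::] [:: tt; tt] (nseq n tt) [:: tt; tt]
  [:: tt; tt; tt] (nseq n.+1 tt) (nseq n.+2 tt) tt tt tt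
  ltac:(usz) ltac:(usz) ltac:(usz) ltac:(usz) ltac:(usz) ltac:(usz) ltac:(usz)
  x star2 star2.
have ax2 := @ib_seq_l _ _ N (nseq k tt) (nseq (n - k.+1) tt) [::] [:: tt] [:: tt; tt] (nseq n tt) [:: tt; tt]
  [:: tt; tt; tt] (nseq n.+1 tt) (nseq n.+2 tt) tt tt tt
  ltac:(usz) ltac:(usz) ltac:(usz) ltac:(usz) ltac:(usz) ltac:(usz) ltac:(usz)
  x star2 star2.
apply: (etrans _ (etrans ax1 (etrans _ (etrans (esym ax2) _)))).
- by apply: rcomp_congr; [apply: rcomp_congr => //; usz2|usz2].
- by apply: rcomp_congr => //; usz2.
- by apply: rcomp_congr; [apply: rcomp_congr => //; usz2|usz2].
Qed.

Lemma d_inner_inner k m (hk : (k < n)%N) (hm : (m < n)%N)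
    (hk' : (k < n.+1)%N) (hm' : (m.+1 < n.+1)%N) x : (k < m)%N ->
  d_inner hm' (d_inner hk x) = d_inner hk' (d_inner hm x).
Proof.
move=> km.
have ax := @ib_par_l _ _ N (nseq k tt) (nseq (m - k.+1) tt) (nseq (n - m.+1) tt) [:: tt; tt] [:: tt; tt] (nseq n tt)
  (nseq n.+1 tt) (nseq n.+1 tt) (nseq n.+2 tt) tt tt tt
  ltac:(usz) ltac:(usz) ltac:(usz) ltac:(usz) ltac:(usz) ltac:(usz) ltac:(usz) ltac:(usz)
  x star2 star2.
apply: (etrans _ (etrans ax _)).
- by apply: rcomp_congr; [apply: rcomp_congr => //; usz2|usz2].
- by apply: rcomp_congr; [apply: rcomp_congr => //; usz2|usz2].
Qed.

End Laws.

Lemma coface_law n (i : 'I_n.+2) (j : 'I_n.+3) (i' : 'I_n.+3) (j' : 'I_n.+2)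
    (x : cosimp_space n) :
  (i < j)%N -> i' = i :> nat -> j = j'.+1 :> nat ->
  coface j (coface i x) = coface i' (coface j' x).
Proof.
move=> ij ei ej; have := ltn_ord i; have := ltn_ord j.
case ni : (nat_of_ord i) ij ei => [|k] ij ei jn i_n.
  rewrite (cofaceE0 _ ni) (cofaceE0 _ ei).
  case nj : (nat_of_ord j') ej => [|m] ej.
    rewrite (cofaceE0 _ nj) (@cofaceEi n.+1 _ 0 isT _ ej).
    exact: d_first_first.
  have [mn|nm] := ltnP m n.
    rewrite (cofaceEi mn _ nj) (@cofaceEi n.+1 _ m.+1 mn _ ej).
    exact: d_inner_first.
  have {}nm : m = n by lia.
  subst m; rewrite (cofaceEl _ nj) (cofaceEl _ ej).
  exact: d_first_last.
have [kn|nk] := ltnP k n.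
  have kn' : (k < n.+1)%N by lia.
  rewrite (cofaceEi kn _ ni) (cofaceEi kn' _ ei).
  case nj : (nat_of_ord j') ej => [|m] ej; first by lia.
  have [mn|nm] := ltnP m n.
    have mn' : (m.+1 < n.+1)%N by lia.
    rewrite (cofaceEi mn _ nj) (cofaceEi mn' _ ej).
    have [km|mk] := ltnP k m; first exact: d_inner_inner.
    have mk' : m = k by lia.
    subst m; rewrite (bool_irrelevance mn kn); exact: d_inner_same.
  have {}nm : m = n by lia.
  subst m; rewrite (cofaceEl _ nj) (cofaceEl _ ej).
  exact: d_inner_last.
have kn : k = n by lia.
subst k; have nj : nat_of_ord j' = n.+1 by lia.
rewrite (cofaceEl _ ni) (cofaceEl _ nj) (@cofaceEl n.+1 j); last by lia.
rewrite (@cofaceEi n.+1 _ n (ltnSn n) _ ei); exact: d_last_last.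
Qed.

Definition cosimp : semicosimplicial :=
  SemiCosimplicial coface_continuous coface_law.

End Cosimplicial.

(* Main.v *)
(* The bimodule [Act] is replaced by an explicit model.  As an
   infinitesimal bimodule over [As_{>0}] is the same as a semi-cosimplicial space,
   the standard simplices form a model [modelc] of [As], and bimodule maps from
   [modelc] to [N] are exactly the points of [sTot N].  An infinitesimal bimodule
   over [Act_{>0}] that is empty outside the arities of [Act] amounts to a map
   [h : M_c^n -> M_o^(n+1)] of semi-cosimplicial spaces, [h = *_{2;o} o_1 -]; the
   identity of the simplices is therefore a model [model] of [Act], and bimodule maps
   out of it are determined by their restriction to the colour [c].

   It remains to compare a model [C] with an arbitrary cofibrant replacement [P].
   A map [P -> C] exists because [P] is cofibrant and [C -> Act] is a trivial fibration.
   A map [C -> P] is built simplex by simplex: the components of [P] are weakly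
   contractible, hence maps to them extend from the boundary of a simplex.  The
   composite on [P] is homotopic to the identity, by lifting against the trivial
   fibration from paths in [P] to pairs of points of [P]; the one on [C] is so because
   the components of [C] are convex and its operations are affine.  Therefore the
   two mapping spaces are homotopy equivalent. *)

From mathcomp Require Import all_boot all_order all_algebra.
From mathcomp Require Import all_classical all_reals.
From mathcomp Require Import topology normedtype.
From mathcomp Require Import zify ring lra.
From Stdlib Require Import Relation_Operators.
Require Import Defs.
Import Order.TTheory GRing.Theory Num.Theory.
Import numFieldNormedType.Exports.

Set Implicit Arguments.
Unset Strict Implicit.
Unset Printing Implicit Defensive.

Local Open Scope classical_set_scope.
Local Open Scope ring_scope.

(** * Mapping spaces *)

(** Cofibrancy is available only as a lifting property: it gives maps out of a replacement, while
    maps out of the model have to be built by hand. What makes this possible is asphericity, i.e.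
    components that are empty or have trivial homotopy. A map between aspherical spaces is a weak
    equivalence as soon as it does not miss a nonempty target, and all parallel maps in play become
    homotopic, so no composite is ever computed. Three obstacles shape the rest. Homotopy groups are
    defined on cubes relative to the boundary, whereas maps must be extended over simplices: a
    simplex is presented as a quotient of a cube times an interval, to which a null homotopy
    descends. The homotopies between mapping spaces are free, so homotopy equivalences become weak
    equivalences only after transport along the track of the base point. Finally, points of a
    simplex are stored as cumulative sums, sequences indexed by all naturals: every operation is
    then precomposition with a map of indices, whatever the arities, and the bimodule axioms come
    down to linear arithmetic. *)

Lemma cts_comp (S T U : topologicalType) (f : S -> T) (g : T -> U) :
  continuous f -> continuous g -> continuous (fun x => g (f x)).
Proof. by move=> cf cg x; apply: (@continuous_comp _ _ _ f g); [exact: cf|exact: cg]. Qed.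

Lemma continuous_o (S T U : topologicalType) (f : S -> T) (g : T -> U) :
  continuous f -> continuous g -> continuous (g \o f).
Proof. by move=> cf cg x; apply: continuous_comp; [exact: cf|exact: cg]. Qed.

Definition compact_space (T : topologicalType) (hT : hausdorff_space T)
    (cT : compact [set: T]) : space := Space hT (compact_cg cT).

(** Openness is tested on compact subsets, and their inclusions are maps from compact Hausdorff
    spaces. This reduces evaluation and currying to domains where the exponential law of the
    compact-open topology holds. *)
Lemma cg_continuous (S : space) (Z : topologicalType) (f : S -> Z) :
  (forall (T : topologicalType) (h : T -> S), hausdorff_space T ->
     compact [set: T] -> continuous h -> continuous (f \o h)) ->
  continuous f.
Proof.
move=> H; apply/continuousP => U oU; apply: space_cg => K cK.
have cv : continuous (set_val : K -> S) by exact: initial_continuous.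
have := (continuousP _).1 (H K set_val (set_type_hausdorff (@space_hausdorff S))
  (compact_set_type cK) cv) _ oU.
case=> W oW WU; apply/open_subspaceP; exists W => //.
apply/seteqP; split=> x [Wx Kx]; split=> //.
  have : (set_val @^-1` W) (exist _ x (mem_set Kx) : K) by [].
  by rewrite WU.
have : ((f \o set_val) @^-1` U) (exist _ x (mem_set Kx) : K) by [].
by rewrite -WU.
Qed.

Lemma kpair_continuous (S X Y : space) (f : S -> X) (g : S -> Y) :
  continuous f -> continuous g ->
  continuous ((fun s => (f s, g s)) : S -> kprod X Y).
Proof.
move=> cf cg; apply: (@space_kcontinuous S (X * Y)%type) => x.
by apply: cvg_pair; [exact: cf|exact: cg].
Qed.

Lemma kfst_continuous (X Y : space) : continuous (fst : kprod X Y -> X).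
Proof.
move=> z; apply: (@continuous_comp (kprod X Y) (X * Y)%type X id fst).
  exact: kify_id_continuous.
exact: cvg_fst.
Qed.

Lemma ksnd_continuous (X Y : space) : continuous (snd : kprod X Y -> Y).
Proof.
move=> z; apply: (@continuous_comp (kprod X Y) (X * Y)%type Y id snd).
  exact: kify_id_continuous.
exact: cvg_snd.
Qed.

Lemma prod_hausdorff (X Y : topologicalType) :
  hausdorff_space X -> hausdorff_space Y -> hausdorff_space (X * Y)%type.
Proof.
move=> hX hY; apply: (@hausdorff_injective_family _ bool
  (fun b => if b then X else Y)
  (fun b => if b return X * Y -> (if b then X else Y) then fst else snd)).
- by case.
- by case=> x; [exact: cvg_fst|exact: cvg_snd].
- by move=> [a b] [c d] e; congr pair; [exact: (e true)|exact: (e false)].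
Qed.

Lemma prod_compact (X Y : topologicalType) :
  compact [set: X] -> compact [set: Y] -> compact [set: (X * Y)%type].
Proof. by move=> cX cY; rewrite -setXTT; exact: compact_setX. Qed.

Section MapSpaces.
Variables (I : Type) (X Y : I -> space) (P : set (forall i, X i -> Y i)).
Local Notation Map := (map_space P).

Definition mk_map (f : forall i, X i -> Y i) (cf : forall i, continuous (f i))
    (Pf : P f) : Map :=
  exist _ (f : prod_topology (fun i => {compact-open, X i -> Y i}))
    (mem_set (conj cf Pf : cfamily P f)).

Lemma mk_mapE f cf Pf i x : mapf (@mk_map f cf Pf) i x = f i x.
Proof. by []. Qed.

Lemma mapf_continuous (f : Map) i : continuous (mapf f i).
Proof. by have [] := set_valP (f : cfamily P). Qed.

Lemma mapf_law (f : Map) : P (mapf f).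
Proof. by have [] := set_valP (f : cfamily P). Qed.

Lemma map_ext (f g : Map) : (forall i x, mapf f i x = mapf g i x) -> f = g.
Proof.
move=> fg; apply: (@val_inj _ _ (cfamily P)); apply: functional_extensionality_dep => i.
by apply/funext => x; exact: fg.
Qed.

Lemma map_proj_continuous i :
  continuous ((fun f => mapf f i) : Map -> {compact-open, X i -> Y i}).
Proof.
have ci : continuous (fun f : prod_topology (fun i => {compact-open, X i -> Y i}) => f i).
  move=> f; have /cvg_sup/(_ i) : f --> f by apply: cvg_id.
  move=> fi; apply: cvg_trans (@initial_continuous _ _
     (fun f : prod_topology (fun i => {compact-open, X i -> Y i}) => f i) f).
  exact: cvg_app.
move=> f; apply: (@continuous_comp Map (cfamily P) {compact-open, X i -> Y i}
  id (fun f => set_val f i)); first exact: kify_id_continuous.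
apply: (@continuous_comp _ _ _ (set_val : cfamily P -> _) (fun f => f i)).
  exact: initial_continuous.
exact: ci.
Qed.

(** Evaluation on the plain compact-open topology would require [X i] to be locally compact. Over a
    compact Hausdorff test space [T] both the map and its argument are pulled back to [T], and
    evaluation becomes the diagonal of an uncurried map on [T * T]. *)
Lemma map_eval_continuous i :
  continuous ((fun z => mapf z.1 i z.2) : kprod Map (X i) -> Y i).
Proof.
apply: cg_continuous => T h hT cT ch.
have ch1 : continuous (fst \o h : T -> Map).
  exact: (continuous_o ch (@kfst_continuous Map (X i))).
have ch2 : continuous (snd \o h : T -> X i).
  exact: (continuous_o ch (@ksnd_continuous Map (X i))).
pose k (t s : T) := mapf (h t).1 i (h s).2.
have ck : continuous (k : T -> {compact-open, T -> Y i}).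
  move=> t; apply/compact_open_cvgP => K O cK oO kKO.
  have /compact_open_cvgP H :
      (fun t => mapf (h t).1 i : {compact-open, X i -> Y i}) @ t -->
      (mapf (h t).1 i : {compact-open, X i -> Y i}).
    apply: (@continuous_comp T Map {compact-open, X i -> Y i} (fst \o h)
      (fun f => mapf f i)); [exact: ch1|exact: map_proj_continuous].
  have cK' : compact ((snd \o h) @` K).
    by apply: (continuous_compact _ cK); exact: continuous_subspaceT.
  have KE (g : X i -> Y i) : g @` ((snd \o h) @` K) = (g \o (snd \o h)) @` K.
    by rewrite image_comp.
  have near_t : \forall s \near t, mapf (h s).1 i @` ((snd \o h) @` K) `<=` O.
    by apply: (H _ O cK' oO); rewrite KE.
  by apply: filterS near_t => s; rewrite KE.
have lc : locally_compact [set: T].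
  by move=> t _; exists setT; [exact: filterT|split=> //; exact: closedT].
have cu : continuous (uncurry k).
  apply: (@continuous_uncurry T T (Y i) k lc hT ck) => t s.
  apply: (@continuous_comp _ _ _ (snd \o h) (mapf (h t).1 i)); first exact: ch2.
  exact: mapf_continuous.
move=> t; apply: (@continuous_comp T (T * T)%type (Y i) (fun t => (t, t)) (uncurry k)).
  by apply: cvg_pair; exact: cvg_id.
exact: cu.
Qed.

Lemma map_apply_continuous (S : space) i (F : S -> Map) (x : S -> X i) :
  continuous F -> continuous x -> continuous (fun s => mapf (F s) i (x s)).
Proof.
move=> cF cx s; apply: (@continuous_comp S (kprod Map (X i)) (Y i)
  (fun s => (F s, x s)) (fun z => mapf z.1 i z.2)).
  exact: kpair_continuous.
exact: map_eval_continuous.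
Qed.

(** A compact-open neighbourhood sees only a compact [K], and over a compact [T] the plain product
    [T * K] is already compactly generated, so continuity on the k-product can be used there. *)
Lemma map_curry_continuous (S : space) (F : S -> Map) :
  (forall i, continuous ((fun z => mapf (F z.1) i z.2) : kprod S (X i) -> Y i)) ->
  continuous F.
Proof.
move=> cF; apply: (@space_kcontinuous S (cfamily P)).
apply: continuous_comp_initial.
suff ci i : continuous ((fun s => mapf (F s) i) : S -> {compact-open, X i -> Y i}).
  move=> s; apply/cvg_sup => i.
  apply: (@continuous_comp_initial _ _ _
    (fun f : forall j, {compact-open, X j -> Y j} => f i)
    (set_val \o F)) => t; exact: ci.
apply: cg_continuous => T h hT cT ch t.
apply/compact_open_cvgP => K O cK oO kKO.
pose g (z : T * K) := mapf (F (h z.1)) i (set_val z.2).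
have cg : continuous g.
  pose TK := compact_space (prod_hausdorff hT (set_type_hausdorff (@space_hausdorff (X i))))
    (prod_compact cT (compact_set_type cK)).
  have c1 : continuous ((fun z => h z.1) : TK -> S).
    by move=> z; apply: continuous_comp; [exact: cvg_fst|exact: ch].
  have c2 : continuous ((fun z => set_val z.2) : TK -> X i).
    by move=> z; apply: continuous_comp; [exact: cvg_snd|exact: initial_continuous].
  move=> z; apply: (@continuous_comp TK (kprod S (X i)) (Y i)
    (fun z => (h z.1, set_val z.2)) (fun z => mapf (F z.1) i z.2)).
    exact: (kpair_continuous c1 c2).
  exact: cF.
have [cc _] := continuous_curry cg.
have /compact_open_cvgP/(_ setT O (compact_set_type cK) oO) :
    (curry g : T -> {compact-open, K -> Y i}) @ t --> (curry g t : {compact-open, K -> Y i}).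
  exact: cc.
have KE s : curry g s @` setT = mapf (F (h s)) i @` K.
  apply/seteqP; split=> y [x].
    by move=> _ <-; exists (set_val x) => //; exact: set_valP.
  by move=> Kx <-; exists (exist _ x (mem_set Kx)).
rewrite /= KE => /(_ kKO); apply: filterS => s.
by rewrite /= -KE.
Qed.

End MapSpaces.

(** A continuous surjection from a compact space to a Hausdorff one is closed, hence a quotient
    map. *)
Lemma quotient_continuous (K D X : topologicalType) (q : K -> D) (psi : D -> X)
    (h : K -> X) :
  compact [set: K] -> hausdorff_space D -> continuous q -> continuous h ->
  (forall y, exists z, q z = y) -> (forall z, psi (q z) = h z) ->
  continuous psi.
Proof.
move=> cK hD cq ch qs qh; apply/continuous_closedP => A cA.
have -> : psi @^-1` A = q @` (h @^-1` A).
  apply/seteqP; split=> y /=.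
    by have [z <-] := qs y; rewrite qh => Az; exists z.
  by move=> [z Az <-]; rewrite qh.
apply: compact_closed => //; apply: continuous_compact.
  exact: continuous_subspaceT.
apply: (subclosed_compact _ cK) => //.
exact: ((continuous_closedP _).1 ch).
Qed.

Lemma glue_continuous (R : realType) (T X : topologicalType) (r : T -> R) (f g : T -> X) :
  continuous r -> continuous f -> continuous g ->
  (forall t, r t = 0 -> f t = g t) ->
  continuous (fun t => if r t <= 0 then f t else g t).
Proof.
move=> cr cf cg fg; apply/continuous_closedP => A cA.
have -> : (fun t => if r t <= 0 then f t else g t) @^-1` A =
    ((r @^-1` [set x | x <= 0]) `&` f @^-1` A) `|`
    ((r @^-1` [set x | 0 <= x]) `&` g @^-1` A).
  apply/seteqP; split=> t /=.
    by case: ifP => r0 At; [left|right; split=> //; rewrite ltW // ltNge r0].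
  move=> [[r0 At]|[r0 At]]; first by rewrite r0.
  case: ifP => // r0'; rewrite fg //; apply/eqP; rewrite eq_le r0 andbT //.
have P (Z : topologicalType) (k : T -> Z) (B : set Z) : continuous k -> closed B -> closed (k @^-1` B).
  by move=> ck; exact: ((continuous_closedP _).1 ck).
by apply: closedU; apply: closedI; apply: P.
Qed.

(** * Cubes and balls *)

Section RealContinuity.
Variables (R : realType) (T : topologicalType).
Implicit Types f g : T -> R.

Lemma ctsD f g : continuous f -> continuous g -> continuous (fun t => f t + g t).
Proof. by move=> cf cg t; apply: continuousD; [exact: cf|exact: cg]. Qed.

Lemma ctsN f : continuous f -> continuous (fun t => - f t).
Proof. by move=> cf t; apply: continuousN; exact: cf. Qed.

Lemma ctsM f g : continuous f -> continuous g -> continuous (fun t => f t * g t).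
Proof. by move=> cf cg t; apply: continuousM; [exact: cf|exact: cg]. Qed.

Lemma ctsV f : (forall t, f t != 0) -> continuous f -> continuous (fun t => (f t)^-1).
Proof. by move=> f0 cf t; apply: continuousV; [exact: f0|exact: cf]. Qed.

Lemma cts_max f g : continuous f -> continuous g ->
  continuous (fun t => Num.max (f t) (g t)).
Proof. by move=> cf cg t; apply: continuous_max; [exact: cf|exact: cg]. Qed.

Lemma cts_min f g : continuous f -> continuous g ->
  continuous (fun t => Num.min (f t) (g t)).
Proof. by move=> cf cg t; apply: continuous_min; [exact: cf|exact: cg]. Qed.

Lemma cts_cst (U : topologicalType) (x : U) : continuous (fun _ : T => x).
Proof. exact: cst_continuous. Qed.

Lemma cts_sum (I : Type) (r : seq I) (P : pred I) (F : I -> T -> R) :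
  (forall i, P i -> continuous (F i)) -> continuous (fun t => \sum_(i <- r | P i) F i t).
Proof.
move=> cF t; apply: (cvg_big (@add_continuous _) (nbhs_filter t)) => i Pi.
exact: cF.
Qed.

Lemma cts_norm n (F : T -> 'rV[R]_n) : continuous F -> continuous (fun t => `|F t|).
Proof.
by move=> cF t; apply: (@continuous_comp _ _ _ F (fun x => `|x|)); [exact: cF|exact: norm_continuous].
Qed.

Lemma cts_coord n (F : T -> 'rV[R]_n) i : continuous F -> continuous (fun t => F t ord0 i).
Proof.
by move=> cF t; apply: (@continuous_comp _ _ _ F (fun x => x ord0 i)); [exact: cF|exact: coord_continuous].
Qed.

Lemma cts_row n (F : T -> 'rV[R]_n) :
  (forall i, continuous (fun t => F t ord0 i)) -> continuous F.
Proof.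
move=> cF x B [P Px PB].
have : \forall y \near x, forall j, P ord0 j (F y ord0 j).
  apply: (@filter_forall _ _ _ _ (nbhs_filter x)) => j.
  exact: (cF j x _ (Px ord0 j)).
by apply: filterS => y Py; apply: PB => a b; rewrite (ord1 a).
Qed.

Lemma cts_scale n f (F : T -> 'rV[R]_n) :
  continuous f -> continuous F -> continuous (fun t => f t *: F t).
Proof.
move=> cf cF; apply: cts_row => i.
suff -> : (fun t => (f t *: F t) ord0 i) = (fun t => f t * F t ord0 i).
  by apply: ctsM => //; exact: cts_coord.
by apply/funext => t; rewrite mxE.
Qed.

End RealContinuity.

Lemma cts_fst (T U V : topologicalType) (f : T -> V) :
  continuous f -> continuous (fun z : T * U => f z.1).
Proof.
by move=> cf z; apply: (@continuous_comp _ _ _ fst f); [exact: cvg_fst|exact: cf].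
Qed.

Lemma cts_snd (T U V : topologicalType) (f : U -> V) :
  continuous f -> continuous (fun z : T * U => f z.2).
Proof.
by move=> cf z; apply: (@continuous_comp _ _ _ snd f); [exact: cvg_snd|exact: cf].
Qed.

Lemma cts_id (T : topologicalType) : continuous (fun x : T => x).
Proof. by move=> ?; exact: cvg_id. Qed.

Lemma cts_pair (T U V : topologicalType) (f : T -> U) (g : T -> V) :
  continuous f -> continuous g -> continuous (fun t => (f t, g t)).
Proof. by move=> cf cg t; apply: cvg_pair; [exact: cf|exact: cg]. Qed.

(** Structural continuity. The last seven cases restore eta-expansions, without which the combinator
    lemmas do not match. *)
Ltac cts1 :=
  lazymatch goal with
  | |- forall x, continuous_at x (fun t => t) => exact: cts_id
  | |- forall x, continuous_at x id => exact: cts_id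
  | |- forall x, continuous_at x (fun t => fst t) => move=> ?; exact: cvg_fst
  | |- forall x, continuous_at x fst => move=> ?; exact: cvg_fst
  | |- forall x, continuous_at x (fun t => snd t) => move=> ?; exact: cvg_snd
  | |- forall x, continuous_at x snd => move=> ?; exact: cvg_snd
  | |- forall x, continuous_at x (fun t => @Algebra.add _ _ _) => apply: ctsD
  | |- forall x, continuous_at x (fun t => @Algebra.opp _ _) => apply: ctsN
  | |- forall x, continuous_at x (fun t => @GRing.mul _ _ _) => apply: ctsM
  | |- forall x, continuous_at x (fun t => @GRing.scale _ _ _ _) => apply: cts_scale
  | |- forall x, continuous_at x (fun t => @Order.max _ _ _ _) => apply: cts_max
  | |- forall x, continuous_at x (fun t => @Order.min _ _ _ _) => apply: cts_min
  | |- forall x, continuous_at x (fun t => @Num.norm _ _ _) => apply: cts_norm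
  | |- forall x, continuous_at x (fun t => (_, _)) => apply: cts_pair
  | |- forall x, continuous_at x (fun _ => ?y) => exact: cts_cst
  | |- forall x, continuous_at x (fun t => ?f (fst t)) => apply: cts_fst
  | |- forall x, continuous_at x (fun t => ?f (snd t)) => apply: cts_snd
  | |- forall x, continuous_at x (Order.max ?a) =>
      change (continuous (fun t => Order.max a t))
  | |- forall x, continuous_at x (Order.min ?a) =>
      change (continuous (fun t => Order.min a t))
  | |- forall x, continuous_at x (Algebra.add ?a) =>
      change (continuous (fun t => Algebra.add a t))
  | |- forall x, continuous_at x (GRing.mul ?a) =>
      change (continuous (fun t => GRing.mul a t))
  | |- forall x, continuous_at x (@Algebra.opp ?V) =>
      change (continuous (fun t => @Algebra.opp V t))
  | |- forall x, continuous_at x (@Num.norm ?K ?V) =>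
      change (continuous (fun t => @Num.norm K V t))
  | |- forall x, continuous_at x (GRing.scale ?a) =>
      change (continuous (fun t => GRing.scale a t))
  end.

Ltac cts := repeat first [assumption | cts1].

Section CubesAndBalls.
Variable R : realType.
Implicit Types n : nat.

(** Homotopies are parametrised by the whole line through this retraction onto the unit interval, so
    that reparametrising them is plain real arithmetic. *)
Definition clamp (x : R) : R := Num.min 1 (Num.max 0 x).

Lemma clamp_itv x : 0 <= clamp x <= 1.
Proof. by rewrite /clamp le_min ge_min ler01 le_max lexx /= lexx. Qed.

Lemma clamp_id x : 0 <= x <= 1 -> clamp x = x.
Proof. by move=> /andP[x0 x1]; rewrite /clamp max_r // min_r. Qed.

Lemma clamp_ge1 x : 1 <= x -> clamp x = 1.
Proof. by move=> x1; rewrite /clamp max_r ?min_l // (le_trans ler01). Qed.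

Lemma clamp_le0 x : x <= 0 -> clamp x = 0.
Proof. by move=> x0; rewrite /clamp max_l // min_r. Qed.

Lemma clamp_continuous : continuous clamp.
Proof. by rewrite /clamp; cts. Qed.

Definition clampI (x : R) : itv R := exist _ (clamp x) (mem_set (clamp_itv x)).

Lemma clampI_continuous : continuous clampI.
Proof. by apply: continuous_comp_initial; exact: clamp_continuous. Qed.

Lemma itvP (s : itv R) : 0 <= (set_val s : R) <= 1.
Proof. exact: (set_valP s). Qed.

Lemma clampIK (s : itv R) : clampI (set_val s) = s.
Proof. by apply: val_inj; rewrite /= clamp_id //; exact: itvP. Qed.

Lemma clampI0 x : x <= 0 -> clampI x = itv0 R.
Proof. by move=> x0; apply: val_inj; rewrite /= clamp_le0. Qed.

Lemma clampI1 x : 1 <= x -> clampI x = itv1 R.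
Proof. by move=> x1; apply: val_inj; rewrite /= clamp_ge1. Qed.

Lemma itv_val_continuous : continuous (set_val : itv R -> R).
Proof. exact: initial_continuous. Qed.

Lemma itv_hausdorff : hausdorff_space (itv R).
Proof. by apply: set_type_hausdorff; exact: norm_hausdorff. Qed.

Lemma itv_compact : compact [set: itv R].
Proof.
by apply: compact_set_type; have := @segment_compact R 0 1; congr compact.
Qed.

Definition itv_space : space := compact_space itv_hausdorff itv_compact.

Lemma cube_hausdorff n : hausdorff_space (cube R n).
Proof. by apply: set_type_hausdorff; exact: norm_hausdorff. Qed.

Lemma cube_compact n : compact [set: cube R n].
Proof.
apply: compact_set_type.
have := @rV_compact R n (fun=> [set` `[0, 1]]) (fun=> @segment_compact _ _ _).
by congr compact; apply/seteqP; split=> x /= h i; have := h i; rewrite in_itv.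
Qed.

Definition cube_space n : space := compact_space (@cube_hausdorff n) (@cube_compact n).

Definition cube_itv_space n : space :=
  compact_space (prod_hausdorff (@cube_hausdorff n) itv_hausdorff)
    (prod_compact (@cube_compact n) itv_compact).

(* [of_cube] identifies the cube with the unit ball of the max norm, and [to_cube]
   extends its inverse to a retraction of the whole space. *)
Definition of_cube n (t : cube R n) : 'rV[R]_n := 2 *: set_val t - const_mx 1.

Lemma to_cube_subproof n (u : 'rV[R]_n) :
  @cube_set R n (\row_i clamp ((u ord0 i + 1) / 2)).
Proof. by move=> i; rewrite mxE clamp_itv. Qed.

Definition to_cube n (u : 'rV[R]_n) : cube R n :=
  exist _ (\row_i clamp ((u ord0 i + 1) / 2)) (mem_set (to_cube_subproof u)).

Lemma to_cube_continuous n : continuous (@to_cube n).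
Proof.
apply: continuous_comp_initial; apply: cts_row => i.
have -> : (fun u => (set_val \o @to_cube n) u ord0 i) =
    (fun u : 'rV[R]_n => clamp ((u ord0 i + 1) / 2)).
  by apply/funext => u; rewrite /= mxE.
apply: (continuous_o _ clamp_continuous).
by cts; exact: coord_continuous.
Qed.

Lemma of_cube_continuous n : continuous (@of_cube n).
Proof.
apply: cts_row => i.
have -> : (fun t => @of_cube n t ord0 i) =
    (fun t => 2 * (set_val t : 'rV[R]_n) ord0 i - 1).
  by apply/funext => t; rewrite !mxE.
cts; apply: cts_coord; exact: initial_continuous.
Qed.

Lemma mx_norm_leP n (u : 'rV[R]_n) (c : R) : 0 <= c ->
  reflect (forall i, `|u ord0 i| <= c) (`|u| <= c).
Proof.
move=> c0; rewrite [`|u|]mx_normrE; apply: (iffP (bigmax_leP _ _ _ _)).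
  by move=> [_ h] i; exact: (h (ord0, i)).
by move=> h; split=> // -[a b] _ /=; rewrite (ord1 a).
Qed.

Lemma coord_le_norm n (u : 'rV[R]_n) i : `|u ord0 i| <= `|u|.
Proof. by move: i; exact/(mx_norm_leP u (normr_ge0 u)). Qed.

Lemma norm_coord n (u : 'rV[R]_n) : (0 < n)%N -> exists i, `|u ord0 i| = `|u|.
Proof.
case: n u => // n u _; have [u0|] := eqVneq (`|u|) 0.
  by exists ord0; apply/eqP; rewrite eq_le coord_le_norm u0 normr_ge0.
by case/mx_norm_neq0 => -[a i] e; exists i; rewrite [RHS]e /= (ord1 a).
Qed.

Lemma of_cubeK n (t : cube R n) : to_cube (of_cube t) = t.
Proof.
apply: val_inj; apply/rowP => i; rewrite /= !mxE.
have h := set_valP t i; rewrite -[RHS](clamp_id h); congr clamp; lra.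
Qed.

Lemma of_cube_norm n (t : cube R n) : `|of_cube t| <= 1.
Proof.
apply/mx_norm_leP => // i; rewrite !mxE ler_norml.
have := set_valP t i; lra.
Qed.

Lemma to_cubeK n (u : 'rV[R]_n) : `|u| <= 1 -> of_cube (to_cube u) = u.
Proof.
move=> /(mx_norm_leP _ ler01) h; apply/rowP => i; rewrite !mxE.
have := h i; rewrite ler_norml => hi; rewrite clamp_id; lra.
Qed.

Lemma of_cube_boundary n (t : cube R n) :
  cube_boundary t -> 1 <= `|of_cube t|.
Proof.
move=> [i]; rewrite !inE => h; apply: le_trans (coord_le_norm _ i).
by rewrite !mxE; case/orP: h => /eqP ->; rewrite ?(mulr0, mulr1, add0r, normrN1) //;
  rewrite ger0_norm; lra.
Qed.

Lemma to_cube_boundary n (u : 'rV[R]_n) : (0 < n)%N -> 1 <= `|u| ->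
  cube_boundary (to_cube u).
Proof.
move=> n0; have [i <-] := norm_coord u n0 => u1; exists i; rewrite /= mxE !inE.
have [ui|ui] := lerP 0 (u ord0 i).
  by rewrite (@clamp_ge1 ((u ord0 i + 1) / 2)) ?eqxx ?orbT //; rewrite ger0_norm in u1; lra.
by rewrite (@clamp_le0 ((u ord0 i + 1) / 2)) ?eqxx //; rewrite ltr0_norm in u1; lra.
Qed.

End CubesAndBalls.

(* Classes of an equivalence relation defined on a subset [L], with the classes
   written as in [pi0] and [pi]. *)
Lemma class_bij (A B : Type) (L : set A) (L' : set B) (E : A -> A -> Prop)
    (E' : B -> B -> Prop) (phi : A -> B) :
  (forall a, L a -> E a a) -> (forall a b, E a b -> E b a) ->
  (forall b, L' b -> E' b b) -> (forall a b, E' a b -> E' b a) ->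
  (forall a b c, E a b -> E b c -> E a c) ->
  (forall a b c, E' a b -> E' b c -> E' a c) ->
  (forall a, L a -> L' (phi a)) ->
  (forall a b, E a b -> E' (phi a) (phi b)) ->
  (forall a b, L a -> L b -> E' (phi a) (phi b) -> E a b) ->
  (forall b, L' b -> exists2 a, L a & E' (phi a) b) ->
  set_bij [set E a | a in L] [set E' b | b in L']
    (fun C => [set b | exists2 a, C a & E' (phi a) b]).
Proof.
move=> r s r' s' t t' Lphi hom inj surj.
have img a : L a -> [set b | exists2 a', E a a' & E' (phi a') b] = E' (phi a).
  move=> La; apply/seteqP; split=> b /=.
    by move=> [a' /hom aa' a'b]; exact: t' aa' a'b.
  by move=> ab; exists a => //; exact: r.
have cls a b : E' a b -> E' a = E' b.
  move=> ab; apply/funext => x; apply/propext; split=> [ax|bx].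
    by apply: t' ax; exact: s'.
  exact: t' bx.
split.
- by move=> _ [a La <-]; rewrite img //; exists (phi a) => //; exact: Lphi.
- move=> C1 C2; rewrite !inE => -[a La <-] [b Lb <-]; rewrite !img // => eab.
  have ab : E a b by apply: inj => //; rewrite eab; exact/r'/Lphi.
  apply/funext => x; apply/propext; split=> [ax|bx]; last exact: t bx.
  by apply: t ax; exact: s.
- move=> _ [b Lb <-]; have [a La ab] := surj _ Lb.
  by exists (E a); [exists a|rewrite img //; exact: cls].
Qed.

Section PathJoined.
Variable R : realType.
Implicit Types X Y : topologicalType.

Lemma path_joined_refl X (x : X) : path_joined R x x.
Proof. by exists (cst x); [exact: cst_continuous|]. Qed.

(** Paths on the whole line, constant on either side of the unit interval, can be reversed and
    concatenated without subtypes. *)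
Lemma path_joinedP X (x y : X) : path_joined R x y <->
  exists2 g : R -> X, continuous g &
    (forall t, t <= 0 -> g t = x) /\ (forall t, 1 <= t -> g t = y).
Proof.
split=> [[g cg [g0 g1]]|[g cg [g0 g1]]].
  exists (g \o @clampI R); first exact: (continuous_o (@clampI_continuous R) cg).
  by split=> t ht /=; [rewrite clampI0|rewrite clampI1].
exists (g \o set_val); first exact: (continuous_o (@itv_val_continuous R) cg).
by split; [exact: g0|exact: g1].
Qed.

Lemma path_joined_sym X (x y : X) : path_joined R x y -> path_joined R y x.
Proof.
move=> /path_joinedP[g cg [g0 g1]]; apply/path_joinedP.
exists (fun t => g (1 - t)); first by refine (cts_comp _ cg); cts.
by split=> t ht; [apply: g1|apply: g0]; lra.
Qed.

Lemma path_joined_trans X (x y z : X) :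
  path_joined R x y -> path_joined R y z -> path_joined R x z.
Proof.
move=> /path_joinedP[g cg [g0 g1]] /path_joinedP[h ch [h0 h1]]; apply/path_joinedP.
exists (fun t => if t - 2^-1 <= 0 then g (2 * t) else h (2 * t - 1)); last first.
  split=> t ht; first by rewrite ifT ?g0 //; lra.
  by rewrite ifF ?h1 //; [lra|apply/negbTE; rewrite -ltNge; lra].
apply: glue_continuous => [|||t t0]; first by cts.
- by refine (cts_comp _ cg); cts.
- by refine (cts_comp _ ch); cts.
- by rewrite g1 ?h0 //; lra.
Qed.

End PathJoined.

(** * Loops on the ball and change of base point *)

Section Homotopies.
Variables (R : realType) (n : nat).
Hypothesis n0 : (0 < n)%N.
Local Notation E := 'rV[R]_n.
Implicit Types X Y : topologicalType.

(** A loop as a map on the whole vector space, constant outside the unit ball of the max norm;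
    shrinking a loop is then just scaling its argument. *)
Definition ball_loop X (x0 : X) (F : E -> X) :=
  continuous F /\ forall u, 1 <= `|u| -> F u = x0.

(** Times range over the line, but the sphere is held fixed only for times in the unit interval;
    this is what reparametrised homotopies satisfy. *)
Definition ball_homotopic X (x0 : X) (F G : E -> X) :=
  exists2 K : E * R -> X, continuous K &
    [/\ forall u, K (u, 0) = F u, forall u, K (u, 1) = G u &
        forall u t, 0 <= t <= 1 -> 1 <= `|u| -> K (u, t) = x0].

Lemma loops_ball X (x0 : X) (f : cube R n -> X) :
  loops x0 f -> ball_loop x0 (f \o @to_cube R n).
Proof.
move=> [cf f0]; split; first exact: continuous_o (@to_cube_continuous R n) cf.
by move=> u u1; apply: f0; exact: to_cube_boundary.
Qed.

Lemma ball_loops X (x0 : X) F : ball_loop x0 F -> loops x0 (F \o @of_cube R n).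
Proof.
move=> [cF F0]; split; first exact: continuous_o (@of_cube_continuous R n) cF.
by move=> t bt; apply: F0; exact: of_cube_boundary.
Qed.

Lemma ball_loopK X (x0 : X) F : ball_loop x0 F ->
  (F \o @of_cube R n) \o @to_cube R n = F.
Proof.
move=> [cF F0]; apply/funext => u /=.
have [u1|u1] := lerP (`|u|) 1; first by rewrite to_cubeK.
rewrite !F0 ?(ltW u1) //; apply: of_cube_boundary.
by apply: to_cube_boundary => //; exact: ltW.
Qed.

Lemma homotopic_ball X (x0 : X) (f g : cube R n -> X) :
  homotopic_rel x0 f g <->
  ball_homotopic x0 (f \o @to_cube R n) (g \o @to_cube R n).
Proof.
split=> [[H cH [H0 H1 Hb]]|[K cK [K0 K1 Kb]]].
  exists (fun z => H (to_cube z.1, clampI z.2)).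
    refine (cts_comp _ cH).
    by cts; [exact: to_cube_continuous|exact: clampI_continuous].
  split=> [u|u|u t t01 u1] /=.
  - by rewrite clampI0.
  - by rewrite clampI1.
  - by apply: Hb; exact: to_cube_boundary.
exists (fun z => K (of_cube z.1, set_val z.2)).
  refine (cts_comp _ cK).
  by cts; [exact: of_cube_continuous|exact: itv_val_continuous].
split=> [t|t|t s bt] /=.
- by rewrite K0 /= of_cubeK.
- by rewrite K1 /= of_cubeK.
- by apply: Kb; [exact: itvP|exact: of_cube_boundary].
Qed.

Lemma ball_homotopic_refl X (x0 : X) F : ball_loop x0 F -> ball_homotopic x0 F F.
Proof. by move=> [cF F0]; exists (fun z => F z.1); [cts|split=> // u t _; exact: F0]. Qed.

Lemma ball_homotopic_sym X (x0 : X) F G :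
  ball_homotopic x0 F G -> ball_homotopic x0 G F.
Proof.
move=> [K cK [K0 K1 Kb]]; exists (fun z => K (z.1, 1 - z.2)).
  by refine (cts_comp _ cK); cts.
split=> [u|u|u t ht u1] /=; rewrite ?subr0 ?subrr //.
by apply: Kb => //; case/andP: ht => t0 t1; apply/andP; split; lra.
Qed.

Lemma ball_homotopic_trans X (x0 : X) F G H :
  ball_homotopic x0 F G -> ball_homotopic x0 G H -> ball_homotopic x0 F H.
Proof.
move=> [K cK [K0 K1 Kb]] [L cL [L0 L1 Lb]].
exists (fun z => if z.2 - 2^-1 <= 0 then K (z.1, 2 * z.2) else L (z.1, 2 * z.2 - 1)).
  apply: glue_continuous => [|||[u t] /= t0]; first by cts.
  - by refine (cts_comp _ cK); cts.
  - by refine (cts_comp _ cL); cts.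
  - have -> : 2 * t = 1 by lra.
    by rewrite subrr K1 L0.
split=> [u|u|u t ht u1] /=.
- by rewrite ifT ?mulr0 //; lra.
- rewrite ifF; last by apply/negbTE; rewrite -ltNge; lra.
  have e : 2 * 1 - 1 = 1 :> R by lra.
  by rewrite e L1.
- by case: lerP => h; [apply: Kb|apply: Lb] => //; lra.
Qed.

Lemma ball_homotopic_comp X Y (phi : X -> Y) (x0 : X) F G : continuous phi ->
  ball_homotopic x0 F G -> ball_homotopic (phi x0) (phi \o F) (phi \o G).
Proof.
move=> cphi [K cK [K0 K1 Kb]]; exists (phi \o K); first exact: continuous_o cK cphi.
by split=> [u|u|u t ht u1] /=; rewrite ?K0 ?K1 ?Kb.
Qed.

Section BaseChange.
Variables (X : topologicalType) (x0 x1 : X) (g : R -> X).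
Hypothesis cg : continuous g.
Hypothesis g0 : forall t, t <= 0 -> g t = x0.
Hypothesis g1 : forall t, 1 <= t -> g t = x1.

(** A free homotopy of loops whose base point travels along [g]. *)
Definition along (F : E * R -> X) :=
  continuous F /\ forall u t, 1 <= `|u| -> F (u, t) = g t.

(* The end of [F] with its trace on the unit sphere pushed out into the shell
   between radius [1 / 2] and [1]. *)
Definition stretch (F : E * R -> X) (u : E) : X :=
  F (2 *: u, Num.max 0 (2 * `|u| - 1)).

Lemma stretch_end F : along F ->
  ball_homotopic x1 (stretch F) (fun u => F (u, 1)).
Proof.
move=> [cF Fg].
(* As [z.2] goes from 0 to 1, the scale shrinks from 2 to 1 and the starting time rises from 0 to 1;
   the shell always runs on along [g]. *)
exists (fun z => F ((2 - z.2) *: z.1, z.2 + Num.max 0 ((2 - z.2) * `|z.1| - 1))).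
  refine (cts_comp _ cF).
  by cts.
have Fl u t : 1 <= t -> 1 <= `|u| -> F (u, t) = x1.
  by move=> t1 u1; rewrite Fg // g1.
split=> [u|u|u t /andP[t0 t1] u1] /=.
- by rewrite subr0 add0r.
- have -> : 2 - 1 = 1 :> R by lra.
  rewrite scale1r mul1r; have [u1|u1] := lerP (`|u|) 1.
    by rewrite max_l ?addr0 //; lra.
  by rewrite !Fl ?(ltW u1) // max_r; lra.
- have h : 2 - t <= (2 - t) * `|u| by rewrite ler_peMr //; lra.
  apply: Fl; first by rewrite max_r; lra.
  by rewrite normrZ ger0_norm //; lra.
Qed.

(** Inside radius [1 / 2] the given homotopy [K] runs on the doubled ball; in the shell both maps
    already equal [g (2 * |u| - 1)]. The time is clamped because [K] fixes the sphere only at times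
    in the unit interval. *)
Lemma stretch_homotopic F G : along F -> along G ->
  ball_homotopic x0 (fun u => F (u, 0)) (fun u => G (u, 0)) ->
  ball_homotopic x1 (stretch F) (stretch G).
Proof.
move=> [cF Fg] [cG Gg] [K cK [K0 K1 Kb]].
have n2 (u : E) : `|2 *: u| = 2 * `|u| by rewrite normrZ ger0_norm.
exists (fun z => if 2 * `|z.1| - 1 <= 0 then K (2 *: z.1, clamp z.2)
                 else g (2 * `|z.1| - 1)).
  apply: glue_continuous => [|||[u t] /= u1]; first by cts.
  - refine (cts_comp _ cK).
    by cts; exact: clamp_continuous.
  - by refine (cts_comp _ cg); cts.
  - by rewrite u1 g0 // Kb ?clamp_itv // n2; lra.
split=> [u|u|u t t01 u1] /=.
- rewrite clamp_le0 // K0 /stretch; case: (lerP (2 * `|u| - 1) 0) => h.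
    by [].
  by rewrite Fg // n2; lra.
- rewrite clamp_ge1 // K1 /stretch; case: (lerP (2 * `|u| - 1) 0) => h.
    by [].
  by rewrite Gg // n2; lra.
- by rewrite ifF ?g1 //; [lra|apply/negbTE; rewrite -ltNge; lra].
Qed.

(** This is the injectivity of transport along [g], expressed on representatives: each end is
    homotopic to the corresponding start with a shell added. *)
Lemma base_change F G : along F -> along G ->
  ball_homotopic x0 (fun u => F (u, 0)) (fun u => G (u, 0)) ->
  ball_homotopic x1 (fun u => F (u, 1)) (fun u => G (u, 1)).
Proof.
move=> aF aG FG; apply: ball_homotopic_trans (stretch_end aG).
apply: ball_homotopic_trans (stretch_homotopic aF aG FG).
exact/ball_homotopic_sym/stretch_end.
Qed.

(** The homotopy extension property of the ball and its sphere, by a formula: at time [t >= 0] the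
    loop is shrunk to radius [1 / (1 + t)] and the shell around it is filled with [g]. The minimum
    makes the value exactly [g t] from radius 1 on. *)
Lemma along_transport f : ball_loop x0 f ->
  exists2 F, along F & forall u, F (u, 0) = f u.
Proof.
move=> [cf f0]; pose s (t : R) := 1 + Num.max 0 t.
have s1 t : 1 <= s t by rewrite /s lerDl le_max lexx.
have ns t (u : E) : `|s t *: u| = s t * `|u|.
  by rewrite normrZ ger0_norm //; have := s1 t; lra.
exists (fun z => if s z.2 * `|z.1| - 1 <= 0 then f (s z.2 *: z.1)
                 else g (Num.min z.2 (s z.2 * `|z.1| - 1))); last first.
  move=> u /=; have -> : s 0 = 1 by rewrite /s max_l ?addr0.
  rewrite mul1r scale1r; case: ifP => // /negbT; rewrite -ltNge => h.
  by rewrite min_l ?g0 ?f0 //; lra.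
split.
  apply: glue_continuous => [|||[u t] /= h]; rewrite /s; first by cts.
  - by refine (cts_comp _ cf); cts.
  - by refine (cts_comp _ cg); cts.
  - rewrite -/(s t) h g0 ?ge_min ?lexx ?orbT //.
    by apply: f0; rewrite ns; lra.
move=> u t u1 /=; have := s1 t; have : t <= Num.max 0 t by rewrite le_max lexx orbT.
rewrite /s; set m := Num.max 0 t => tm st.
have h : 1 + m <= (1 + m) * `|u| by rewrite ler_peMr //; lra.
case: ifP => [h'|_]; last by rewrite min_l //; lra.
rewrite g0 ?f0 //; last by lra.
by have := ns t u; rewrite /s -/m => ->; lra.
Qed.

End BaseChange.
End Homotopies.

(** * Homotopy equivalences *)

Section HomotopicRel.
Variables (R : realType) (n : nat) (X : topologicalType) (x0 : X).
Hypothesis n0 : (0 < n)%N.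
Implicit Types f g h : cube R n -> X.

Lemma homotopic_rel_refl f : loops x0 f -> homotopic_rel x0 f f.
Proof.
by move=> lf; apply/(homotopic_ball n0); apply/ball_homotopic_refl/loops_ball.
Qed.

Lemma homotopic_rel_sym f g : homotopic_rel x0 f g -> homotopic_rel x0 g f.
Proof. by rewrite !homotopic_ball //; exact: ball_homotopic_sym. Qed.

Lemma homotopic_rel_trans f g h :
  homotopic_rel x0 f g -> homotopic_rel x0 g h -> homotopic_rel x0 f h.
Proof. by rewrite !homotopic_ball //; exact: ball_homotopic_trans. Qed.

End HomotopicRel.

Lemma weak_equivalenceP (R : realType) (X Y : topologicalType) (phi : X -> Y) :
  continuous phi ->
  (forall x y, path_joined R (phi x) (phi y) -> path_joined R x y) ->
  (forall y, exists x, path_joined R (phi x) y) ->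
  (forall n x0 (f g : cube R n -> X), (0 < n)%N -> loops x0 f -> loops x0 g ->
    homotopic_rel (phi x0) (phi \o f) (phi \o g) -> homotopic_rel x0 f g) ->
  (forall n x0 (g : cube R n -> Y), (0 < n)%N -> loops (phi x0) g ->
    exists2 f, loops x0 f & homotopic_rel (phi x0) (phi \o f) g) ->
  weak_equivalence R phi.
Proof.
move=> cphi inj0 surj0 inj surj; split=> // [|n x0 n0].
  apply: (@class_bij X Y setT setT (path_joined R (X := X)) (path_joined R (X := Y)) phi) => //.
  - by move=> x _; exact: path_joined_refl.
  - by move=> x y; exact: path_joined_sym.
  - by move=> x _; exact: path_joined_refl.
  - by move=> x y; exact: path_joined_sym.
  - by move=> x y z; exact: path_joined_trans.
  - by move=> x y z; exact: path_joined_trans.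
  - move=> x y [g cg [g0 g1]]; exists (phi \o g); first exact: continuous_o cg cphi.
    by rewrite /= g0 g1.
  - by move=> x y _ _; exact: inj0.
  - by move=> y _; have [x xy] := surj0 y; exists x.
apply: (@class_bij _ _ (@loops R n X x0) (@loops R n Y (phi x0))
  (@homotopic_rel R n X x0) (@homotopic_rel R n Y (phi x0)) (fun f => phi \o f)).
- by move=> f; exact: homotopic_rel_refl.
- by move=> f g; exact: homotopic_rel_sym.
- by move=> f; exact: homotopic_rel_refl.
- by move=> f g; exact: homotopic_rel_sym.
- by move=> f g h; exact: homotopic_rel_trans.
- by move=> f g h; exact: homotopic_rel_trans.
- move=> f [cf f0]; split; first exact: continuous_o cf cphi.
  by move=> t bt /=; rewrite f0.
- move=> f g; rewrite !homotopic_ball //; exact: ball_homotopic_comp.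
- by move=> f g lf lg; exact: inj.
- by move=> g lg; exact: surj.
Qed.

Section HomotopyEquivalence.
Variable R : realType.

Definition homotopy (X Y : space) (f g : X -> Y) :=
  exists2 A : kprod X (itv_space R) -> Y, continuous A &
    (forall x, A (x, itv0 R) = f x) /\ (forall x, A (x, itv1 R) = g x).

Lemma homotopy_path (X : space) (f : X -> X) :
  homotopy f id -> forall x, path_joined R (f x) x.
Proof.
move=> [A cA [A0 A1]] x; exists (fun s => A (x, s)).
  exact: (continuous_o (@kprod_pairl_continuous X (itv_space R) x) cA).
by rewrite A0 A1.
Qed.

Section Along.
Variables (n : nat) (X : space) (A : kprod X (itv_space R) -> X) (x0 : X).
Hypotheses (n0 : (0 < n)%N) (cA : continuous A).

Lemma homotopy_track_continuous : continuous (fun t => A (x0, clampI t)).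
Proof.
refine (@cts_comp _ _ _ (@clampI R) (fun s => A (x0, s)) _ _).
  exact: clampI_continuous.
exact: (continuous_o (@kprod_pairl_continuous X (itv_space R) x0) cA).
Qed.

Lemma homotopy_track_along (f : 'rV[R]_n -> X) : ball_loop x0 f ->
  along (fun t => A (x0, clampI t)) (fun z => A (f z.1, clampI z.2)).
Proof.
move=> lf; split=> [|u t u1 /=]; last by rewrite lf.2.
(* [A] is continuous on a k-product only. The map is therefore factored through the compact cube,
   whose plain product with the interval is already a space. *)
pose B (z : cube R n * itv R) : X := A (f (of_cube z.1), z.2).
have cB : continuous B.
  apply: (@continuous_o (cube_itv_space R n) (kprod X (itv_space R)) X
    (fun z => (f (of_cube z.1), z.2)) A) => //.
  apply: kpair_continuous; last by move=> z; exact: cvg_snd.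
  apply: (@cts_fst (cube R n) (itv R) X (fun t => f (of_cube t))).
  exact: (continuous_o (@of_cube_continuous R n) lf.1).
have -> : (fun z : 'rV[R]_n * R => A (f z.1, clampI z.2)) =
    B \o (fun z => (to_cube z.1, clampI z.2)).
  apply/funext => z; rewrite /B /=; congr (A (_, _)).
  by rewrite -[in LHS](ball_loopK n0 lf).
apply: (continuous_o _ cB).
by cts; [exact: to_cube_continuous|exact: clampI_continuous].
Qed.

End Along.

(** The homotopies are free, so [psi \o phi] and [phi \o psi] move base points; bijectivity on
    homotopy groups comes from [base_change] along the tracks of [A] and [B]. *)
Theorem homotopy_equivalence (X Y : space) (phi : X -> Y) (psi : Y -> X) :
  continuous phi -> continuous psi ->
  homotopy (psi \o phi) id -> homotopy (phi \o psi) id ->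
  weak_equivalence R phi.
Proof.
move=> cphi cpsi hA hB; apply: weak_equivalenceP => //.
- move=> x y [g cg [g0 g1]].
  apply: path_joined_trans (path_joined_sym (homotopy_path hA x)) _.
  apply: path_joined_trans _ (homotopy_path hA y).
  exists (psi \o g); first exact: continuous_o cg cpsi.
  by rewrite /= g0 g1.
- by move=> y; exists (psi y); exact: (homotopy_path hB).
- case: hA => A cA [A0 A1] n x0 f g n0 lf lg.
  move=> /(homotopic_ball n0)/(ball_homotopic_comp cpsi) h.
  apply/(homotopic_ball n0).
  have lf' := loops_ball n0 lf; have lg' := loops_ball n0 lg.
  have aF := homotopy_track_along n0 cA lf'; have aG := homotopy_track_along n0 cA lg'.
  have := base_change (x0 := psi (phi x0)) (x1 := x0) (@homotopy_track_continuous X A x0 cA) _ _ aF aG.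
  rewrite /= clampI0 // clampI1 //.
  have -> : (fun u => A (f (to_cube u), itv0 R)) = psi \o (phi \o f \o @to_cube R n).
    by apply/funext => u; rewrite A0.
  have -> : (fun u => A (g (to_cube u), itv0 R)) = psi \o (phi \o g \o @to_cube R n).
    by apply/funext => u; rewrite A0.
  have -> : (fun u => A (f (to_cube u), itv1 R)) = f \o @to_cube R n.
    by apply/funext => u; rewrite A1.
  have -> : (fun u => A (g (to_cube u), itv1 R)) = g \o @to_cube R n.
    by apply/funext => u; rewrite A1.
  by apply=> [t ht|t ht|//]; [rewrite clampI0 ?A0|rewrite clampI1 ?A1].
case: hA => A cA [A0 A1]; case: hB => B cB [B0 B1] n x0 g n0 lg.
have lG := loops_ball n0 lg; set G := g \o _ in lG.
have lpG : ball_loop (psi (phi x0)) (psi \o G).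
  by split=> [|u u1 /=]; [exact: continuous_o lG.1 cpsi|rewrite lG.2].
(* The preimage of the class of [G]: the loop [psi \o G], based at [psi (phi x0)], is carried to
   [x0] along the track of [A]. *)
have [F aF F0] := along_transport (@homotopy_track_continuous X A x0 cA)
  (fun t t0 => etrans (congr1 (fun s => A (x0, s)) (clampI0 t0)) (A0 x0)) lpG.
pose f u := F (u, 1).
have lf : ball_loop x0 f.
  split; first by refine (cts_comp _ aF.1); cts.
  by move=> u u1; rewrite /f aF.2 // clampI1.
exists (f \o @of_cube R n); first exact: ball_loops.
apply/(homotopic_ball n0); rewrite -/G.
have -> : (phi \o (f \o @of_cube R n)) \o @to_cube R n = phi \o f.
  by rewrite -[in RHS](ball_loopK n0 lf).
(* [F] and the action of [A] on [f] both end at [f]. Read backwards, they start from the same loop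
   and follow the same reversed track, so their other ends agree up to homotopy. *)
have h1 : ball_homotopic (psi (phi x0)) (psi \o (phi \o f)) (psi \o G).
  have aF1 := homotopy_track_along n0 cA lf.
  have rev H : along (fun t => A (x0, clampI t)) H ->
      along (fun t => A (x0, clampI (1 - t))) (fun z : 'rV[R]_n * R => H (z.1, 1 - z.2)).
    move=> [cH Hl]; split; last by move=> u t u1 /=; rewrite Hl.
    by refine (cts_comp _ cH); cts.
  have cg : continuous (fun t : R => A (x0, clampI (1 - t))).
    by refine (@cts_comp R R X (fun t => 1 - t) _ _ (@homotopy_track_continuous X A x0 cA)); cts.
  have := base_change (x0 := x0) (x1 := psi (phi x0)) cg _ _ (rev _ aF1) (rev _ aF).
  rewrite /= !subr0 !subrr clampI1 // clampI0 //.
  have -> : (fun u => A (f u, itv0 R)) = psi \o (phi \o f) by apply/funext => u; rewrite A0.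
  have -> : (fun u => A (f u, itv1 R)) = f by apply/funext => u; rewrite A1.
  have -> : (fun u => F (u, 0)) = psi \o G by apply/funext => u; rewrite F0.
  apply=> [t ht|t ht|]; last exact: ball_homotopic_refl.
    by rewrite clampI1 ?A1 //; lra.
  by rewrite clampI0 ?A0 //; lra.
have lpf : ball_loop (phi x0) (phi \o f).
  by split=> [|u u1 /=]; [exact: continuous_o lf.1 cphi|rewrite lf.2].
(* After [phi] is applied to [h1], transport along the track of [B] removes [phi \o psi] from both
   sides. *)
have aF' := homotopy_track_along n0 cB lpf; have aG := homotopy_track_along n0 cB lG.
have := base_change (x0 := phi (psi (phi x0))) (x1 := phi x0)
  (@homotopy_track_continuous Y B (phi x0) cB) _ _ aF' aG.
rewrite /= clampI0 // clampI1 //.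
have -> : (fun u => B (phi (f u), itv0 R)) = phi \o (psi \o (phi \o f)).
  by apply/funext => u; rewrite B0.
have -> : (fun u => B (G u, itv0 R)) = phi \o (psi \o G).
  by apply/funext => u; rewrite B0.
have -> : (fun u => B (phi (f u), itv1 R)) = phi \o f by apply/funext => u; rewrite B1.
have -> : (fun u => B (G u, itv1 R)) = G by apply/funext => u; rewrite B1.
apply=> [t ht|t ht|]; [by rewrite clampI0 ?B0|by rewrite clampI1 ?B1|].
exact: ball_homotopic_comp.
Qed.

End HomotopyEquivalence.

(** * Aspherical spaces and path spaces *)

Section Aspherical.
Variable R : realType.
Implicit Types X Y : topologicalType.

(* The empty space is allowed. *)
Definition aspherical X :=
  (forall x y : X, path_joined R x y) /\
  forall n (x0 : X) (f : cube R n -> X), (0 < n)%N -> loops x0 f ->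
    homotopic_rel x0 f (cst x0).

Lemma homotopic_rel_loops n X (x0 : X) (f g : cube R n -> X) :
  homotopic_rel x0 f g -> loops x0 f /\ loops x0 g.
Proof.
move=> [H cH [H0 H1 Hb]]; split; split.
- have -> : f = (fun t => H (t, itv0 R)) by apply/funext => t.
  by refine (cts_comp _ cH); cts.
- by move=> t bt; rewrite -H0 Hb.
- have -> : g = (fun t => H (t, itv1 R)) by apply/funext => t.
  by refine (cts_comp _ cH); cts.
- by move=> t bt; rewrite -H1 Hb.
Qed.

Lemma weak_equivalence_aspherical X Y (phi : X -> Y) :
  weak_equivalence R phi -> aspherical Y -> aspherical X.
Proof.
move=> [cphi [_ inj0 _] hpi] [cY aY]; split=> [x y|n x0 f n0 lf].
  have : path_joined R (X := X) x = path_joined R y.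
    apply: inj0; rewrite ?inE; [by exists x|by exists y|].
    apply/seteqP; split=> z _; [exists y|exists x] => //; exact: path_joined_refl.
  by move=> ->; exact: path_joined_refl.
have [_ inj _] := hpi n x0 n0.
have lc : loops x0 (cst x0 : cube R n -> X) by split=> //; exact: cst_continuous.
suff -> : homotopic_rel x0 f = homotopic_rel x0 (cst x0 : cube R n -> X).
  exact: homotopic_rel_refl.
apply: inj; rewrite ?inE; [by exists f|by exists (cst x0)|].
(* All loops of [Y] being homotopic, the image of any class is the whole set of loops, so
   injectivity on classes identifies all classes of [X]. *)
have all (h : cube R n -> X) : loops x0 h -> pi_map x0 phi (homotopic_rel x0 h) =
    @loops R n Y (phi x0).
  move=> lh; apply/seteqP; split=> g.
    by move=> [h' _ /homotopic_rel_loops[]].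
  have lph : loops (phi x0) (phi \o h).
    split; first exact: continuous_o lh.1 cphi.
    by move=> t bt /=; rewrite lh.2.
  move=> lg; exists h; first exact: homotopic_rel_refl.
  apply: homotopic_rel_trans (aY _ _ _ n0 lph) _ => //.
  exact/homotopic_rel_sym/aY.
by rewrite !all.
Qed.

(** With trivial homotopy on both sides, the one thing left to exclude is an empty source over a
    nonempty target. *)
Lemma aspherical_weak_equivalence X Y (phi : X -> Y) : continuous phi ->
  aspherical X -> aspherical Y -> (Y -> exists _ : X, True) ->
  weak_equivalence R phi.
Proof.
move=> cphi [cX aX] [cY aY] ne; apply: weak_equivalenceP => //.
- by move=> y; have [x _] := ne y; exists x.
- move=> n x0 f g n0 lf lg _.
  apply: homotopic_rel_trans (aX _ _ _ n0 lf) _ => //.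
  exact/homotopic_rel_sym/aX.
- move=> n x0 g n0 lg; exists (cst x0); first by split=> //; exact: cst_continuous.
  exact/homotopic_rel_sym/aY.
Qed.

Lemma weak_equivalence_inhabited X Y (phi : X -> Y) (y : Y) :
  weak_equivalence R phi -> exists _ : X, True.
Proof.
move=> [_ [_ _ surj] _].
have [|C [x _ _] _] := surj (path_joined R y); first by exists y.
by exists x.
Qed.

Lemma subsingleton_aspherical X : (forall x y : X, x = y) -> aspherical X.
Proof.
move=> e; split=> [x y|n x0 f n0 lf]; first by rewrite (e x y); exact: path_joined_refl.
by rewrite (_ : f = cst x0) in lf *; [exact: homotopic_rel_refl|apply/funext => t; exact: e].
Qed.

End Aspherical.

Definition point : space := pt_if True.

Section Cotensor.
Variables (J : Type) (K : J -> space).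

(** A product of mapping spaces over arbitrary [J] and [K], so that one construction gives both the
    paths (one interval) and the pairs of points (two one-point spaces) together with their bimodule
    structures. *)
Definition cotensor (X : space) : space := map_space (Y := fun=> X) [set: forall j, K j -> X].

Definition cot (X : space) (f : cotensor X) j (k : K j) : X := mapf f j k.

Lemma cot_curry (S X : space) (g : forall j, S -> K j -> X) :
  (forall j, continuous ((fun z => g j z.1 z.2) : kprod S (K j) -> X)) ->
  exists2 F : S -> cotensor X, continuous F & forall s j k, cot (F s) k = g j s k.
Proof.
move=> cg.
have cs s j : continuous (g j s).
  exact: (continuous_o (@kprod_pairl_continuous S (K j) s) (cg j)).
exists (fun s => mk_map (P := [set: forall j, K j -> X]) (cs s) I) => //.
by apply: map_curry_continuous => j; exact: cg.
Qed.

Lemma cot_apply_continuous (S X : space) j (F : S -> cotensor X) (k : S -> K j) :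
  continuous F -> continuous k -> continuous (fun s => cot (F s) (k s)).
Proof. exact: map_apply_continuous. Qed.

Lemma cot_ext (X : space) (f g : cotensor X) :
  (forall j (k : K j), cot f k = cot g k) -> f = g.
Proof. exact: map_ext. Qed.

End Cotensor.

(** * Paths, pairs of points and the endpoint fibration *)

Section PathSpace.
Variable R : realType.
Implicit Types X : space.
Local Notation I := (itv_space R).

Definition paths X : space := cotensor (fun _ : unit => I) X.
Definition square X : space := cotensor (fun _ : bool => point) X.

Definition path_at X (p : paths X) (s : itv R) : X := cot (j := tt) p (s : I).
Definition square_at X (p : square X) (b : bool) : X := cot (j := b) p (pt Logic.I).

Lemma path_at_continuous (S X : space) (p : S -> paths X) (s : S -> itv R) :
  continuous p -> continuous s -> continuous (fun z => path_at (p z) (s z)).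
Proof. by move=> cp cs; exact: (@cot_apply_continuous _ _ S X tt p s cp cs). Qed.

Lemma square_at_continuous (S X : space) (p : S -> square X) b :
  continuous p -> continuous (fun z => square_at (p z) b).
Proof.
move=> cp; apply: (@cot_apply_continuous _ _ S X b p (fun=> pt Logic.I)) => //.
exact: cst_continuous.
Qed.

Lemma path_ext X (p q : paths X) : (forall s, path_at p s = path_at q s) -> p = q.
Proof. by move=> pq; apply: cot_ext => -[] s; exact: pq. Qed.

Lemma square_ext X (p q : square X) : (forall b, square_at p b = square_at q b) -> p = q.
Proof.
by move=> pq; apply: cot_ext => b k; rewrite (pt_if_eq k (pt Logic.I)); exact: pq.
Qed.

Lemma path_curry (S X : space) (g : S -> itv R -> X) :
  continuous ((fun z => g z.1 z.2) : kprod S I -> X) ->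
  exists2 F : S -> paths X, continuous F & forall s t, path_at (F s) t = g s t.
Proof.
move=> cg; have [F cF FE] := @cot_curry unit (fun=> I) S X (fun=> g) (fun=> cg).
by exists F => // s t; exact: FE.
Qed.

Lemma square_curry (S X : space) (g : S -> bool -> X) :
  (forall b, continuous (g ^~ b)) ->
  exists2 F : S -> square X, continuous F & forall s b, square_at (F s) b = g s b.
Proof.
move=> cg.
have cg' b : continuous ((fun z => g z.1 b) : kprod S point -> X).
  exact: (continuous_o (@kfst_continuous S point) (cg b)).
have [F cF FE] := @cot_curry bool (fun=> point) S X (fun b s _ => g s b) cg'.
by exists F => // s b; exact: FE.
Qed.

Definition ends_square X (p : paths X) : square X :=
  projT1 (cid2 (square_curry (fun b => path_at_continuous (S := paths X) (X := X)
    (@cts_id _) (@cts_cst _ _ (if b then itv1 R else itv0 R))))) p.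

Lemma ends_square_continuous X : continuous (@ends_square X).
Proof. by rewrite /ends_square; case: cid2. Qed.

Lemma ends_squareE X (p : paths X) b :
  square_at (ends_square p) b = path_at p (if b then itv1 R else itv0 R).
Proof. by rewrite /ends_square; case: cid2 => F cF FE; exact: FE. Qed.

(** Evaluation at time 0 is a homotopy equivalence: the path space contracts onto the constant paths
    through [t |-> p (s * t)]. *)
Lemma paths_aspherical X : aspherical R X -> aspherical R (paths X).
Proof.
pose ev (p : paths X) := path_at p (itv0 R).
have cev : continuous ev.
  by apply: (path_at_continuous (S := paths X)); [exact: cts_id|exact: cts_cst].
have [c cc cE] := @path_curry X X (fun x _ => x) (@kfst_continuous X I).
suff we : weak_equivalence R ev by exact: weak_equivalence_aspherical we.
pose m (z : itv R * itv R) : itv R := clampI (set_val z.1 * set_val z.2).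
have cm : continuous m.
  refine (cts_comp _ (@clampI_continuous R)).
  by cts; exact: itv_val_continuous.
have m0 s : m (itv0 R, s) = itv0 R by rewrite /m clampI0 //= mul0r.
have m1 s : m (itv1 R, s) = s by rewrite /m /= mul1r clampIK.
pose g (z : kprod (paths X) I) (t : itv R) : X := path_at z.1 (m (z.2, t)).
have cg : continuous ((fun z => g z.1 z.2) : kprod (kprod (paths X) I) I -> X).
  apply: (path_at_continuous (S := kprod (kprod (paths X) I) I)).
    exact: (continuous_o (@kfst_continuous _ I) (@kfst_continuous _ I)).
  have c2 := continuous_o (@kfst_continuous (kprod (paths X) I) I)
    (@ksnd_continuous (paths X) I).
  have c3 := @ksnd_continuous (kprod (paths X) I) I.
  refine (@cts_comp (kprod (kprod (paths X) I) I) (itv R * itv R)%type (itv R)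
    (fun z => (z.1.2, z.2)) m _ cm).
  exact: cts_pair c2 c3.
have [A cA AE] := path_curry cg.
apply: (homotopy_equivalence cev cc).
  exists A => //; split=> p; apply: path_ext => s; rewrite AE /g /=.
    by rewrite m0 cE.
  by rewrite m1.
exists fst; first exact: kfst_continuous.
by split=> x //=; rewrite /ev cE.
Qed.

Lemma square_aspherical X : aspherical R X -> aspherical R (square X).
Proof.
move=> [cX aX]; split=> [p q|n p0 f n0 [cf f0]].
  have [g0 cg0 [g00 g01]] := cX (square_at p false) (square_at q false).
  have [g1 cg1 [g10 g11]] := cX (square_at p true) (square_at q true).
  have cg b : continuous ((fun s => if b then g1 s else g0 s) : I -> X) by case: b.
  have [F cF FE] := square_curry cg.
  by exists F => //; split; apply: square_ext => -[]; rewrite FE.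
have lf b : loops (square_at p0 b) (fun t => square_at (f t) b).
  split; first exact: (@square_at_continuous (cube_space R n) X f b cf).
  by move=> t bt; rewrite f0.
have [H1 cH1 [H10 H11 H1b]] := aX _ _ _ n0 (lf true).
have [H0 cH0 [H00 H01 H0b]] := aX _ _ _ n0 (lf false).
have cg b : continuous ((fun s => if b then H1 s else H0 s) : cube_itv_space R n -> X).
  by case: b.
have [F cF FE] := square_curry cg.
exists F => //; split=> [t|t|t s bt]; apply: square_ext => -[]; rewrite FE //.
- exact: H1b.
- exact: H0b.
Qed.

(* Given a path over time [0] and the motions [b0], [b1] of its two ends, the
   path at time [t] runs back along [b0], then along the given path, then along
   [b1]; [w = s (1 + 2 t) - t] is the position on it, between [- t] and [1 + t]. *)
Lemma ends_square_fibration X : serre_fibration R (@ends_square X).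
Proof.
split=> [|n h H ch cH hH]; first exact: ends_square_continuous.
pose a (z : cube R n * itv R) : X := path_at (h z.1) z.2.
pose b c (z : cube R n * itv R) : X := square_at (H z) c.
have ca : continuous a.
  apply: (path_at_continuous (S := cube_itv_space R n)).
    by apply: (@cts_fst (cube R n) (itv R) (paths X) h).
  by move=> z; exact: cvg_snd.
have cb c : continuous (b c) by exact: (@square_at_continuous (cube_itv_space R n) X H c cH).
have ab0 x : b false (x, itv0 R) = a (x, itv0 R) by rewrite /b hH ends_squareE.
have ab1 x : b true (x, itv0 R) = a (x, itv1 R) by rewrite /b hH ends_squareE.
pose w (z : (cube R n * itv R) * itv R) : R :=
  (set_val z.2 : R) * (1 + 2 * set_val z.1.2) - set_val z.1.2.
have c12 : continuous (fun z : (cube R n * itv R) * itv R => set_val z.1.2 : R).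
  apply: (@cts_fst _ _ _ (fun y : cube R n * itv R => set_val y.2 : R)).
  by apply: (@cts_snd _ _ _ (set_val : itv R -> R)); exact: itv_val_continuous.
have cw : continuous w.
  rewrite /w; cts; exact: itv_val_continuous.
pose g z : X := if w z <= 0 then b false (z.1.1, clampI (- w z)) else
  if w z - 1 <= 0 then a (z.1.1, clampI (w z)) else b true (z.1.1, clampI (w z - 1)).
have c1 : continuous (fun z : (cube R n * itv R) * itv R => z.1.1).
  by apply: (@cts_fst _ _ _ (fun y : cube R n * itv R => y.1)); cts.
have cg : continuous g.
  apply: glue_continuous => //.
  - refine (cts_comp _ (cb false)); apply: cts_pair => //.
    by refine (cts_comp _ (@clampI_continuous R)); cts.
  - apply: glue_continuous => [|||z z0]; first by cts.
    + refine (cts_comp _ ca); apply: cts_pair => //.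
      by refine (cts_comp _ (@clampI_continuous R)); cts.
    + refine (cts_comp _ (cb true)); apply: cts_pair => //.
      by refine (cts_comp _ (@clampI_continuous R)); cts.
    + by rewrite z0 clampI1 ?clampI0 //; lra.
  - by move=> z z0; rewrite z0 ifT ?oppr0 ?clampI0 //; lra.
have cg' : continuous ((fun z => g (z.1, z.2)) : kprod (cube_itv_space R n) I -> X).
  apply: (@continuous_o (kprod (cube_itv_space R n) I)
    ((cube R n * itv R) * itv R)%type X (fun z => (z.1, z.2)) g _ cg).
    exact: (cts_pair (@kfst_continuous (cube_itv_space R n) I)
    (@ksnd_continuous (cube_itv_space R n) I)).
have [G cG GE] := @path_curry (cube_itv_space R n) X (fun y t => g (y, t)) cg'.
exists G => //; split=> [x|[x t]].
  apply: path_ext => s; rewrite GE /g /w /=.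
  have := itvP s => s01.
  rewrite mulr0 addr0 subr0 mulr1 clampIK; case: ifP => s0.
    have -> : s = itv0 R by rewrite -(clampIK s) clampI0.
    by rewrite clampI0 ?ab0 //= oppr0.
  by rewrite ifT //; lra.
have := itvP t => t01.
have v0 : set_val (itv0 R) = 0 :> R by [].
have v1 : set_val (itv1 R) = 1 :> R by [].
apply: square_ext => -[]; rewrite ends_squareE GE /g /w /= ?v0 ?v1.
  rewrite ifF; last by apply/negbTE; rewrite -ltNge; lra.
  case: ifP => t0.
    have -> : t = itv0 R by rewrite -(clampIK t) clampI0 //; lra.
    by rewrite clampI1 //=; [exact/esym/ab1|lra].
  rewrite (_ : _ - _ - _ = set_val t) ?clampIK //; lra.
rewrite ifT; last by lra.
by rewrite (_ : - _ = set_val t) ?clampIK //; lra.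
Qed.

End PathSpace.

(** * Homotopies of infinitesimal bimodules *)

Section CotensorBimodule.
Variables (S : Type) (O : operad S) (J : Type) (K : J -> space).

Section Operations.
Variable M : ibimod O.
Local Notation cotM := (fun l s => cotensor K (M l s)).

Lemma cot_lcomp_continuous u v w l r a s (e1 : l = u ++ a :: v)
    (e2 : r = u ++ w ++ v) j (T : space) (x : T -> O l s) (y : T -> cotM w a)
    (k : T -> K j) :
  continuous x -> continuous y -> continuous k ->
  continuous (fun t => ib_lcomp e1 e2 (x t) (cot (y t) (k t))).
Proof.
move=> cx cy ck.
exact: (continuous_o (kpair_continuous cx (cot_apply_continuous cy ck))
  (@ib_lcontinuous S O M _ _ _ _ _ _ _ e1 e2)).
Qed.

Lemma cot_rcomp_continuous u v w l r a s (e1 : l = u ++ a :: v)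
    (e2 : r = u ++ w ++ v) j (T : space) (x : T -> cotM l s) (y : T -> O w a)
    (k : T -> K j) :
  continuous x -> continuous y -> continuous k ->
  continuous (fun t => ib_rcomp e1 e2 (cot (x t) (k t)) (y t)).
Proof.
move=> cx cy ck.
exact: (continuous_o (kpair_continuous (cot_apply_continuous cx ck) cy)
  (@ib_rcontinuous S O M _ _ _ _ _ _ _ e1 e2)).
Qed.

Definition cot_lcomp : pcomp O cotM cotM :=
  fun u v w l r a s e1 e2 x y =>
    mk_map (P := [set: forall j, K j -> M r s])
      (fun j => @cot_lcomp_continuous u v w l r a s e1 e2 j (K j) (fun=> x) (fun=> y) id
        (@cts_cst _ _ x) (@cts_cst _ _ y) (@cts_id (K j)))
      Logic.I.

Definition cot_rcomp : pcomp cotM O cotM :=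
  fun u v w l r a s e1 e2 x y =>
    mk_map (P := [set: forall j, K j -> M r s])
      (fun j => @cot_rcomp_continuous u v w l r a s e1 e2 j (K j) (fun=> x) (fun=> y) id
        (@cts_cst _ _ x) (@cts_cst _ _ y) (@cts_id (K j)))
      Logic.I.

Lemma cot_lcontinuous : pcomp_continuous cot_lcomp.
Proof.
move=> u v w l r a s e1 e2; apply: map_curry_continuous => j.
apply: (@cot_lcomp_continuous _ _ _ _ _ _ _ e1 e2 j
  (kprod (kprod (O l s) (cotM w a)) (K j)) (fun z => z.1.1) (fun z => z.1.2) snd).
- exact: (continuous_o (@kfst_continuous _ (K j)) (@kfst_continuous _ _)).
- exact: (continuous_o (@kfst_continuous _ (K j)) (@ksnd_continuous _ _)).
- exact: ksnd_continuous.
Qed.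

Lemma cot_rcontinuous : pcomp_continuous cot_rcomp.
Proof.
move=> u v w l r a s e1 e2; apply: map_curry_continuous => j.
apply: (@cot_rcomp_continuous _ _ _ _ _ _ _ e1 e2 j
  (kprod (kprod (cotM l s) (O w a)) (K j)) (fun z => z.1.1) (fun z => z.1.2) snd).
- exact: (continuous_o (@kfst_continuous _ (K j)) (@kfst_continuous _ _)).
- exact: (continuous_o (@kfst_continuous _ (K j)) (@ksnd_continuous _ _)).
- exact: ksnd_continuous.
Qed.

Definition cot_ibimod : ibimod O.
Proof.
apply: (@Ibimod S O cotM cot_lcomp cot_rcomp cot_lcontinuous cot_rcontinuous).
- abstract (by move=> *; apply: cot_ext => j k; exact: ib_seq_l).
- abstract (by move=> *; apply: cot_ext => j k; exact: ib_seq_m).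
- abstract (by move=> *; apply: cot_ext => j k; exact: ib_seq_r).
- abstract (by move=> *; apply: cot_ext => j k; exact: ib_par_l).
- abstract (by move=> *; apply: cot_ext => j k; exact: ib_par_m).
- abstract (by move=> *; apply: cot_ext => j k; exact: ib_par_r).
- abstract (by move=> l s e1 e2 x; apply: cot_ext => j k; exact: ib_unitl).
- abstract (by move=> u v l a s e1 e2 x; apply: cot_ext => j k; exact: ib_unitr).
Defined.

End Operations.
End CotensorBimodule.

Section IbimodHomotopy.
Variables (R : realType) (S : Type) (O : operad S).
Implicit Types M N P C A : ibimod O.

Lemma ibimod_map_lcomp M N (f : Ibimod_map M N) u v w l r a s
    (e1 : l = u ++ a :: v) (e2 : r = u ++ w ++ v) (x : O l s) (m : M w a) :
  mapf f (r, s) (ib_lcomp e1 e2 x m) = ib_lcomp e1 e2 x (mapf f (w, a) m).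
Proof. exact: (mapf_law f).1. Qed.

Lemma ibimod_map_rcomp M N (f : Ibimod_map M N) u v w l r a s
    (e1 : l = u ++ a :: v) (e2 : r = u ++ w ++ v) (m : M l s) (x : O w a) :
  mapf f (r, s) (ib_rcomp e1 e2 m x) = ib_rcomp e1 e2 (mapf f (l, s) m) x.
Proof. exact: (mapf_law f).2. Qed.

Definition paths_ib M : ibimod O := cot_ibimod (fun _ : unit => itv_space R) M.
Definition square_ib M : ibimod O := cot_ibimod (fun _ : bool => point) M.

Definition ibimod_homotopy M N (H : Ibimod_map M (paths_ib N)) (f g : Ibimod_map M N) :=
  forall i x, path_at (mapf H i x) (itv0 R) = mapf f i x /\
              path_at (mapf H i x) (itv1 R) = mapf g i x.

Lemma ibimod_comp_subproof M N P (g : Ibimod_map N P) (f : Ibimod_map M N) :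
  ibimod_law (fun i x => mapf g i (mapf f i x)).
Proof.
by split=> *; rewrite ?ibimod_map_lcomp ?ibimod_map_rcomp.
Qed.

Definition ibimod_comp M N P (g : Ibimod_map N P) (f : Ibimod_map M N) : Ibimod_map M P :=
  mk_map (fun i => continuous_o (@mapf_continuous _ _ _ _ f i) (@mapf_continuous _ _ _ _ g i))
    (ibimod_comp_subproof g f).

Lemma ibimod_id_subproof M : ibimod_law (fun i (x : M i.1 i.2) => x).
Proof. by []. Qed.

Definition ibimod_id M : Ibimod_map M M :=
  mk_map (fun i => @cts_id (M i.1 i.2)) (@ibimod_id_subproof M).

Lemma precomp_continuous M N P (f : Ibimod_map M N) :
  continuous ((fun g => ibimod_comp g f) : Ibimod_map N P -> Ibimod_map M P).
Proof.
apply: map_curry_continuous => i.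
apply: (@map_apply_continuous _ _ _ _ (kprod (Ibimod_map N P) (M i.1 i.2)) i fst
  (fun z => mapf f i z.2)).
  exact: kfst_continuous.
exact: (continuous_o (@ksnd_continuous _ (M i.1 i.2)) (@mapf_continuous _ _ _ _ f i)).
Qed.

(** At each time, [k] is applied to the value of the path [H] at that time; every time slice is a
    bimodule map because operations on paths are pointwise. *)
Lemma homotopy_precomp M N P (f g : Ibimod_map M N) (H : Ibimod_map M (paths_ib N)) :
  ibimod_homotopy H f g ->
  homotopy R ((fun k => ibimod_comp k f) : Ibimod_map N P -> Ibimod_map M P)
             (fun k => ibimod_comp k g).
Proof.
move=> Hfg; pose I := itv_space R.
have law (z : kprod (Ibimod_map N P) I) :
    @ibimod_law S O M P (fun i x => mapf z.1 i (path_at (mapf H i x) z.2)).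
  split=> [u v w l r a s e1 e2 x m|u v w l r a s e1 e2 m x].
    by rewrite (ibimod_map_lcomp H); exact: (ibimod_map_lcomp z.1).
  by rewrite (ibimod_map_rcomp H); exact: (ibimod_map_rcomp z.1).
have cA i : continuous ((fun z => mapf z.1.1 i (path_at (mapf H i z.2) z.1.2)) :
    kprod (kprod (Ibimod_map N P) I) (M i.1 i.2) -> P i.1 i.2).
  pose Mi := M i.1 i.2; pose T := kprod (kprod (Ibimod_map N P) I) Mi.
  apply: (@map_apply_continuous _ _ _ _ T i (fun z => z.1.1)
    (fun z => path_at (mapf H i z.2) z.1.2)).
    exact: (continuous_o (@kfst_continuous _ Mi) (@kfst_continuous _ I)).
  apply: (@path_at_continuous R T (N i.1 i.2) (fun z => mapf H i z.2) (fun z => z.1.2)).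
    exact: (continuous_o (@ksnd_continuous _ Mi) (@mapf_continuous _ _ _ _ H i)).
  exact: (continuous_o (@kfst_continuous _ Mi) (@ksnd_continuous _ I)).
have cz (z : kprod (Ibimod_map N P) I) i :
    continuous ((fun x => mapf z.1 i (path_at (mapf H i x) z.2)) : M i.1 i.2 -> P i.1 i.2).
  exact: (continuous_o (@kprod_pairl_continuous (kprod (Ibimod_map N P) I) (M i.1 i.2) z)
    (cA i)).
exists (fun z => mk_map (cz z) (law z)).
  by apply: map_curry_continuous => i; exact: cA.
by split=> k; apply: map_ext => i x; have [h0 h1] := Hfg i x; rewrite mk_mapE ?h0 ?h1.
Qed.

Lemma homotopy_equivalent_ibimods P C M (f : Ibimod_map P C) (g : Ibimod_map C P)
    (H : Ibimod_map P (paths_ib P)) (L : Ibimod_map C (paths_ib C)) :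
  ibimod_homotopy H (ibimod_comp g f) (ibimod_id P) ->
  ibimod_homotopy L (ibimod_comp f g) (ibimod_id C) ->
  weakly_equivalent R (Ibimod_map P M) (Ibimod_map C M).
Proof.
move=> hH hL; apply: rst_step; exists (fun k => ibimod_comp k g).
apply: (@homotopy_equivalence R _ _ _ (fun k => ibimod_comp k f)).
- exact: precomp_continuous.
- exact: precomp_continuous.
- have [A cA [A0 A1]] := homotopy_precomp M hH.
  by exists A => //; split=> k; rewrite ?A0 ?A1; apply: map_ext.
- have [A cA [A0 A1]] := homotopy_precomp M hL.
  by exists A => //; split=> k; rewrite ?A0 ?A1; apply: map_ext.
Qed.

Definition ib_aspherical M := forall l s, aspherical R (M l s).

Lemma square_lcomp M u v w l r a s (e1 : l = u ++ a :: v) (e2 : r = u ++ w ++ v)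
    (x : O l s) (y : square_ib M w a) b :
  square_at (X := M r s) (ib_lcomp e1 e2 x y) b =
  ib_lcomp e1 e2 x (square_at (X := M w a) y b).
Proof. by []. Qed.

Lemma square_rcomp M u v w l r a s (e1 : l = u ++ a :: v) (e2 : r = u ++ w ++ v)
    (y : square_ib M l s) (x : O w a) b :
  square_at (X := M r s) (ib_rcomp e1 e2 y x) b =
  ib_rcomp e1 e2 (square_at (X := M l s) y b) x.
Proof. by []. Qed.

Lemma ends_square_law M :
  @ibimod_law S O (paths_ib M) (square_ib M) (fun i => @ends_square R (M i.1 i.2)).
Proof.
split=> [u v w l r a s e1 e2 x y|u v w l r a s e1 e2 y x]; apply: square_ext => b;
  apply: (etrans (ends_squareE _ _)).
  by apply: etrans (esym (square_lcomp e1 e2 x _ b)); rewrite ends_squareE.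
by apply: etrans (esym (square_rcomp e1 e2 _ x b)); rewrite ends_squareE.
Qed.

Lemma cofibrant_homotopic P N (f g : Ibimod_map P N) :
  ib_cofibrant R P -> ib_aspherical N ->
  exists H : Ibimod_map P (paths_ib N), ibimod_homotopy H f g.
Proof.
move=> cP aN.
pose p : Ibimod_map (paths_ib N) (square_ib N) :=
  mk_map (fun i => @ends_square_continuous R (N i.1 i.2)) (@ends_square_law N).
have sq i := @square_curry (P i.1 i.2) (N i.1 i.2)
  (fun x b => if b then mapf g i x else mapf f i x).
have sqc i : forall b, continuous
    ((fun x => if b then mapf g i x else mapf f i x) : P i.1 i.2 -> N i.1 i.2).
  by case; [exact: (@mapf_continuous _ _ _ _ g i)|exact: (@mapf_continuous _ _ _ _ f i)].
pose q i := projT1 (cid2 (sq i (sqc i))).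
have cq i : continuous (q i) by rewrite /q; case: cid2.
have qE i x b : square_at (q i x) b = if b then mapf g i x else mapf f i x.
  by rewrite /q; case: cid2 => F cF FE /=; exact: FE.
have lq : @ibimod_law S O P (square_ib N) q.
  split=> [u v w l r a s e1 e2 x m|u v w l r a s e1 e2 m x]; apply: square_ext => b;
    apply: (etrans (qE (r, s) _ b)).
    apply: etrans (esym (square_lcomp e1 e2 x (q (w, a) m) b)); rewrite (qE (w, a)).
    by case: b; exact: ibimod_map_lcomp.
  apply: etrans (esym (square_rcomp e1 e2 (q (l, s) m) x b)); rewrite (qE (l, s)).
  by case: b; exact: ibimod_map_rcomp.
have [|i|H HE] := cP _ _ p (mk_map cq lq).
- by move=> i; exact: ends_square_fibration.
(* The fibration is trivial because paths and pairs in an aspherical space are aspherical; a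
   constant path shows that no nonempty target is missed. *)
- apply: aspherical_weak_equivalence.
  + exact: (@mapf_continuous _ _ _ _ p i).
  + exact/paths_aspherical/aN.
  + exact/square_aspherical/aN.
  + move=> y; have cc := @cts_cst (itv_space R) _ (square_at y true).
    by exists (mk_map (P := [set: forall j : unit, itv_space R -> N i.1 i.2])
      (fun=> cc) Logic.I).
exists H => i x; have e b := congr1 (fun z => square_at z b) (HE i x).
by have := e false; have := e true; rewrite /= !mk_mapE !qE !ends_squareE.
Qed.

Lemma cofibrant_map P C A (p : Ibimod_map C A) (g : Ibimod_map P A) :
  (forall l s (x y : A l s), x = y) -> ib_cofibrant R P -> ib_aspherical C ->
  (forall l s, A l s -> exists _ : C l s, True) ->
  exists _ : Ibimod_map P C, True.
Proof.
move=> sA cP aC neC; have [|i|h _] := cP _ _ p g; last by exists h.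
  move=> i; split=> [|n h H ch cH hH]; first exact: (@mapf_continuous _ _ _ _ p i).
  (* Over a base with at most one point, a lift that is constant in time covers every homotopy. *)
  exists (h \o fst); last by split=> // z; exact: sA.
  by apply: (@cts_fst _ _ _ h).
apply: aspherical_weak_equivalence => //.
- exact: (@mapf_continuous _ _ _ _ p i).
- by apply: subsingleton_aspherical; exact: (sA i.1 i.2).
- exact: (neC i.1 i.2).
Qed.

Lemma replacement_aspherical A (P : cofibrant_replacement R A) :
  (forall l s (x y : A l s), x = y) -> ib_aspherical (cr_obj P).
Proof.
move=> sA l s; apply: (weak_equivalence_aspherical (cr_weq P (l, s))).
by apply: subsingleton_aspherical; exact: sA.
Qed.

Lemma replacement_inhabited A (P : cofibrant_replacement R A) l s :
  A l s -> exists _ : cr_obj P l s, True.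
Proof. by move=> x; exact: (weak_equivalence_inhabited (x : A (l, s).1 (l, s).2) (cr_weq P (l, s))). Qed.

(** The maps in the two directions may be arbitrary: asphericity of the replacement and the last
    hypothesis on [C] make both composites homotopic to identities. *)
Lemma replacement_comparison A (P : cofibrant_replacement R A) C M
    (p : Ibimod_map C A) (g : Ibimod_map C (cr_obj P)) :
  (forall l s (x y : A l s), x = y) -> ib_aspherical C ->
  (forall l s, A l s -> exists _ : C l s, True) ->
  (forall k : Ibimod_map C C, exists H, @ibimod_homotopy C C H k (ibimod_id C)) ->
  weakly_equivalent R (Ibimod_h P M) (Ibimod_map C M).
Proof.
move=> sA aC neC hC.
have [f _] := cofibrant_map p (cr_map P) sA (@cr_cofibrant _ _ _ _ P) aC neC.
have [H hH] := cofibrant_homotopic (ibimod_comp g f) (ibimod_id _) (@cr_cofibrant _ _ _ _ P)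
  (replacement_aspherical P sA).
have [L hL] := hC (ibimod_comp f g).
exact: homotopy_equivalent_ibimods hH hL.
Qed.

End IbimodHomotopy.

(** * Extension from the boundary of a simplex *)

Section Gauge.
Variables (R : realType) (n : nat).
Implicit Types z : 'rV[R]_n.+1.

(* On the hyperplane [\sum_i z_i = 0], the Minkowski gauge of the simplex
   centred at its barycentre, in the coordinates [z = (n + 1) x - 1]. *)
Definition gauge z : R := `|\row_i Num.max 0 (- z ord0 i)|.

Lemma gauge_ge z i : - z ord0 i <= gauge z.
Proof.
apply: le_trans (coord_le_norm _ i); rewrite mxE.
by apply: le_trans (ler_norm _); rewrite le_max lexx orbT.
Qed.

Lemma gauge_leP z c : 0 <= c -> (forall i, - z ord0 i <= c) -> gauge z <= c.
Proof.
move=> c0 h; apply/mx_norm_leP => // i; rewrite mxE ger0_norm ?le_max ?lexx //.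
by rewrite ge_max c0 h.
Qed.

Lemma gauge_ge0 z : 0 <= gauge z. Proof. exact: normr_ge0. Qed.

Lemma gauge_attained z : 0 < gauge z -> exists i, - z ord0 i = gauge z.
Proof.
have [i] := norm_coord (\row_i Num.max 0 (- z ord0 i)) (ltn0Sn n).
rewrite mxE -/(gauge z) ger0_norm ?le_max ?lexx // => e g0; exists i.
by move: e g0; case: (lerP 0 (- z ord0 i)) => // _ <-; rewrite ltxx.
Qed.

Lemma gaugeZ c z : 0 <= c -> gauge (c *: z) = c * gauge z.
Proof.
move=> c0; rewrite /gauge -(ger0_norm c0) -normrZ ger0_norm //; congr (`|_|).
by apply/rowP => i; rewrite !mxE -mulrN maxr_pMr // mulr0.
Qed.

(** If no coordinate is negative, a zero sum forces every coordinate to vanish. *)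
Lemma gauge_gt0 z : \sum_i z ord0 i = 0 -> z != 0 -> 0 < gauge z.
Proof.
move=> s0 z0; rewrite lt0r gauge_ge0 andbT; apply: contra z0 => /eqP g0.
have zge i : 0 <= z ord0 i by have := gauge_ge z i; rewrite g0; lra.
apply/eqP/rowP => i; rewrite mxE; apply/eqP.
by have /psumr_eq0P := s0; move=> /(_ (fun i _ => zge i)) ->.
Qed.

Lemma gauge_continuous : continuous gauge.
Proof.
rewrite /gauge; apply: cts_norm; apply: cts_row => i.
have -> : (fun z => (\row_j Num.max 0 (- z ord0 j)) ord0 i) =
    (fun z : 'rV[R]_n.+1 => Num.max 0 (- z ord0 i)).
  by apply/funext => z; rewrite mxE.
by cts; exact: coord_continuous.
Qed.

End Gauge.

(** * The simplex as a quotient of a cube times an interval *)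

Section Directions.
Variables (R : realType) (m : nat).
Hypothesis m0 : (0 < m)%N.
Implicit Types (u p : 'rV[R]_m).

(* [u |-> (dir_row u, dir_last u)] collapses the unit sphere of the max norm to a
   point and maps the open unit ball bijectively onto the remaining directions. *)
Definition dir_row u : 'rV[R]_m := (1 - `|u|) *: u.
Definition dir_last u : R := 1 - 2 * `|u|.

Lemma dir_surj p c : (p != 0) || (c != 0) -> exists u l,
  [/\ `|u| <= 1, 0 < l, dir_row u = l *: p & dir_last u = l * c].
Proof.
have [-> /= c0|p0 _] := eqVneq p 0.
  (* The two poles: the centre of the ball gives the positive one, and the collapsed unit sphere the
     negative one. *)
  have [cp|cn] := ltrP 0 c.
    exists 0, c^-1; rewrite normr0 invr_gt0 /dir_row /dir_last !scaler0 normr0.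
    by split=> //; rewrite mulVf // mulr0 subr0.
  have {}cn : c < 0 by rewrite lt_neqAle c0.
  have n1 : `|const_mx 1 : 'rV[R]_m| = 1.
    by have [i <-] := norm_coord (const_mx 1 : 'rV[R]_m) m0; rewrite mxE normr1.
  exists (const_mx 1), (- c^-1); rewrite /dir_row /dir_last n1 subrr scale0r scaler0.
  by split=> //; rewrite ?oppr_gt0 ?invr_lt0 // mulNr mulVf //; lra.
have a0 : 0 < `|p| by rewrite normr_gt0.
set a := `|p| in a0.
(* For [u = (r / a) *: p], proportionality of the direction of [u] to [(p, c)] says exactly that
   [g r = 0]; the opposite signs at 0 and 1 give a root strictly between. *)
pose g (r : R) := c * (r * (1 - r)) - a * (1 - 2 * r).
have cg : {within `[0, 1], continuous g}.
  by apply: continuous_subspaceT; rewrite /g; cts.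
have g0 : g 0 = - a by rewrite /g; ring.
have g1 : g 1 = a by rewrite /g; ring.
have [|r] := @IVT R g 0 1 0 ler01 cg.
  by rewrite g0 g1 ge_min le_max; apply/andP; split; apply/orP; [left|right]; lra.
rewrite in_itv /= => /andP[r0 r1] gr.
have {}r0 : 0 < r.
  by rewrite lt0r r0 andbT; apply/eqP => e; move: gr; rewrite e g0; lra.
have {}r1 : r < 1.
  by rewrite lt_neqAle r1 andbT; apply/eqP => e; move: gr; rewrite e g1; lra.
have nu : `|(r / a) *: p| = r.
  by rewrite normrZ ger0_norm ?divr_ge0 ?(ltW r0) ?(ltW a0) // -/a divfK // gt_eqF.
exists ((r / a) *: p), (r * (1 - r) / a); rewrite /dir_row /dir_last nu; split.
- exact: ltW.
- by rewrite divr_gt0 // mulr_gt0 //; lra.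
- by rewrite scalerA; congr (_ *: _); field; rewrite gt_eqF.
- have e : a * (1 - 2 * r) = c * (r * (1 - r)) by move: gr; rewrite /g; lra.
  have an : a != 0 by rewrite gt_eqF.
  by apply: (mulfI an); rewrite e; field.
Qed.

Lemma dir_inj u v l : `|u| <= 1 -> `|v| <= 1 -> 0 < l ->
  dir_row u = l *: dir_row v -> dir_last u = l * dir_last v ->
  u = v \/ (`|u| = 1 /\ `|v| = 1).
Proof.
rewrite /dir_row /dir_last => u1 v1 l0 er es.
have ur0 := normr_ge0 u; have vr0 := normr_ge0 v.
have en : `|u| * (1 - `|u|) = l * (`|v| * (1 - `|v|)).
  have := congr1 (fun x : 'rV[R]_m => `|x|) er.
  rewrite !normrZ !ger0_norm ?subr_ge0 //; last by rewrite (ltW l0).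
  by move=> e; rewrite mulrC e; ring.
set r := `|u| in u1 ur0 er es en *; set t := `|v| in v1 vr0 er es en *.
(* This is what remains after eliminating [l] from [en] and [es]. The second factor vanishes only if
   one norm is 0 and the other 1, i.e. at opposite poles, which [l > 0] excludes. *)
have /eqP : (r - t) * ((1 - r) * (1 - t) + r * t) = 0.
  have : r * (1 - r) * (1 - 2 * t) = t * (1 - t) * (1 - 2 * r).
    by rewrite en es; ring.
  lra.
rewrite mulf_eq0 subr_eq0 => /orP[/eqP rt|/eqP h].
  rewrite -rt in er es en *.
  have [r1|r1] := eqVneq r 1; first by right.
  have [r0|r0] := eqVneq r 0.
    left; have u0 : u = 0 by apply/eqP; rewrite -normr_eq0 -/r r0.
    have v0 : v = 0 by apply/eqP; rewrite -normr_eq0 -/t -rt r0.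
    by rewrite u0 v0.
  left; have nz : r * (1 - r) != 0 by rewrite mulf_neq0 // subr_eq0 eq_sym.
  have l1 : l = 1 by apply: (mulIf nz); rewrite mul1r.
  have nz1 : 1 - r != 0 by rewrite subr_eq0 eq_sym.
  by move: er; rewrite l1 scale1r => /(scalerI nz1).
exfalso; have h1 : 0 <= (1 - r) * (1 - t) by apply: mulr_ge0; lra.
have h2 : 0 <= r * t by exact: mulr_ge0.
have /eqP : r * t = 0 by lra.
have /eqP : (1 - r) * (1 - t) = 0 by lra.
rewrite !mulf_eq0 => /orP[]/eqP a /orP[]/eqP b; move: es; nra.
Qed.

Lemma dir_continuous : continuous dir_row /\ continuous dir_last.
Proof. by split; rewrite /dir_row /dir_last; cts. Qed.

Lemma dir_neq0 u : (dir_row u != 0) || (dir_last u != 0).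
Proof.
rewrite /dir_last /dir_row; have [e|_] := eqVneq (1 - 2 * `|u|) 0; last by rewrite orbT.
rewrite orbF scaler_eq0 negb_or -(normr_eq0 u); apply/andP; split; apply/eqP => h; lra.
Qed.

(** Linear coordinates [(p, c)] on the hyperplane of sum zero: the last entry balances the
    others. *)
Definition dir_vec p c : 'rV[R]_m.+2 :=
  \row_i (if unlift ord_max i is Some j then
            (if unlift ord_max j is Some k then p ord0 k else c)
          else - (c + \sum_k p ord0 k)).

Lemma dir_vec_sum p c : \sum_i dir_vec p c ord0 i = 0.
Proof.
rewrite (bigD1_ord ord_max) //= mxE unlift_none (bigD1_ord ord_max) //= mxE liftK unlift_none.
under [X in _ + (_ + X)]eq_bigr do rewrite mxE !liftK.
by rewrite addNr.
Qed.

Lemma dir_vec_of (y : 'rV[R]_m.+2) : \sum_i y ord0 i = 0 ->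
  y = dir_vec (\row_k y ord0 (lift ord_max (lift ord_max k))) (y ord0 (lift ord_max ord_max)).
Proof.
rewrite (bigD1_ord ord_max) //= (bigD1_ord ord_max) //= => s0; apply/rowP => i; rewrite mxE.
case: unliftP => [j ->|->]; first by case: unliftP => [k ->|->]; rewrite ?mxE.
by under eq_bigr do rewrite mxE; lra.
Qed.

Lemma dir_vecZ p c l : dir_vec (l *: p) (l * c) = l *: dir_vec p c.
Proof.
apply/rowP => i; rewrite !mxE; case: unlift => [j|].
  by case: unlift => [k|] //; rewrite mxE.
by rewrite mulrN mulrDr mulr_sumr; under eq_bigr do rewrite mxE.
Qed.

Lemma dir_vec_inj p c p' c' : dir_vec p c = dir_vec p' c' -> p = p' /\ c = c'.
Proof.
move=> /rowP e; split.
  by apply/rowP => k; have := e (lift ord_max (lift ord_max k)); rewrite !mxE !liftK.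
by have := e (lift ord_max ord_max); rewrite !mxE !liftK unlift_none.
Qed.

End Directions.

Definition simplex_boundary (R : realType) n : set (simplex R n) :=
  [set x | exists i, simplex_val x ord0 i = 0].

(** Continuity of the restriction of [phi] to the boundary, a closed set, stated without the
    subtype: [phi] can be a total function with dummy values inside. *)
Definition closed_extendable (R : realType) n (X : topologicalType) (phi : simplex R n -> X) :=
  forall A, closed A -> closed (phi @^-1` A `&` @simplex_boundary R n).

Section SimplexDisc.
Variables (R : realType) (m : nat).
Hypothesis m0 : (0 < m)%N.
Local Notation K := (cube R m * itv R)%type.
Local Notation D := (simplex R m.+1).
Local Notation N := (m.+2%:R : R).

Let N0 : N != 0. Proof. by rewrite pnatr_eq0. Qed.

Definition dirz (u : 'rV[R]_m) : 'rV[R]_m.+2 := dir_vec (dir_row u) (dir_last u).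

Lemma dirz_gauge u : 0 < gauge (dirz u).
Proof.
apply: gauge_gt0; first exact: dir_vec_sum.
have nz := dir_neq0 u; apply: contraTN nz => /eqP e.
have : dirz u = dir_vec (0 : 'rV_m) 0.
  rewrite e; apply/rowP => i; rewrite !mxE; case: unlift => [j|].
    by case: unlift => [k|] //; rewrite mxE.
  by under eq_bigr do rewrite mxE; rewrite sumr_const mul0rn addr0 oppr0.
by move=> /dir_vec_inj[-> ->]; rewrite !eqxx.
Qed.

Lemma dirz_continuous : continuous dirz.
Proof.
have [cr cl] := @dir_continuous R m.
apply: cts_row => i.
suff -> : (fun u => dirz u ord0 i) = (fun u =>
    if unlift ord_max i is Some j then
      (if unlift ord_max j is Some k then dir_row u ord0 k else dir_last u)
    else - (dir_last u + \sum_k dir_row u ord0 k)).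
  case: unlift => [j|].
    by case: unlift => [k|] //; exact: cts_coord.
  apply: ctsN; apply: ctsD => //; apply: cts_sum => k _; exact: cts_coord.
by apply/funext => u; rewrite mxE.
Qed.

Definition disc_row (s : R) (u : 'rV[R]_m) : 'rV[R]_m.+2 :=
  \row_i ((1 + s * (dirz u ord0 i / gauge (dirz u))) / N).

Lemma disc_subproof (z : K) :
  @simplex_set R m.+1 (disc_row (1 - set_val z.2) (of_cube z.1)).
Proof.
have /andP[t0 t1] := itvP z.2; set u := of_cube _; set s := 1 - _.
have g0 := dirz_gauge u.
split=> [i|].
  rewrite mxE divr_ge0 //.
  have h : - 1 <= dirz u ord0 i / gauge (dirz u).
    by rewrite ler_pdivlMr // mulN1r; have := gauge_ge (dirz u) i; lra.
  have : s * - 1 <= s * (dirz u ord0 i / gauge (dirz u)).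
    by apply: ler_wpM2l => //; rewrite /s; lra.
  rewrite /s in h *; lra.
under eq_bigr do rewrite mxE.
rewrite -mulr_suml big_split /= -mulr_sumr -mulr_suml dir_vec_sum mul0r mulr0 addr0.
by rewrite sumr_const card_ord divff.
Qed.

(* The cone from the barycentre over the collapsed sphere: radius [1 - z.2] in the
   gauge, direction given by [z.1]. A loop on the cube is thus a map on the boundary
   of the simplex, and a null homotopy of it is a map on the whole simplex. *)
Definition disc_map (z : K) : D :=
  (exist _ (disc_row (1 - set_val z.2) (of_cube z.1)) (mem_set (disc_subproof z))
    : @simplex_set R m.+1).

Lemma disc_mapE z i : simplex_val (disc_map z) ord0 i =
  (1 + (1 - set_val z.2) * (dirz (of_cube z.1) ord0 i / gauge (dirz (of_cube z.1)))) / N.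
Proof. by rewrite /simplex_val /= mxE. Qed.

Lemma disc_map_continuous : continuous disc_map.
Proof.
apply: continuous_comp_initial; apply: cts_row => i.
have -> : (fun z => (set_val \o disc_map) z ord0 i) = (fun z : K =>
    (1 + (1 - set_val z.2) * (dirz (of_cube z.1) ord0 i * (gauge (dirz (of_cube z.1)))^-1)) / N).
  by apply/funext => z; rewrite /= mxE.
have cz : continuous (fun z : K => dirz (of_cube z.1)).
  apply: (@cts_fst _ _ _ (fun t => dirz (of_cube t))).
  exact: (continuous_o (@of_cube_continuous R m) dirz_continuous).
apply: ctsM; last by cts.
apply: ctsD; first by cts.
apply: ctsM; first by cts; exact: itv_val_continuous.
apply: ctsM; first exact: cts_coord.
apply: ctsV; first by move=> z; rewrite gt_eqF ?dirz_gauge.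
exact: (continuous_o cz (@gauge_continuous R m.+1)).
Qed.

Lemma disc_map_boundary (t : cube R m) : simplex_boundary (disc_map (t, itv0 R)).
Proof.
have g0 := dirz_gauge (of_cube t); have [i hi] := gauge_attained g0.
exists i; rewrite disc_mapE /= subr0 mul1r.
have -> : dirz (of_cube t) ord0 i = - gauge (dirz (of_cube t)) by lra.
by rewrite mulNr divff ?gt_eqF // subrr mul0r.
Qed.

Definition centred (x : D) : 'rV[R]_m.+2 := \row_i (N * simplex_val x ord0 i - 1).

Lemma centred_sum x : \sum_i centred x ord0 i = 0.
Proof.
have [_ x1] := set_valP (x : @simplex_set R m.+1).
under eq_bigr do rewrite mxE.
by rewrite big_split /= -mulr_sumr x1 sumr_const card_ord mulr1 mulNrn subrr.
Qed.

Lemma centred_gauge x : gauge (centred x) <= 1.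
Proof.
have [x0 _] := set_valP (x : @simplex_set R m.+1).
apply: gauge_leP => // i; rewrite mxE.
have : 0 <= N * simplex_val x ord0 i by apply: mulr_ge0 => //; exact: x0.
lra.
Qed.

Lemma centred_disc z :
  centred (disc_map z) = ((1 - set_val z.2) / gauge (dirz (of_cube z.1))) *: dirz (of_cube z.1).
Proof.
apply/rowP => i; rewrite [LHS]mxE disc_mapE [RHS]mxE.
by rewrite [N * _]mulrC divfK // addrC addKr mulrA mulrAC.
Qed.

Lemma centred_disc_gauge z : gauge (centred (disc_map z)) = 1 - set_val z.2.
Proof.
have g0 := dirz_gauge (of_cube z.1); have := itvP z.2 => t01.
by rewrite centred_disc gaugeZ ?divfK ?gt_eqF // divr_ge0 ?(ltW g0) //; lra.
Qed.

Lemma centred_inj : injective centred.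
Proof.
move=> x y /rowP e; apply: simplex_val_inj; apply/rowP => i.
by have := e i; rewrite !mxE => h; apply: (mulfI N0); lra.
Qed.

Lemma disc_map_surj x : exists z, disc_map z = x.
Proof.
have [y0|y0] := eqVneq (centred x) 0.
  exists (to_cube 0, itv1 R); apply: centred_inj.
  by rewrite centred_disc /= subrr mul0r scale0r y0.
have ys := centred_sum x; have gy := gauge_gt0 ys y0; have gy1 := centred_gauge x.
move: (dir_vec_of ys); set p := \row__ _; set c := centred x _ _ => ye.
have [|u [l [u1 l0 er el]]] := @dir_surj R m m0 p c.
  rewrite -negb_and; apply: contra y0 => /andP[/eqP p0 /eqP c0].
  rewrite ye p0 c0; apply/eqP/rowP => i; rewrite !mxE; case: unlift => [j|].
    by case: unlift => [k|] //; rewrite mxE.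
  by under eq_bigr do rewrite mxE; rewrite sumr_const mul0rn addr0 oppr0.
have ze : dirz u = l *: centred x by rewrite /dirz er el dir_vecZ -ye.
(* Time is one minus the radius in the gauge, since time 0 is the boundary and time 1 the
   barycentre. *)
exists (to_cube u, clampI (1 - gauge (centred x))); apply: centred_inj.
rewrite centred_disc to_cubeK // (_ : set_val _ = clamp (1 - gauge (centred x))) //.
rewrite clamp_id; last by lra.
rewrite ze gaugeZ ?(ltW l0) // scalerA -[RHS]scale1r; congr (_ *: _).
by field; rewrite !gt_eqF.
Qed.

Lemma disc_map_boundaryP x : simplex_boundary x -> exists t, disc_map (t, itv0 R) = x.
Proof.
move=> [i xi]; have [[t s] e] := disc_map_surj x; exists t.
have h := centred_disc_gauge (t, s); rewrite e /= in h.
have := gauge_ge (centred x) i; rewrite mxE xi mulr0 h => hs.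
by have := itvP s => hs'; rewrite -e; congr disc_map; congr pair;
  rewrite -[RHS](clampIK s) clampI0 //; lra.
Qed.

(** The gauge recovers the time. Off the apex the direction is then known up to a positive factor,
    and [dir_inj] leaves only the collapsed sphere. *)
Lemma disc_map_fibre z z' : disc_map z = disc_map z' ->
  [\/ z = z', z.2 = itv1 R /\ z'.2 = itv1 R |
      cube_boundary z.1 /\ cube_boundary z'.1].
Proof.
case: z => t s; case: z' => t' s' e.
have es : s = s'.
  have h := centred_disc_gauge (t, s); have h' := centred_disc_gauge (t', s').
  rewrite e h' /= in h; apply: val_inj.
  by change (set_val s = set_val s' :> R); lra.
subst s'; have := congr1 centred e; rewrite !centred_disc /=.
have [s1|s1] := eqVneq (1 - set_val s : R) 0.
  by move=> _; constructor 2; rewrite -(clampIK s) clampI1 //; lra.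
have g0 := dirz_gauge (of_cube t); have g0' := dirz_gauge (of_cube t').
have hs : 0 < 1 - set_val s :> R by rewrite lt0r s1; have := itvP s; lra.
set u := of_cube t in g0 *; set v := of_cube t' in g0' *.
move=> /(congr1 (fun x => (gauge (dirz u) / (1 - set_val s)) *: x)).
rewrite !scalerA => ee.
have : dirz u = (gauge (dirz u) / gauge (dirz v)) *: dirz v.
  have a1 : gauge (dirz u) / (1 - set_val s) * ((1 - set_val s) / gauge (dirz u)) = 1.
    by field; rewrite s1 gt_eqF.
  rewrite a1 scale1r in ee; rewrite [LHS]ee; congr (_ *: _).
  by field; rewrite s1 !gt_eqF.
rewrite [in RHS]/dirz -dir_vecZ => /dir_vec_inj[er el].
have [uv|[u1 v1]] := dir_inj (of_cube_norm t) (of_cube_norm t') (divr_gt0 g0 g0') er el.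
  by constructor 1; have := congr1 (@to_cube R m) uv; rewrite !of_cubeK => ->.
constructor 3; split=> /=.
  by have := @to_cube_boundary R m u m0; rewrite of_cubeK u1; exact.
by have := @to_cube_boundary R m v m0; rewrite of_cubeK v1; exact.
Qed.

Lemma disc_map_cube_boundary t t' s :
  cube_boundary t -> cube_boundary t' -> disc_map (t, s) = disc_map (t', s).
Proof.
move=> bt bt'; apply: centred_inj; rewrite !centred_disc /=.
suff -> : dirz (of_cube t) = dirz (of_cube t') by [].
have h x : cube_boundary x -> `|of_cube x| = 1 :> R.
  by move=> bx; apply/eqP; rewrite eq_le of_cube_norm of_cube_boundary.
by rewrite /dirz /dir_row /dir_last !h // subrr !scale0r.
Qed.

Lemma disc_extension (X : topologicalType) (phi : D -> X) :
  aspherical R X -> closed_extendable phi ->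
  exists2 psi : D -> X, continuous psi & forall x, simplex_boundary x -> psi x = phi x.
Proof.
move=> [_ aX] cphi.
pose f (t : cube R m) : X := phi (disc_map (t, itv0 R)).
have cf : continuous f.
  apply/continuous_closedP => A cA.
  have -> : f @^-1` A = (fun t => disc_map (t, itv0 R)) @^-1`
      (phi @^-1` A `&` @simplex_boundary R m.+1).
    apply/seteqP; split=> t /= h; last by case: h.
    by split=> //; exact: disc_map_boundary.
  have cd : continuous (fun t => disc_map (t, itv0 R)).
    by refine (cts_comp _ disc_map_continuous); cts.
  exact: (continuous_closedP _).1 cd _ (cphi _ cA).
have b1 : cube_boundary (to_cube (const_mx 1 : 'rV[R]_m)).
  apply: to_cube_boundary => //.
  by have [i <-] := norm_coord (const_mx 1 : 'rV[R]_m) m0; rewrite mxE normr1.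
set tb := to_cube _ in b1; pose x0 := f tb.
have lf : loops x0 f.
  by split=> // t bt; rewrite /x0 /f (disc_map_cube_boundary _ bt b1).
have [H cH [H0 H1 Hb]] := aX _ _ _ m0 lf.
(* A null homotopy is constant at time 1 and on the boundary of the cube, precisely where [disc_map]
   makes identifications, so it descends to the simplex. *)
have Hf z z' : disc_map z = disc_map z' -> H z = H z'.
  case: z => t s; case: z' => t' s' /disc_map_fibre[[-> ->]|[/= -> ->]|[/= bt bt']] //.
    by rewrite !H1.
  by rewrite !Hb.
pose psi x := H (projT1 (cid (disc_map_surj x))).
have psiE z : psi (disc_map z) = H z.
  by rewrite /psi; case: cid => z' /= e; exact: Hf.
exists psi.
  apply: (@quotient_continuous K D X disc_map psi H) => //.
  - by apply: prod_compact; [exact: cube_compact|exact: itv_compact].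
  - exact: space_hausdorff.
  - exact: disc_map_continuous.
  - exact: disc_map_surj.
by move=> x /disc_map_boundaryP[t <-]; rewrite psiE H0.
Qed.

End SimplexDisc.

(** The boundary consists of two points, so a path between their images takes the place of a null
    homotopy. *)
Lemma segment_extension (R : realType) (X : topologicalType) (phi : simplex R 1 -> X) :
  aspherical R X ->
  exists2 psi : simplex R 1 -> X, continuous psi & forall x, simplex_boundary x -> psi x = phi x.
Proof.
move=> [cX _].
have v_sub (b : bool) : @simplex_set R 1 (\row_i (if (i == ord0) == b then 1 else 0)).
  split=> [i|]; first by rewrite mxE; case: ifP.
  by rewrite big_ord_recl big_ord1 !mxE /=; case: b; rewrite ?addr0 ?add0r.
pose v b : simplex R 1 := (exist _ (\row_i (if (i == ord0) == b then 1 else 0)) (mem_set (v_sub b))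
    : @simplex_set R 1).
have /path_joinedP[g cg [g0 g1]] := cX (phi (v false)) (phi (v true)).
exists (fun x => g (simplex_val x ord0 ord0)).
  refine (cts_comp _ cg); apply: cts_coord; exact: initial_continuous.
move=> x [i xi]; have [x0 x1] := set_valP (x : @simplex_set R 1).
rewrite big_ord_recl big_ord1 in x1.
have [i0|i1] : simplex_val x ord0 ord0 = 0 \/ simplex_val x ord0 (lift ord0 ord0) = 0.
  by case: (unliftP ord0 i) xi => [j ->|-> ->]; [rewrite (ord1 j); right|left].
- rewrite g0 ?i0 //; congr phi; apply: simplex_val_inj; apply/rowP => j; rewrite mxE.
  case: (unliftP ord0 j) => [k ->|->]; last by rewrite eqxx.
  by rewrite (ord1 k) /=; rewrite -x1 [X in X + _]i0 add0r.
- rewrite g1; last by rewrite -x1 [X in _ + X]i1 addr0.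
  congr phi; apply: simplex_val_inj; apply/rowP => j; rewrite mxE.
  case: (unliftP ord0 j) => [k ->|->]; last by rewrite eqxx -x1 [X in _ + X]i1 addr0.
  by rewrite (ord1 k) /= i1.
Qed.

Lemma simplex_extension (R : realType) n (X : topologicalType) (phi : simplex R n.+1 -> X) :
  aspherical R X -> closed_extendable phi ->
  exists2 psi : simplex R n.+1 -> X, continuous psi &
    forall x, simplex_boundary x -> psi x = phi x.
Proof.
case: n phi => [|n] phi aX cphi; first exact: segment_extension.
exact: disc_extension.
Qed.

(** * Points of the totalization *)

Section Faces.
Variable R : realType.
Local Notation simplex := (simplex R).

Lemma face_val n (i : 'I_n.+2) (y : simplex n) j : simplex_val (face i y) ord0 j =
  if unlift i j is Some k then simplex_val y ord0 k else 0.
Proof. by rewrite /simplex_val /= mxE. Qed.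

Lemma face_inj n (i : 'I_n.+2) : injective (@face R n i).
Proof.
move=> x y e; apply: simplex_val_inj; apply/rowP => k.
by have := congr1 (fun z => simplex_val z ord0 (lift i k)) e; rewrite /= !face_val liftK.
Qed.

Lemma face_surj n (i : 'I_n.+2) (x : simplex n.+1) :
  simplex_val x ord0 i = 0 -> exists y, face i y = x.
Proof.
move=> xi; have [x0 x1] := set_valP (x : @simplex_set R n.+1).
have y_sub : @simplex_set R n (\row_k simplex_val x ord0 (lift i k)).
  split=> [k|]; first by rewrite mxE; exact: x0.
  under eq_bigr do rewrite mxE; rewrite -x1 [RHS](bigD1_ord i) //=.
  by rewrite [X in _ = X + _]xi add0r.
exists (exist _ (\row_k simplex_val x ord0 (lift i k)) (mem_set y_sub) : @simplex_set R n).
apply: simplex_val_inj; apply/rowP => j; rewrite face_val.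
by case: (unliftP i j) => [k ->|->]; [rewrite /simplex_val /= mxE|rewrite xi].
Qed.

Lemma face_boundary n (i : 'I_n.+2) (y : simplex n) : simplex_boundary (face i y).
Proof. by exists i; rewrite face_val unlift_none. Qed.

(** Distinct facets meet in a common face of codimension two: a converse to [face_law]. *)
Lemma face_face n (i j : 'I_n.+3) (y y' : simplex n.+1) : (i < j)%N ->
  face i y = face j y' ->
  exists (i' j' : 'I_n.+2) (z : simplex n),
    [/\ i = i' :> nat, j = j'.+1 :> nat, y = face j' z & y' = face i' z].
Proof.
move=> ij e; have jn := ltn_ord j.
have i'P : (i < n.+2)%N by lia.
have j'P : (j.-1 < n.+2)%N by lia.
pose i' := Ordinal i'P; pose j' := Ordinal j'P.
have ej : j = j'.+1 :> nat by rewrite /=; lia.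
have [z ez] : exists z, face i' z = y'.
  apply: face_surj; have := congr1 (fun x => simplex_val x ord0 i) e.
  rewrite /= !face_val unlift_none.
  have -> : i = lift j i' by apply: val_inj; rewrite /= /bump; lia.
  by rewrite liftK.
exists i', j', z; split=> //; apply: (@face_inj _ i).
by rewrite e -ez (@face_law R n i' j i j').
Qed.

End Faces.

Section TotInhabited.
Variables (R : realType) (X : semicosimplicial).
Hypotheses (aX : forall n, aspherical R (X n)) (neX : forall n, exists _ : X n, True).
Local Notation simplex := (simplex R).

(* The compatibility that lets [sc_d i \o f] be glued along the facets of the
   next simplex. *)
Definition matching n (f : simplex n -> X n) :=
  continuous f /\ forall i j y y', face i y = face j y' -> sc_d i (f y) = sc_d j (f y').

Lemma matching0 : exists f : simplex 0 -> X 0, matching f.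
Proof.
have [x _] := neX 0; exists (cst x); split; first exact: cst_continuous.
move=> i j y y' e; have [-> //|ij] := eqVneq i j.
(* Distinct facets of a segment are disjoint: a common point would have both coordinates zero,
   against the sum 1. *)
have [_ x1] := set_valP (face i y : @simplex_set R 1).
have hi : simplex_val (face i y) ord0 i = 0 by rewrite face_val unlift_none.
have hj : simplex_val (face i y) ord0 j = 0 by rewrite e face_val unlift_none.
exfalso; move: x1; rewrite (bigD1 i) //= [X in X + _]hi add0r big1 => [/esym/eqP|k ki].
  by rewrite oner_eq0.
suff -> : k = j by exact: hj.
apply: val_inj; move: ki ij; rewrite -!val_eqE /=.
by have := ltn_ord i; have := ltn_ord j; have := ltn_ord k; lia.
Qed.

(** Matching makes the values prescribed on the facets well defined on the boundary. The extension
    matches in turn because two facets meet in codimension two, where the cosimplicial identities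
    apply. *)
Lemma matching_step n (f : simplex n -> X n) : matching f ->
  exists2 g : simplex n.+1 -> X n.+1, matching g &
    forall i y, g (face i y) = sc_d i (f y).
Proof.
move=> [cf mf]; have [x0 _] := neX n.+1.
pose phi (x : simplex n.+1) : X n.+1 :=
  if pselect (exists p : 'I_n.+2 * simplex n, face p.1 p.2 = x) is left h
  then sc_d (projT1 (cid h)).1 (f (projT1 (cid h)).2) else x0.
have phiE i y : phi (face i y) = sc_d i (f y).
  rewrite /phi; case: pselect => [h|[]]; last by exists (i, y).
  by case: cid => -[j y'] /= e; exact: mf.
have cphi : closed_extendable phi.
  move=> A cA.
  (* The boundary is a finite union of compact facets, and on each of them [phi] is continuous. *)
  have -> : phi @^-1` A `&` @simplex_boundary R n.+1 =
      \bigcup_(i in [set: 'I_n.+2]) (face i @` ((fun y => sc_d i (f y)) @^-1` A)).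
    apply/seteqP; split=> x.
      move=> [Ax [i /face_surj[y yx]]]; exists i => //.
      by exists y => //=; rewrite -phiE yx.
    move=> [i _ [y Ay <-]]; split; last exact: face_boundary.
    by rewrite /= phiE.
  apply: closed_bigcup => [|i _]; first exact: finite_finset.
  apply: compact_closed; first exact: space_hausdorff.
  apply: continuous_compact; first by apply: continuous_subspaceT; exact: face_continuous.
  apply: (subclosed_compact _ (compact_set_type (@simplex_compact R n))) => //.
  apply: ((continuous_closedP _).1 _ _ cA).
  exact: (continuous_o cf (@sc_continuous X n i)).
have [g cg gE] := simplex_extension (aX n.+1) cphi.
have gface i y : g (face i y) = sc_d i (f y) by rewrite gE ?phiE //; exact: face_boundary.
exists g => //; split=> // i j y y'.
have main (a b : 'I_n.+3) z z' : (a < b)%N -> face a z = face b z' ->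
    sc_d a (g z) = sc_d b (g z').
  move=> ab /(face_face ab)[a' [b' [t [ea eb -> ->]]]].
  by rewrite !gface; apply/esym/sc_law => //; rewrite -ea.
case: (ltngtP i j) => [ij|ji|/val_inj <-].
- exact: main.
- by move=> e; apply/esym/main.
- by move=> /face_inj ->.
Qed.

Lemma sTot_inhabited : exists _ : sTot R X, True.
Proof.
pose st n := {f : simplex n -> X n | matching f}.
pose s0 : st 0 := cid matching0.
have stepP n (f : st n) := matching_step (projT2 f).
pose next n (f : st n) : {g : simplex n.+1 -> X n.+1 |
    matching g /\ forall i y, g (face i y) = sc_d i (projT1 f y)} :=
  cid (let: ex_intro2 g h e := stepP n f in ex_intro _ g (conj h e)).
pose s := fix s n : st n :=
  if n is k.+1 then exist _ (projT1 (next k (s k))) (projT2 (next k (s k))).1 else s0.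
have cs n : continuous (projT1 (s n) : Delta R n -> X n) by exact: (projT2 (s n)).1.
have ls : @sc_map_law (Delta R) X (fun n => projT1 (s n)).
  by move=> n i x; exact: (projT2 (next n (s n))).2.
by exists (mk_map cs ls).
Qed.

End TotInhabited.

(** * The simplicial model of Act *)

Section Staircases.
Variable R : realType.
Local Notation seqs := (prod_topology (fun _ : nat => R : topologicalType)).

(* The cumulative coordinates [T k = \sum_(j < k) x_j] of the points [x] of the
   simplex with [N] vertices; inserting zeros reindexes [T]. *)
Definition stair_set (N : nat) : set seqs :=
  [set T | T 0%N = 0 /\ (forall i, T i <= T i.+1) /\ forall k, (N <= k)%N -> T k = 1].

Lemma seqs_continuous (S : topologicalType) (f : S -> seqs) :
  (forall k, continuous (fun t => f t k)) -> continuous f.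
Proof.
move=> cf t; apply/cvg_sup => k.
by apply: (@continuous_comp_initial _ _ _ (fun f : nat -> R => f k) f) => ?; exact: cf.
Qed.

Lemma coord_seqs_continuous k : continuous (fun T : seqs => T k).
Proof. exact: (@proj_continuous nat (fun=> R : topologicalType) k). Qed.

Lemma stair_mono N T : stair_set N T -> forall i j, (i <= j)%N -> T i <= T j.
Proof.
move=> [_ [h _]] i j /subnK <-; elim: (j - i)%N => // k IH.
by rewrite addSn; exact: le_trans IH (h _).
Qed.

Lemma stair_itv N T : stair_set N T -> forall k, 0 <= T k <= 1.
Proof.
move=> sT k; have m := stair_mono sT; case: sT => T0 [_ T1]; apply/andP; split.
  by rewrite -T0 m.
by rewrite -(T1 (maxn N k)) ?leq_maxl // m // leq_maxr.
Qed.

Lemma stair_reindex N N' T (rho : nat -> nat) :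
  rho 0%N = 0%N -> (forall k, (rho k <= rho k.+1)%N) ->
  (forall k, (N' <= k)%N -> (N <= rho k)%N) ->
  stair_set N T -> stair_set N' (T \o rho).
Proof.
move=> r0 rm rN sT; have m := stair_mono sT; case: sT => T0 [_ T1].
by split; [rewrite /= r0|split=> [i|k /rN/T1]//; exact: (m _ _ (rm i))].
Qed.

Lemma stair_compact N : compact (stair_set N).
Proof.
apply: (@subclosed_compact _ _ [set T : seqs | forall k, `[0, 1]%classic (T k)]).
- have -> : stair_set N = ((fun T : seqs => T 0%N) @^-1` [set x | x = 0]) `&`
      ((\bigcap_i ((fun T : seqs => T i.+1 - T i) @^-1` [set x | 0 <= x])) `&`
       (\bigcap_(k in [set k | (N <= k)%N]) ((fun T : seqs => T k) @^-1` [set x | x = 1]))).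
    apply/seteqP; split=> T /= [T0 [Tm T1]]; split=> //; split=> //.
      by move=> i _ /=; rewrite subr_ge0.
    by move=> i; rewrite -subr_ge0; exact: (Tm i).
  have pre (f : seqs -> R) (B : set R) : continuous f -> closed B -> closed (f @^-1` B).
    by move=> cf; exact: (continuous_closedP _).1 cf _.
  apply: closedI; [|apply: closedI].
  + by apply: pre; [exact: coord_seqs_continuous|exact: closed_eq].
  + apply: closed_bigI => i _; apply: pre; last exact: closed_ge.
    by apply: ctsD; [|apply: ctsN]; exact: coord_seqs_continuous.
  + apply: closed_bigI => i _; apply: pre; last exact: closed_eq.
    exact: coord_seqs_continuous.
- by apply: (@tychonoff nat (fun=> R : topologicalType) (fun=> `[0, 1]%classic)) => _; exact: segment_compact.
- by move=> T sT k; rewrite /= in_itv; exact: stair_itv sT k.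
Qed.

Lemma stair_conv N T T' (s : R) : 0 <= s <= 1 -> stair_set N T -> stair_set N T' ->
  stair_set N (fun k => (1 - s) * T k + s * T' k).
Proof.
move=> s01 [T0 [Tm T1]] [T0' [Tm' T1']]; split; first by rewrite T0 T0'; ring.
split=> [i|k Nk]; last by rewrite T1 ?T1' //; ring.
by apply: lerD; apply: ler_wpM2l => //; lra.
Qed.

(** The number of vertices. Output [c] with [n] inputs gives the [n]-simplex; for output [o] the
    input [o] is not counted, so [n + 1] inputs give the same simplex. *)
Definition model_size (l : seq color) (s : color) : nat :=
  (size l + (if s is colC then 1 else 0))%N.

Definition model_set (l : seq color) (s : color) : set seqs :=
  [set T | stair_set (model_size l s) T /\ act_arity l s].

Lemma model_compact l s : compact (model_set l s).
Proof.
have [ar|nar] := pselect (act_arity l s).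
  have -> : model_set l s = stair_set (model_size l s).
    by apply/seteqP; split=> T; [case|split].
  exact: stair_compact.
have -> : model_set l s = set0 by apply/seteqP; split=> T //=; case.
exact: compact0.
Qed.

Lemma model_hausdorff l s : hausdorff_space (model_set l s).
Proof.
by apply: set_type_hausdorff; apply: hausdorff_product => _; exact: norm_hausdorff.
Qed.

Definition model_space l s : space :=
  compact_space (@model_hausdorff l s) (compact_set_type (@model_compact l s)).

Definition stair l s (x : model_space l s) : nat -> R := set_val (x : model_set l s).

Lemma stairP l s (x : model_space l s) : stair_set (model_size l s) (stair x).
Proof. by have [] := set_valP (x : model_set l s). Qed.

Lemma model_arity l s (x : model_space l s) : act_arity l s.
Proof. by have [] := set_valP (x : model_set l s). Qed.

Lemma stair_inj l s (x y : model_space l s) : (forall k, stair x k = stair y k) -> x = y.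
Proof. by move=> e; apply: (@val_inj _ _ (model_set l s)); apply/funext => k; exact: e. Qed.

Lemma stair_continuous l s k : continuous (fun x : model_space l s => stair x k).
Proof.
apply: (@cts_comp _ _ _ (set_val : model_set l s -> seqs) (fun T => T k)).
  exact: initial_continuous.
exact: coord_seqs_continuous.
Qed.

Definition of_stair l s (T : nat -> R) (sT : stair_set (model_size l s) T)
    (ar : act_arity l s) : model_space l s :=
  (exist _ (T : seqs) (mem_set (conj sT ar : model_set l s T)) : model_set l s).

Lemma model_space_continuous (S : topologicalType) l s (f : S -> model_space l s) :
  (forall k, continuous (fun t => stair (f t) k)) -> continuous f.
Proof. by move=> cf; apply: continuous_comp_initial; exact: seqs_continuous. Qed.

(* The left action puts zeros in front of (and behind) the coordinates [x]; the right
   action at a position [size u] puts [size w - 1] zeros behind the coordinate [size u]. *)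
Definition lcomp_reindex (u : seq color) (k : nat) : nat := (k - size u)%N.
Definition rcomp_reindex (u w : seq color) (k : nat) : nat :=
  (minn k (size u).+1 + (k - (size u + size w)))%N.

(** Ensures that a staircase shifted by [size u] still reaches 1 in time: the extra vertex of a
    grafted [c]-operation is provided by an input in [v] or by the output [c]. *)
Lemma act_arity_tail u a v s : act_arity (u ++ a :: v) s ->
  ((if a is colC then 1 else 0) <= size v + (if s is colC then 1 else 0))%N.
Proof.
case: s => /= -[n e]; last by case: a e; rewrite /= ?addn1.
case/lastP: v e => [|v b]; last by rewrite size_rcons; case: a.
by rewrite cats1 => /rcons_inj[_ ->].
Qed.

Lemma model_lcomp_stair u v w l r a s (e1 : l = u ++ a :: v) (e2 : r = u ++ w ++ v)
    (x : Act_pos l s) (y : model_space w a) :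
  stair_set (model_size r s) (stair y \o lcomp_reindex u).
Proof.
have [ar _] := pt_ifP x; rewrite e1 in ar; have h := act_arity_tail ar.
apply: stair_reindex (stairP y) => [|k|k]; rewrite /lcomp_reindex; first by rewrite sub0n.
  by lia.
by rewrite e2 /model_size !size_cat; move: h; lia.
Qed.

Lemma model_lcomp_arity u v w l r a s (e1 : l = u ++ a :: v) (e2 : r = u ++ w ++ v)
    (x : Act_pos l s) (y : model_space w a) : act_arity r s.
Proof.
have [ar _] := pt_ifP x; rewrite e1 in ar.
by rewrite e2; exact: act_arity_comp ar (model_arity y).
Qed.

Lemma model_rcomp_stair u v w l r a s (e1 : l = u ++ a :: v) (e2 : r = u ++ w ++ v)
    (x : model_space l s) (y : Act_pos w a) :
  stair_set (model_size r s) (stair x \o rcomp_reindex u w).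
Proof.
have [_ w0] := pt_ifP y; apply: stair_reindex (stairP x) => [|k|k]; rewrite /rcomp_reindex.
- by rewrite min0n sub0n.
- by lia.
- by rewrite e1 e2 /model_size !size_cat /=; lia.
Qed.

Lemma model_rcomp_arity u v w l r a s (e1 : l = u ++ a :: v) (e2 : r = u ++ w ++ v)
    (x : model_space l s) (y : Act_pos w a) : act_arity r s.
Proof.
have ar := model_arity x; rewrite e1 in ar.
by rewrite e2; exact: act_arity_comp ar (pt_ifP y).1.
Qed.

Definition model_lcomp : pcomp Act_pos model_space model_space :=
  fun u v w l r a s e1 e2 x y =>
    of_stair (model_lcomp_stair e1 e2 x y) (model_lcomp_arity e1 e2 x y).

Definition model_rcomp : pcomp model_space Act_pos model_space :=
  fun u v w l r a s e1 e2 x y =>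
    of_stair (model_rcomp_stair e1 e2 x y) (model_rcomp_arity e1 e2 x y).

Lemma model_lcontinuous : pcomp_continuous model_lcomp.
Proof.
move=> u v w l r a s e1 e2; apply: model_space_continuous => k.
exact: (continuous_o (@ksnd_continuous (Act_pos l s) (model_space w a))
  (@stair_continuous w a (lcomp_reindex u k))).
Qed.

Lemma model_rcontinuous : pcomp_continuous model_rcomp.
Proof.
move=> u v w l r a s e1 e2; apply: model_space_continuous => k.
exact: (continuous_o (@kfst_continuous (model_space l s) (Act_pos w a))
  (@stair_continuous l s (rcomp_reindex u w k))).
Qed.

Definition model : ibimod Act_pos.
Proof.
apply: (@Ibimod color Act_pos model_space model_lcomp model_rcomp
  model_lcontinuous model_rcontinuous).
- abstract (move=> u v u' v' t l w w' r q a b s e1 e2 e3 e4 e5 e6 e7 x y z;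
    have [_ t0] := pt_ifP z; have [_ w0] := pt_ifP y;
    apply: stair_inj => k; congr (stair x _);
    rewrite /rcomp_reindex e5 e6 !size_cat /=; lia).
- abstract (move=> u v u' v' t l w w' r q a b s e1 e2 e3 e4 e5 e6 e7 x y z;
    have [_ t0] := pt_ifP z;
    apply: stair_inj => k; congr (stair y _); rewrite /rcomp_reindex /lcomp_reindex !size_cat; lia).
- abstract (move=> u v u' v' t l w w' r q a b s e1 e2 e3 e4 e5 e6 e7 x y z;
    apply: stair_inj => k; congr (stair z _); rewrite /lcomp_reindex !size_cat; lia).
- abstract (move=> u v t p q l r1 r2 r a b s e1 e2 e3 e4 e5 e6 e7 e8 x y z;
    have [_ p0] := pt_ifP y; have [_ q0] := pt_ifP z;
    apply: stair_inj => k; congr (stair x _); rewrite /rcomp_reindex !size_cat /=; lia).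
(* The one axiom where the index maps differ: [z] is grafted among the zeros behind [y]. They agree
   up to [size u + size p + size v + 1], and past that both read [y] where it is already 1. *)
- abstract (move=> u v t p q l r1 r2 r a b s e1 e2 e3 e4 e5 e6 e7 e8 x y z;
    have [_ q0] := pt_ifP z; have [_ [_ y1]] := stairP y;
    apply: stair_inj => k;
    change (stair y (lcomp_reindex u (rcomp_reindex (u ++ p ++ v) q k)) = stair y (lcomp_reindex u k));
    (have hN : (model_size p a <= (size p).+1)%N by rewrite /model_size; case: (a); lia);
    have [kU|Uk] := leqP k (size u + size p + size v).+1;
    [congr (stair y _)|rewrite !y1]; try reflexivity; move: hN; rewrite /lcomp_reindex /rcomp_reindex ?size_cat; lia).
- abstract (move=> u v t p q l r1 r2 r a b s e1 e2 e3 e4 e5 e6 e7 e8 x y z;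
    have [_ p0] := pt_ifP y;
    apply: stair_inj => k; congr (stair z _); rewrite /lcomp_reindex /rcomp_reindex !size_cat /=; lia).
- abstract (by move=> l s e1 e2 x; apply: stair_inj => k; congr (stair x _);
    rewrite /lcomp_reindex subn0).
- abstract (by move=> u v l a s e1 e2 x; apply: stair_inj => k; congr (stair x _);
    rewrite /rcomp_reindex /=; lia).
Defined.

End Staircases.

(** * Straight-line homotopies in bimodules with affine operations *)

Section ConvexBimodules.
Variables (R : realType) (S : Type) (O : operad S) (C : ibimod O).
Variable conv : forall l s, C l s -> C l s -> itv R -> C l s.
Arguments conv {l s}.
Hypothesis conv_continuous : forall l s, continuous
  ((fun z => conv z.1.1 z.1.2 z.2) : kprod (kprod (C l s) (C l s)) (itv_space R) -> C l s).
Hypothesis conv0 : forall l s (x y : C l s), conv x y (itv0 R) = x.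
Hypothesis conv1 : forall l s (x y : C l s), conv x y (itv1 R) = y.
Hypothesis conv_diag : forall l s (x : C l s) t, conv x x t = x.
Hypothesis conv_lcomp : forall u v w l r a s (e1 : l = u ++ a :: v) (e2 : r = u ++ w ++ v)
  (x : O l s) (y y' : C w a) t,
  conv (ib_lcomp e1 e2 x y) (ib_lcomp e1 e2 x y') t = ib_lcomp e1 e2 x (conv y y' t).
Hypothesis conv_rcomp : forall u v w l r a s (e1 : l = u ++ a :: v) (e2 : r = u ++ w ++ v)
  (x : O w a) (y y' : C l s) t,
  conv (ib_rcomp e1 e2 y x) (ib_rcomp e1 e2 y' x) t = ib_rcomp e1 e2 (conv y y' t) x.

Lemma conv_apply_continuous (T : space) l s (f g : T -> C l s) (t : T -> itv R) :
  continuous f -> continuous g -> continuous t ->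
  continuous (fun z => conv (f z) (g z) (t z)).
Proof.
move=> cf cg ct.
exact: (continuous_o (@kpair_continuous T (kprod (C l s) (C l s)) (itv_space R) _ _
  (kpair_continuous cf cg) ct) (@conv_continuous l s)).
Qed.

Lemma convex_aspherical : ib_aspherical R C.
Proof.
move=> l s; split=> [x y|n x0 f n0 [cf f0]].
  exists (conv x y); last by rewrite conv0 conv1.
  apply: (@conv_apply_continuous (itv_space R) l s (fun=> x) (fun=> y) id);
    [exact: cts_cst|exact: cts_cst|exact: cts_id].
exists (fun z => conv (f z.1) x0 z.2).
  apply: (@conv_apply_continuous (cube_itv_space R n) l s (fun z => f z.1) (fun=> x0) snd).
  - by apply: (@cts_fst (cube R n) (itv R) (C l s) f).
  - exact: cts_cst.
  - by move=> z; exact: cvg_snd.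
split=> [t|t|t t' bt] /=; rewrite ?conv0 ?conv1 //.
by rewrite f0.
Qed.

Lemma convex_homotopic (P : ibimod O) (f g : Ibimod_map P C) :
  exists H : Ibimod_map P (paths_ib R C), ibimod_homotopy H f g.
Proof.
have cg i : continuous ((fun z => conv (mapf f i z.1) (mapf g i z.1) z.2) :
    kprod (P i.1 i.2) (itv_space R) -> C i.1 i.2).
  have c1 := @kfst_continuous (P i.1 i.2) (itv_space R).
  apply: (@conv_apply_continuous (kprod (P i.1 i.2) (itv_space R)) i.1 i.2
    (fun z => mapf f i z.1) (fun z => mapf g i z.1) snd).
  - exact: (continuous_o c1 (@mapf_continuous _ _ _ _ f i)).
  - exact: (continuous_o c1 (@mapf_continuous _ _ _ _ g i)).
  - exact: ksnd_continuous.
pose F i := projT1 (cid2 (@path_curry R (P i.1 i.2) (C i.1 i.2)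
  (fun x t => conv (mapf f i x) (mapf g i x) t) (cg i))).
have cF i : continuous (F i) by rewrite /F; case: cid2.
have FE i x t : path_at (F i x) t = conv (mapf f i x) (mapf g i x) t.
  by rewrite /F; case: cid2 => G cG GE; exact: GE.
have lF : @ibimod_law S O P (paths_ib R C) F.
  split=> [u v w l r a s e1 e2 x m|u v w l r a s e1 e2 m x]; apply: path_ext => t;
    apply: (etrans (FE (r, s) _ t)).
    apply: (@etrans _ _ (ib_lcomp e1 e2 x (path_at (F (w, a) m) t))) => //.
    by rewrite (FE (w, a)) -conv_lcomp -!ibimod_map_lcomp.
  apply: (@etrans _ _ (ib_rcomp e1 e2 (path_at (F (l, s) m) t) x)) => //.
  by rewrite (FE (l, s)) -conv_rcomp -!ibimod_map_rcomp.
exists (mk_map cF lF) => i x.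
by rewrite /= !mk_mapE !FE conv0 conv1.
Qed.

End ConvexBimodules.

Section ModelConvex.
Variable R : realType.
Local Notation model := (model R).
Local Notation model_space := (model_space R).

Definition model_conv l s (x y : model_space l s) (t : itv R) : model_space l s :=
  of_stair (stair_conv (itvP t) (stairP x) (stairP y)) (model_arity x).

Lemma model_convE l s (x y : model_space l s) t k :
  stair (model_conv x y t) k = (1 - set_val t) * stair x k + set_val t * stair y k.
Proof. by []. Qed.

Lemma model_conv_continuous l s : continuous
  ((fun z => model_conv z.1.1 z.1.2 z.2) :
     kprod (kprod (model_space l s) (model_space l s)) (itv_space R) -> model_space l s).
Proof.
set T := kprod _ _.
have ct : continuous (fun z : T => set_val z.2 : R).
  exact: (continuous_o (@ksnd_continuous _ (itv_space R)) (@itv_val_continuous R)).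
have c1 := @kfst_continuous (kprod (model_space l s) (model_space l s)) (itv_space R).
have cx k : continuous (fun z : T => stair z.1.1 k).
  exact: (continuous_o (continuous_o c1 (@kfst_continuous _ _)) (@stair_continuous R l s k)).
have cy k : continuous (fun z : T => stair z.1.2 k).
  exact: (continuous_o (continuous_o c1 (@ksnd_continuous _ _)) (@stair_continuous R l s k)).
apply: model_space_continuous => k; apply: ctsD; apply: ctsM => //.
by cts.
Qed.

Lemma model_conv0 l s (x y : model_space l s) : model_conv x y (itv0 R) = x.
Proof. by apply: stair_inj => k; rewrite model_convE /= subr0 mul1r mul0r addr0. Qed.

Lemma model_conv1 l s (x y : model_space l s) : model_conv x y (itv1 R) = y.
Proof. by apply: stair_inj => k; rewrite model_convE /= subrr mul1r mul0r add0r. Qed.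

Lemma model_conv_diag l s (x : model_space l s) t : model_conv x x t = x.
Proof. by apply: stair_inj => k; rewrite model_convE; ring. Qed.

Lemma model_conv_lcomp u v w l r a s (e1 : l = u ++ a :: v) (e2 : r = u ++ w ++ v)
    (x : Act_pos l s) (y y' : model w a) t :
  model_conv (ib_lcomp e1 e2 x y : model r s) (ib_lcomp e1 e2 x y' : model r s) t =
  ib_lcomp e1 e2 x (model_conv y y' t : model w a).
Proof. exact: stair_inj. Qed.

Lemma model_conv_rcomp u v w l r a s (e1 : l = u ++ a :: v) (e2 : r = u ++ w ++ v)
    (x : Act_pos w a) (y y' : model l s) t :
  model_conv (ib_rcomp e1 e2 y x : model r s) (ib_rcomp e1 e2 y' x : model r s) t =
  ib_rcomp e1 e2 (model_conv y y' t : model l s) x.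
Proof. exact: stair_inj. Qed.

Lemma model_aspherical : ib_aspherical R model.
Proof.
exact: (@convex_aspherical R _ _ model model_conv model_conv_continuous model_conv0
  model_conv1 model_conv_diag).
Qed.

Lemma model_homotopic (f : Ibimod_map model model) :
  exists H : Ibimod_map model (paths_ib R model), ibimod_homotopy H f (ibimod_id model).
Proof.
exact: (@convex_homotopic R _ _ model model_conv model_conv_continuous model_conv0
  model_conv1 model_conv_lcomp model_conv_rcomp).
Qed.

Lemma model_inhabited l s : act_arity l s -> exists _ : model_space l s, True.
Proof.
(* The vertex 0, whose staircase jumps at index 1. *)
move=> ar; suff sT : stair_set (model_size l s) (fun k => (if (0 < k)%N then 1 else 0) : R).
  by exists (of_stair sT ar).
split=> //; split=> [[|i] /=|k] ; rewrite ?ler01 //.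
suff : (0 < model_size l s)%N by move=> N0 Nk; rewrite (leq_trans N0 Nk).
case: s ar => -[n ->]; rewrite /model_size ?addn1 //.
by rewrite size_rcons addn0.
Qed.

Lemma model_map_subproof :
  @ibimod_law _ _ model Act_ib (fun i x => pt (model_arity x)).
Proof. by split=> *; exact: pt_if_eq. Qed.

Definition model_map : Ibimod_map model Act_ib :=
  mk_map (fun i => @pt_if_continuous _ _ _) model_map_subproof.

Definition modelc : ibimod As_pos := restr_c model.

Lemma modelc_map_subproof :
  @ibimod_law _ _ modelc As_ib (fun i x => mapf model_map (map to_c i.1, to_c i.2) x).
Proof. by split=> *; exact: pt_if_eq. Qed.

Definition modelc_map : Ibimod_map modelc As_ib :=
  mk_map (fun i => @mapf_continuous _ _ _ _ model_map (map to_c i.1, to_c i.2))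
    modelc_map_subproof.

Lemma modelc_aspherical : ib_aspherical R modelc.
Proof. by move=> l s; exact: model_aspherical. Qed.

Lemma modelc_homotopic (f : Ibimod_map modelc modelc) :
  exists H : Ibimod_map modelc (paths_ib R modelc), ibimod_homotopy H f (ibimod_id modelc).
Proof.
apply: (@convex_homotopic R _ _ modelc (fun l s => @model_conv (map to_c l) (to_c s))).
- by move=> l s; exact: model_conv_continuous.
- by move=> l s; exact: model_conv0.
- by move=> l s; exact: model_conv1.
- by move=> *; exact: model_conv_lcomp.
- by move=> *; exact: model_conv_rcomp.
Qed.

End ModelConvex.

(** * Infinitesimal bimodules as semi-cosimplicial spaces *)

Lemma homeo_weak_equivalence (R : realType) (X Y : space) (phi : X -> Y) (psi : Y -> X) :
  continuous phi -> continuous psi -> cancel phi psi -> cancel psi phi ->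
  weakly_equivalent R X Y.
Proof.
move=> cphi cpsi K1 K2; apply: rst_step; exists phi.
apply: (homotopy_equivalence cphi cpsi).
  by exists fst => //; [exact: kfst_continuous|split=> // x; rewrite /= K1].
by exists fst => //; [exact: kfst_continuous|split=> // x; rewrite /= K2].
Qed.

Lemma unit_seqP (l : seq unit) : nseq (size l) tt = l.
Proof. by apply: unit_seq_eq; rewrite size_nseq. Qed.

Lemma As_pos_arity (l : seq unit) : (0 < size l)%N -> act_pos_arity (map to_c l) (to_c tt).
Proof.
move=> l0; split; last by rewrite size_map.
by exists (size l); rewrite -{1}(unit_seqP l) map_nseq.
Qed.

Definition As_pos_pt (l : seq unit) (l0 : (0 < size l)%N) : As_pos l tt := pt (As_pos_arity l0).

Lemma As_pos_size (l : seq unit) s (x : As_pos l s) : (0 < size l)%N.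
Proof. by have [_] := pt_ifP x; rewrite size_map. Qed.

Section CosimplicialActions.
Variable N : ibimod As_pos.

Ltac usz := apply: unit_seq_eq; rewrite ?(size_cat, size_nseq) /=
  ?(size_cat, size_nseq) /= ?(size_cat, size_nseq) /=; lia.
Ltac usz2 := rewrite ?(size_cat, size_nseq) /= ?(size_cat, size_nseq) /=; lia.

(** An operation with one more input in front is [star2] composed with a shorter one, so a left
    action sheds a first coface; [lcomp_last] does the same at the other end. *)
Lemma lcomp_first i j n k (l l' : seq unit)
    (e1 : l = nseq i.+1 tt ++ tt :: nseq j tt)
    (e2 : nseq k.+1 tt = nseq i.+1 tt ++ nseq n tt ++ nseq j tt)
    (e1' : l' = nseq i tt ++ tt :: nseq j tt)
    (e2' : nseq k tt = nseq i tt ++ nseq n tt ++ nseq j tt)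
    (x : As_pos l tt) (x' : As_pos l' tt) (m : N (nseq n tt) tt) :
  ib_lcomp e1 e2 x m = d_first (ib_lcomp e1' e2' x' m : cosimp_space N k).
Proof.
have kE : k = (i + (n + j))%N by have := congr1 size e2'; rewrite !size_cat !size_nseq.
have ax := @ib_seq_r _ _ N [:: tt] [::] (nseq i tt) (nseq j tt) (nseq n tt) [:: tt; tt]
  l' (nseq k tt) l (nseq k.+1 tt) tt tt tt
  ltac:(usz) ltac:(rewrite e1 e1'; usz) ltac:(rewrite e1; usz) ltac:(usz) e1' e2'
  ltac:(usz) star2 x' m.
apply: (etrans _ (etrans ax _)).
  by apply: lcomp_congr => //; usz2.
by apply: lcomp_congr => //; usz2.
Qed.

Lemma lcomp_last j n k (l l' : seq unit)
    (e1 : l = [::] ++ tt :: nseq j.+1 tt)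
    (e2 : nseq k.+1 tt = [::] ++ nseq n tt ++ nseq j.+1 tt)
    (e1' : l' = [::] ++ tt :: nseq j tt)
    (e2' : nseq k tt = [::] ++ nseq n tt ++ nseq j tt)
    (x : As_pos l tt) (x' : As_pos l' tt) (m : N (nseq n tt) tt) :
  ib_lcomp e1 e2 x m = d_last (ib_lcomp e1' e2' x' m : cosimp_space N k).
Proof.
have kE : k = (n + j)%N by have := congr1 size e2'; rewrite !size_cat !size_nseq.
have ax := @ib_seq_r _ _ N [::] [:: tt] [::] (nseq j tt) (nseq n tt) [:: tt; tt]
  l' (nseq k tt) l (nseq k.+1 tt) tt tt tt
  ltac:(usz) ltac:(rewrite e1 e1'; usz) ltac:(rewrite e1; usz) ltac:(usz) e1' e2'
  ltac:(usz) star2 x' m.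
apply: (etrans _ (etrans ax _)).
  by apply: lcomp_congr => //; usz2.
by apply: lcomp_congr => //; usz2.
Qed.

(** The operation [x] is [star2] with [x'] grafted on its first input, so a right action is an inner
    coface followed by a right action with one input less. *)
Lemma rcomp_inner i j n k (l w w' : seq unit) (h : (i < n)%N)
    (e1 : nseq n tt = nseq i tt ++ tt :: nseq j tt)
    (e2 : nseq k tt = nseq i tt ++ w ++ nseq j tt)
    (e1' : nseq n.+1 tt = nseq i tt ++ tt :: nseq j.+1 tt)
    (e2' : nseq k tt = nseq i tt ++ w' ++ nseq j.+1 tt)
    (x : As_pos w tt) (x' : As_pos w' tt) (m : N (nseq n tt) tt) :
  ib_rcomp e1 e2 m x = ib_rcomp e1' e2' (d_inner h m) x'.
Proof.
have w0 := As_pos_size x'; have nE : n = (i + j.+1)%N.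
  by have := congr1 size e1; rewrite !size_cat /= !size_nseq.
have wE : size w = (size w').+1.
  have := congr1 size e2'; rewrite e2 !size_cat /= !size_nseq; lia.
have ax := @ib_seq_l _ _ N (nseq i tt) (nseq j tt) [::] [:: tt] w' (nseq n tt) [:: tt; tt]
  w (nseq n.+1 tt) (nseq k tt) tt tt tt
  e1 ltac:(usz) ltac:(usz) ltac:(rewrite e2'; usz) ltac:(usz) ltac:(usz) e2 m star2 x'.
apply: (etrans _ (etrans (esym ax) _)).
  by apply: rcomp_congr.
by apply: rcomp_congr; [apply: rcomp_congr => //|]; usz2.
Qed.

End CosimplicialActions.

Lemma ibimod_map_coface (N N' : ibimod As_pos) (f : Ibimod_map N' N) n (i : 'I_n.+2)
    (x : cosimp_space N' n) :
  mapf f (nseq n.+1 tt, tt) (coface i x) = coface i (mapf f (nseq n tt, tt) x : cosimp_space N n).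
Proof.
rewrite /coface; case: (nat_of_ord i) => [|k]; first exact: (ibimod_map_lcomp f).
by case: pselect => kn; [exact: (ibimod_map_rcomp f)|exact: (ibimod_map_lcomp f)].
Qed.

Section CosimplicialExtension.
Variables (N N' : ibimod As_pos).
Variable f : forall n, cosimp_space N' n -> cosimp_space N n.

(** A list over [unit] equals [nseq (size l) tt] only propositionally, hence the transports;
    [ext_nseqE] removes them. *)
Definition ext_nseq l s : N' l s -> N l s :=
  match s with tt => fun x =>
    eq_rect _ (fun l => N l tt)
      (f (eq_rect_r (fun l => N' l tt) x (unit_seqP l) : cosimp_space N' (size l)))
      _ (unit_seqP l)
  end.

Lemma ext_nseqE n (x : N' (nseq n tt) tt) : ext_nseq x = f (x : cosimp_space N' n).
Proof.
rewrite /ext_nseq; move: (unit_seqP _); rewrite size_nseq => e.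
by rewrite (eq_irrelevance e erefl).
Qed.

Hypothesis f_continuous : forall n, continuous (@f n).

Lemma ext_nseq_continuous l s : continuous (@ext_nseq l s).
Proof.
case: s; rewrite -(unit_seqP l).
have -> : @ext_nseq (nseq (size l) tt) tt = @f (size l).
  by apply/funext => x; exact: ext_nseqE.
exact: f_continuous.
Qed.

Hypothesis f_coface : forall n (i : 'I_n.+2) x, f (coface i x) = coface i (f x).

Lemma commute_first n x : f (d_first x) = d_first (@f n x).
Proof. by have := @f_coface n ord0 x; rewrite !cofaceE0. Qed.

Lemma commute_last n x : f (d_last x) = d_last (@f n x).
Proof. by have := @f_coface n ord_max x; rewrite !cofaceEl. Qed.

Lemma commute_inner n k (h : (k < n)%N) x : f (d_inner h x) = d_inner h (@f n x).
Proof.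
have kn : (k.+1 < n.+2)%N by lia.
by have := @f_coface n (Ordinal kn) x; rewrite !(cofaceEi h).
Qed.

(** Induction on the inputs before the grafted one, then on those after it, peeling off a coface
    each time until the unit is left. *)
Lemma commute_lcomp i j n k l (e1 : l = nseq i tt ++ tt :: nseq j tt)
    (e2 : nseq k tt = nseq i tt ++ nseq n tt ++ nseq j tt)
    (x : As_pos l tt) (m : cosimp_space N' n) :
  f (ib_lcomp e1 e2 x m : cosimp_space N' k) = ib_lcomp e1 e2 x (f m).
Proof.
elim: i k l e1 e2 x => [|i IH] k l e1 e2 x; last first.
  have kE : k = (i.+1 + (n + j))%N by have := congr1 size e2; rewrite !size_cat !size_nseq.
  case: k e2 kE => // k e2 kE.
  have e2' : nseq k tt = nseq i tt ++ nseq n tt ++ nseq j tt.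
    by apply: unit_seq_eq; rewrite !size_cat !size_nseq; lia.
  have l0 : (0 < size (nseq i tt ++ tt :: nseq j tt))%N by rewrite size_cat /=; lia.
  rewrite (lcomp_first e1 e2 erefl e2' x (As_pos_pt l0)) commute_first IH.
  by rewrite -(lcomp_first e1 e2 erefl e2' x).
elim: j k l e1 e2 x => [|j IH] k l e1 e2 x; last first.
  have kE : k = (n + j.+1)%N by have := congr1 size e2; rewrite !size_cat !size_nseq.
  case: k e2 kE => [|k] e2 kE; first by lia.
  have e2' : nseq k tt = [::] ++ nseq n tt ++ nseq j tt.
    by apply: unit_seq_eq; rewrite !size_cat !size_nseq /=; lia.
  have l0 : (0 < size ([::] ++ tt :: nseq j tt))%N by [].
  rewrite (lcomp_last e1 e2 erefl e2' x (As_pos_pt l0)) commute_last IH.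
  by rewrite -(lcomp_last e1 e2 erefl e2' x).
have kn : k = n by have := congr1 size e2; rewrite !size_cat !size_nseq /= addn0.
subst k l; have -> : x = op_unit As_pos tt by exact: pt_if_eq.
by rewrite (ib_unitl (i := N')) (ib_unitl (i := N)).
Qed.

(** Induction on the number of inputs of [x], over all [j] and [n] since each inner coface enlarges
    the element acted on. *)
Lemma commute_rcomp i j n k w (e1 : nseq n tt = nseq i tt ++ tt :: nseq j tt)
    (e2 : nseq k tt = nseq i tt ++ w ++ nseq j tt)
    (m : cosimp_space N' n) (x : As_pos w tt) :
  f (ib_rcomp e1 e2 m x : cosimp_space N' k) = ib_rcomp e1 e2 (f m) x.
Proof.
have := As_pos_size x; move sw : (size w) => p.
case: p sw => // p; elim: p j n w e1 e2 m x => [|p IH] j n w e1 e2 m x sw _.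
  have ew : w = [:: tt] by exact: unit_seq_eq.
  have kn : k = n.
    by have := congr1 size e2; have := congr1 size e1; rewrite !size_cat /= !size_nseq ew /=; lia.
  subst k w; have -> : x = op_unit As_pos tt by exact: pt_if_eq.
  by rewrite (ib_unitr (i := N')) (ib_unitr (i := N)).
have nE : n = (i + j.+1)%N.
  by have := congr1 size e1; rewrite !size_cat /= !size_nseq.
have h : (i < n)%N by lia.
have kE : k = (i + (p.+2 + j))%N.
  by have := congr1 size e2; rewrite !size_cat /= !size_nseq sw.
have e1' : nseq n.+1 tt = nseq i tt ++ tt :: nseq j.+1 tt.
  by apply: unit_seq_eq; rewrite !size_cat /= !size_nseq; lia.
have e2' : nseq k tt = nseq i tt ++ nseq p.+1 tt ++ nseq j.+1 tt.
  by apply: unit_seq_eq; rewrite !size_cat /= !size_nseq; lia.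
have w0 : (0 < size (nseq p.+1 tt))%N by [].
rewrite (rcomp_inner nil h e1 e2 e1' e2' x (As_pos_pt w0)) IH ?size_nseq // commute_inner.
by rewrite -(rcomp_inner nil h e1 e2 e1' e2' x).
Qed.

Lemma ext_nseq_law : @ibimod_law _ _ N' N (fun i => @ext_nseq i.1 i.2).
Proof.
split=> [u v w l r [] [] e1 e2 x m|u v w l r [] [] e1 e2 m x] /=.
- move: x m e1 e2; rewrite -(unit_seqP u) -(unit_seqP v) -(unit_seqP w) -(unit_seqP r).
  by move=> x m e1 e2; apply: (etrans (ext_nseqE _)); rewrite commute_lcomp -ext_nseqE.
- move: x m e1 e2; rewrite -(unit_seqP u) -(unit_seqP v) -(unit_seqP l) -(unit_seqP r).
  by move=> x m e1 e2; apply: (etrans (ext_nseqE _)); rewrite commute_rcomp -ext_nseqE.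
Qed.

Definition ext_map : Ibimod_map N' N :=
  mk_map (fun i => @ext_nseq_continuous i.1 i.2) ext_nseq_law.

End CosimplicialExtension.

(** * Bimodule maps out of the simplices are points of the totalization *)

Section SimplexModel.
Variable R : realType.
Local Notation simplex := (simplex R).
Local Notation modelc := (modelc R).

Lemma modelc_size n : model_size (map to_c (nseq n tt)) (to_c tt) = n.+1.
Proof. by rewrite /model_size size_map size_nseq addn1. Qed.

Lemma modelc_arity n : act_arity (map to_c (nseq n tt)) (to_c tt).
Proof. by exists n; rewrite map_nseq. Qed.

Definition cumul n (x : 'rV[R]_n.+1) (k : nat) : R :=
  \sum_(j < n.+1) (if (j < k)%N then x ord0 j else 0).

Lemma cumul_stair n (x : simplex n) :
  stair_set (model_size (map to_c (nseq n tt)) (to_c tt)) (cumul (simplex_val x)).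
Proof.
have [x0 x1] := set_valP (x : @simplex_set R n); rewrite modelc_size; split.
  by rewrite /cumul big1.
split=> [k|k nk].
  apply: ler_sum => j _; case: ifP => [jk|_]; first by rewrite (ltn_trans jk).
  by case: ifP => // _; exact: x0.
rewrite -[RHS]x1; apply: eq_bigr => j _; rewrite ifT //.
exact: leq_trans (ltn_ord j) nk.
Qed.

Definition to_model n (x : simplex n) : modelc (nseq n tt) tt :=
  of_stair (cumul_stair x) (modelc_arity n).

Lemma to_modelE n (x : simplex n) k : stair (to_model x) k = cumul (simplex_val x) k.
Proof. by []. Qed.

Lemma to_model_continuous n : continuous (@to_model n).
Proof.
apply: model_space_continuous => k; apply: cts_sum => j _.
case: (j < k)%N; last exact: cts_cst.
apply: cts_coord; exact: initial_continuous.
Qed.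

Lemma of_model_subproof n (y : modelc (nseq n tt) tt) :
  @simplex_set R n (\row_j (stair y j.+1 - stair y j)).
Proof.
have := stairP y; rewrite modelc_size => -[T0 [Tm T1]]; split=> [i|].
  by rewrite mxE subr_ge0.
under eq_bigr do rewrite mxE.
rewrite -(big_mkord xpredT (fun j => stair y j.+1 - stair y j)) telescope_sumr //.
by rewrite T0 T1 // subr0.
Qed.

Definition of_model n (y : modelc (nseq n tt) tt) : simplex n :=
  (exist _ (\row_j (stair y j.+1 - stair y j)) (mem_set (of_model_subproof y))
    : @simplex_set R n).

Lemma of_model_continuous n : continuous (@of_model n).
Proof.
apply: continuous_comp_initial; apply: cts_row => i.
have -> : (fun y => (set_val \o @of_model n) y ord0 i) =
    (fun y : modelc (nseq n tt) tt => stair y i.+1 - stair y i).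
  by apply/funext => y; rewrite /= mxE.
by apply: ctsD; [|apply: ctsN]; exact: stair_continuous.
Qed.

Lemma to_modelK n : cancel (@to_model n) (@of_model n).
Proof.
move=> x; apply: simplex_val_inj; apply/rowP => i; rewrite {1}/simplex_val /= mxE !to_modelE.
rewrite /cumul -sumrB (bigD1 i) //= ltnSn ltnn subr0 big1 ?addr0 // => j ji.
rewrite ltnS leq_eqVlt; have -> : (j == i :> nat) = false by apply/negbTE.
by rewrite subrr.
Qed.

Lemma of_modelK n : cancel (@of_model n) (@to_model n).
Proof.
move=> y; apply: stair_inj => k; have := stairP y; rewrite modelc_size => -[T0 [Tm T1]].
rewrite to_modelE /cumul /simplex_val /=.
under eq_bigr do rewrite mxE.
have main N : \sum_(j < N) (if (j < k)%N then stair y j.+1 - stair y j else 0) =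
    stair y (minn k N).
  elim: N => [|N IH]; first by rewrite big_ord0 minn0 T0.
  rewrite big_ord_recr /= IH; case: ifP => kN.
    have -> : minn k N = N by lia.
    have -> : minn k N.+1 = N.+1 by lia.
    by rewrite addrC subrK.
  by rewrite addr0; congr (stair y _); lia.
rewrite main; have [kn|nk] := leqP k n.+1; first by congr (stair y _); lia.
by rewrite !T1 //; lia.
Qed.

(** A zero inserted at position [i] delays the cumulative sums by one from there on, which is how
    the actions reindex staircases. *)
Lemma to_model_face n (i : 'I_n.+2) (x : simplex n) :
  to_model (face i x) = coface i (to_model x : cosimp_space modelc n).
Proof.
have fE k : stair (to_model (face i x)) k = stair (to_model x) (k - (i < k)%N)%N.
  rewrite !to_modelE /cumul (bigD1_ord i) //= face_val unlift_none.
  rewrite if_same add0r; apply: eq_bigr => j _; rewrite face_val liftK.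
  congr (if _ then _ else _); rewrite /bump; lia.
have := stairP (to_model x); rewrite modelc_size => -[T0 [Tm T1]].
apply: stair_inj => k; rewrite {}fE.
case ni : (nat_of_ord i) => [|m].
  rewrite (cofaceE0 _ ni); congr (stair (to_model x) _).
  by rewrite /lcomp_reindex size_map /=; lia.
have [mn|nm] := ltnP m n.
  rewrite (cofaceEi mn _ ni); congr (stair (to_model x) _).
  rewrite /rcomp_reindex !size_map size_nseq /=; lia.
have em : m = n by have := ltn_ord i; lia.
rewrite (cofaceEl (i := i)) ?ni ?em //.
(* For the last coface the delay only starts beyond [n + 1], where the staircase is constantly 1. *)
change (stair (to_model x) (k - (n.+1 < k)%N) = stair (to_model x) (k - 0)).
rewrite subn0; have [kn|nk] := leqP k n.+1; first by rewrite subn0.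
by rewrite !T1 //; lia.
Qed.

Lemma of_model_coface n (i : 'I_n.+2) (y : cosimp_space modelc n) :
  of_model (coface i y) = face i (of_model y).
Proof.
by apply: (can_inj (@to_modelK n.+1)); rewrite of_modelK to_model_face of_modelK.
Qed.

Variable N : ibimod As_pos.

Lemma to_tot_subproof (f : Ibimod_map modelc N) :
  @sc_map_law (Delta R) (cosimp N) (fun n x => mapf f (nseq n tt, tt) (to_model x)).
Proof.
move=> n i x; apply: etrans (ibimod_map_coface f i (to_model x : cosimp_space modelc n)).
by congr (mapf f _ _); exact: to_model_face.
Qed.

Definition to_tot (f : Ibimod_map modelc N) : sTot R (cosimp N) :=
  mk_map (fun n => continuous_o (@to_model_continuous n) (@mapf_continuous _ _ _ _ f (nseq n tt, tt)))
    (to_tot_subproof f).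

Lemma of_tot_continuous_subproof (t : sTot R (cosimp N)) n :
  continuous ((fun y => mapf t n (of_model y)) : cosimp_space modelc n -> cosimp_space N n).
Proof. exact: (continuous_o (@of_model_continuous n) (@mapf_continuous _ _ _ _ t n)). Qed.

Lemma of_tot_coface_subproof (t : sTot R (cosimp N)) n (i : 'I_n.+2) (y : cosimp_space modelc n) :
  mapf t n.+1 (of_model (coface i y)) = coface i (mapf t n (of_model y) : cosimp_space N n).
Proof. by rewrite of_model_coface; exact: (mapf_law t). Qed.

Definition of_tot (t : sTot R (cosimp N)) : Ibimod_map modelc N :=
  ext_map (@of_tot_continuous_subproof t) (@of_tot_coface_subproof t).

Lemma of_totE t n (y : cosimp_space modelc n) :
  mapf (of_tot t) (nseq n tt, tt) y = mapf t n (of_model y).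
Proof. exact: (@ext_nseqE N modelc (fun n y => mapf t n (of_model y)) n y). Qed.

Lemma to_tot_continuous : continuous to_tot.
Proof.
apply: map_curry_continuous => n.
apply: (@map_apply_continuous _ _ _ _ (kprod (Ibimod_map modelc N) (simplex n)) (nseq n tt, tt)
  fst (fun z => to_model z.2)); first exact: kfst_continuous.
exact: (continuous_o (@ksnd_continuous _ (simplex n)) (@to_model_continuous n)).
Qed.

Lemma of_tot_continuous : continuous of_tot.
Proof.
apply: map_curry_continuous => -[l []]; rewrite -(unit_seqP l); set n := size l.
have -> : (fun z : kprod (sTot R (cosimp N)) (modelc (nseq n tt) tt) =>
    mapf (of_tot z.1) (nseq n tt, tt) z.2) = (fun z => mapf z.1 n (of_model z.2)).
  by apply/funext => z; exact: of_totE.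
apply: (@map_apply_continuous _ _ _ _ (kprod (sTot R (cosimp N)) (modelc (nseq n tt) tt)) n
  fst (fun z => of_model z.2)); first exact: kfst_continuous.
exact: (continuous_o (@ksnd_continuous _ (modelc (nseq n tt) tt)) (@of_model_continuous n)).
Qed.

Lemma to_totK : cancel to_tot of_tot.
Proof.
move=> f; apply: map_ext => -[l []]; rewrite -(unit_seqP l) => y.
apply: etrans (of_totE _ y) _.
exact: (congr1 (mapf f (nseq (size l) tt, tt)) (of_modelK y)).
Qed.

Lemma of_totK : cancel of_tot to_tot.
Proof.
move=> t; apply: map_ext => n x; apply: etrans (of_totE _ _) _.
exact: (congr1 (mapf t n) (to_modelK x)).
Qed.

Lemma modelc_sTot : weakly_equivalent R (Ibimod_map modelc N) (sTot R (cosimp N)).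
Proof.
exact: (homeo_weak_equivalence R to_tot_continuous of_tot_continuous to_totK of_totK).
Qed.

End SimplexModel.

(** * Restriction to the closed colour *)

(** The arities of [Act] with output [s] are runs of [c] followed by this tail, which treats both
    colours uniformly. *)
Definition output_tail (s : color) : seq color := if s is colC then [::] else [:: colO].

Lemma act_arityP l s : act_arity l s <-> exists n, l = map to_c (nseq n tt) ++ output_tail s.
Proof.
by case: s; split=> -[n ->]; exists n; rewrite map_nseq ?cats1 ?cats0.
Qed.

Lemma model_size_cat n s : model_size (map to_c (nseq n tt) ++ output_tail s) s = n.+1.
Proof. by rewrite /model_size size_cat size_map size_nseq; case: s => /=; lia. Qed.

Lemma act_arity_size l s : act_arity l s ->
  l = [::] ++ map to_c (nseq (model_size l s).-1 tt) ++ output_tail s.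
Proof. by move=> /act_arityP[n ->]; rewrite model_size_cat. Qed.

Lemma act_arity_gt0 l s : act_arity l s -> model_size l s = (model_size l s).-1.+1.
Proof. by move=> /act_arityP[n ->]; rewrite model_size_cat. Qed.

Lemma cat_nseq_tail n s u a v : map to_c (nseq n tt) ++ output_tail s = u ++ a :: v ->
  u = map to_c (nseq (size u) tt) /\
  ((a = colC /\ exists q, v = map to_c (nseq q tt) ++ output_tail s) \/
   [/\ a = colO, s = colO & v = [::]]).
Proof.
elim: u n => [|b u IH] [|n] /=.
- by case: s => //= -[<- <-]; split=> //; right.
- by move=> [<- <-]; split=> //; left; split=> //; exists n.
- by clear IH; case: s => //= -[_]; case: u.
- by move=> [<-] /IH[<- ?].
Qed.

Section ColourExtension.
Variables (R : realType) (M : ibimod Act_pos).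
Local Notation model := (model R).
Local Notation modelc := (modelc R).

Lemma act_lcomp_irr u v u' v' w l l' r a s (e1 : l = u ++ a :: v) (e2 : r = u ++ w ++ v)
    (e1' : l' = u' ++ a :: v') (e2' : r = u' ++ w ++ v')
    (x : Act_pos l s) (x' : Act_pos l' s) (m : M w a) :
  u = u' -> v = v' -> ib_lcomp e1 e2 x m = ib_lcomp e1' e2' x' m.
Proof.
move=> eu ev; subst u' v' l l'.
by rewrite (Prop_irrelevance e2 e2') (pt_if_eq x x').
Qed.

Lemma act_rcomp_irr u v u' v' w l r a s (e1 : l = u ++ a :: v) (e2 : r = u ++ w ++ v)
    (e1' : l = u' ++ a :: v') (e2' : r = u' ++ w ++ v')
    (x : Act_pos w a) (m : M l s) :
  u = u' -> v = v' -> ib_rcomp e1 e2 m x = ib_rcomp e1' e2' m x.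
Proof.
move=> eu ev; subst u' v'.
by rewrite (Prop_irrelevance e2 e2') (Prop_irrelevance e1 e1').
Qed.

Lemma output_arity s : act_pos_arity (colC :: output_tail s) s.
Proof. by split=> //; case: s => /=; [exists 1%N|exists 1%N]. Qed.

Definition output_pt s : Act_pos (colC :: output_tail s) s := pt (output_arity s).

(* The operations of the model of output [o] with [n + 1] inputs and those of output
   [c] with [n] inputs are the points of the same simplex. *)
Definition hat l s (y : model l s) : modelc (nseq (model_size l s).-1 tt) tt.
Proof.
apply: (of_stair (T := stair y) _ (modelc_arity _)).
abstract (by rewrite modelc_size -(act_arity_gt0 (model_arity y)); exact: stairP).
Defined.

Lemma hatE l s (y : model l s) k : stair (hat y) k = stair y k.
Proof. by []. Qed.

Variable k : Ibimod_map modelc (restr_c M).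
Local Notation kc := (fun n (z : modelc (nseq n tt) tt) =>
  (mapf k (nseq n tt, tt) z : M (map to_c (nseq n tt)) colC)).

(* Every operation of output [o] in the model is obtained from one of output [c] by
   grafting it on the first input of [*_{2;o}]. *)
Definition extend l s (y : model l s) : M l s :=
  ib_lcomp (erefl : colC :: output_tail s = [::] ++ colC :: output_tail s)
    (act_arity_size (model_arity y)) (output_pt s) (kc _ (hat y)).

(** [extend] can be computed from any presentation of [y] by a simplex point of the same staircase,
    which avoids transporting along equalities of arities. *)
Lemma extendE l l' s (y : model l s) n (z : modelc (nseq n tt) tt)
    (e1 : l' = [::] ++ colC :: output_tail s)
    (e2 : l = [::] ++ map to_c (nseq n tt) ++ output_tail s) (x : Act_pos l' s) :
  (forall j, stair z j = stair y j) -> extend y = ib_lcomp e1 e2 x (kc _ z).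
Proof.
move=> zy; rewrite /extend.
move: (act_arity_size (model_arity y)) (hat y) (hatE y) => + h hE.
have en : (model_size l s).-1 = n by rewrite e2 model_size_cat.
case: _ / en in z e2 zy * => e.
have -> : z = h by apply: stair_inj => j; rewrite zy hE.
exact: act_lcomp_irr.
Qed.

(** Both sides graft the same [c]-element [K] in two stages. Associativity merges each pair of
    stages into one left action, and [Act_pos] has at most one operation of each arity. *)
Lemma extend_lcomp u v w l r a s (e1 : l = u ++ a :: v) (e2 : r = u ++ w ++ v)
    (x : Act_pos l s) (y : model w a) :
  extend (ib_lcomp e1 e2 x y : model r s) = ib_lcomp e1 e2 x (extend y).
Proof.
have [/act_arityP[L lE] _] := pt_ifP x.
have := cat_nseq_tail (etrans (esym lE) e1); set p := size u => -[uE hv].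
have [q vE] : exists q, output_tail a ++ v = map to_c (nseq q tt) ++ output_tail s.
  by case: hv => [[-> [q ->]]|[-> -> ->]]; [exists q|exists 0%N].
set n := (model_size w a).-1.
have wE : w = map to_c (nseq n tt) ++ output_tail a := act_arity_size (model_arity y).
have xh0 : (0 < size (nseq p tt ++ tt :: nseq q tt))%N by rewrite size_cat /=; lia.
have f2 : nseq (p + (n + q)) tt = nseq p tt ++ nseq n tt ++ nseq q tt by rewrite !nseqD.
pose xh := As_pos_pt xh0.
pose z : modelc (nseq (p + (n + q)) tt) tt := ib_lcomp erefl f2 xh (hat y).
have g2 : r = [::] ++ map to_c (nseq (p + (n + q)) tt) ++ output_tail s.
  by rewrite e2 {1}uE {1}wE f2 !map_cat -!catA -vE.
have zE j : stair z j = stair (ib_lcomp e1 e2 x y : model r s) j.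
  change (stair y (lcomp_reindex (map to_c (nseq p tt)) j) = stair y (lcomp_reindex u j)).
  by rewrite -uE.
rewrite (extendE (erefl (colC :: output_tail s)) g2 (output_pt s) zE).
rewrite (ibimod_map_lcomp k); set K := mapf k (nseq n tt, tt) (hat y).
have h2 : (map to_c (nseq p tt) ++ colC :: map to_c (nseq q tt) ++ output_tail s) =
    [::] ++ map to_c (nseq p tt ++ tt :: nseq q tt) ++ output_tail s.
  by rewrite map_cat /= -catA.
have h4 : r = ([::] ++ map to_c (nseq p tt)) ++ map to_c (nseq n tt) ++
    (map to_c (nseq q tt) ++ output_tail s).
  by rewrite g2 f2 !map_cat -!catA.
have ax1 := @ib_seq_r _ _ M [::] (output_tail s) (map to_c (nseq p tt)) (map to_c (nseq q tt))
  (map to_c (nseq n tt)) _ _ _ _ _ _ _ _ (erefl (colC :: output_tail s)) h2 erefl h4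
  (map_splice to_c erefl) (map_splices to_c f2) g2 (output_pt s) xh K.
apply: (etrans (esym ax1)).
have i4 : r = (u ++ [::]) ++ map to_c (nseq n tt) ++ (output_tail a ++ v).
  by rewrite cats0 e2 {1}wE -!catA.
have i3 : u ++ (colC :: output_tail a) ++ v = (u ++ [::]) ++ colC :: (output_tail a ++ v).
  by rewrite cats0.
have ax2 := @ib_seq_r _ _ M u v [::] (output_tail a)
  (map to_c (nseq n tt)) _ _ _ _ _ _ _ _ e1 erefl i3 i4
  erefl (act_arity_size (model_arity y)) e2 x (output_pt a) K.
apply: (etrans _ ax2); apply: act_lcomp_irr; last by rewrite vE.
by rewrite cats0.
Qed.

(** On an input [c] the action takes place inside [hat y]. The input [o] belongs to [output_pt]
    instead, so grafting there turns into a left action by a larger operation. *)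
Lemma extend_rcomp u v w l r a s (e1 : l = u ++ a :: v) (e2 : r = u ++ w ++ v)
    (y : model l s) (x : Act_pos w a) :
  extend (ib_rcomp e1 e2 y x : model r s) = ib_rcomp e1 e2 (extend y) x.
Proof.
set n := (model_size l s).-1.
have lE : l = map to_c (nseq n tt) ++ output_tail s := act_arity_size (model_arity y).
have [/act_arityP[j wE] w0] := pt_ifP x.
have := cat_nseq_tail (etrans (esym lE) e1); set p := size u => -[uE].
set K := mapf k (nseq n tt, tt) (hat y).
move=> [[aC [q vE]]|[aO sO vE]].
  subst a v; rewrite /= cats0 in wE; subst w.
  have nE : n = (p + q.+1)%N.
    have := congr1 size lE; rewrite {1}e1 !size_cat /= !size_cat !size_map !size_nseq -/p; lia.
  have f1 : nseq n tt = nseq p tt ++ tt :: nseq q tt by rewrite nE nseqD.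
  have f2 : nseq (p + (j + q)) tt = nseq p tt ++ nseq j tt ++ nseq q tt by rewrite !nseqD.
  pose z : modelc (nseq (p + (j + q)) tt) tt :=
    ib_rcomp f1 f2 (hat y) (x : As_pos (nseq j tt) tt).
  have g2 : r = [::] ++ map to_c (nseq (p + (j + q)) tt) ++ output_tail s.
    by rewrite e2 {1}uE f2 !map_cat -!catA.
  have zE i : stair z i = stair (ib_rcomp e1 e2 y x : model r s) i.
    change (stair y (rcomp_reindex (map to_c (nseq p tt)) (map to_c (nseq j tt)) i) =
            stair y (rcomp_reindex u (map to_c (nseq j tt)) i)).
    by rewrite -uE.
  rewrite (extendE (erefl (colC :: output_tail s)) g2 (output_pt s) zE).
  rewrite (ibimod_map_rcomp k) -/K.
  have h3 : l = ([::] ++ map to_c (nseq p tt)) ++ colC :: (map to_c (nseq q tt) ++ output_tail s).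
    by rewrite e1 {1}uE.
  have h4 : r = ([::] ++ map to_c (nseq p tt)) ++ map to_c (nseq j tt) ++
      (map to_c (nseq q tt) ++ output_tail s).
    by rewrite e2 {1}uE.
  have ax := @ib_seq_m _ _ M [::] (output_tail s) (map to_c (nseq p tt)) (map to_c (nseq q tt))
    (map to_c (nseq j tt)) _ _ _ _ _ _ _ _ (erefl (colC :: output_tail s))
    (act_arity_size (model_arity y)) h3 h4 (map_splice to_c f1) (map_splices to_c f2) g2
    (output_pt s) K x.
  by apply: (etrans (esym ax)); apply: act_rcomp_irr.
subst a s v; rewrite /= in wE.
have nE : n = p.
  have := congr1 size lE; rewrite {1}e1 !size_cat /= !size_map !size_nseq -/p; lia.
have xh0 : (0 < size ([::] ++ tt :: nseq j tt))%N by [].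
have f2 : nseq (n + j) tt = [::] ++ nseq n tt ++ nseq j tt by rewrite nseqD.
pose xh := As_pos_pt xh0.
pose z : modelc (nseq (n + j) tt) tt := ib_lcomp erefl f2 xh (hat y).
have g2 : r = [::] ++ map to_c (nseq (n + j) tt) ++ output_tail colO.
  by rewrite e2 {1}uE {1}wE f2 !map_cat cats0 -nE -!catA.
(* Grafting on the last input [o] appends zeros: the two reindexings agree up to [p + 1], and the
   staircase is 1 afterwards. *)
have zE i : stair z i = stair (ib_rcomp e1 e2 y x : model r colO) i.
  change (stair y (lcomp_reindex [::] i) = stair y (rcomp_reindex u w i)).
  have [_ [_ y1]] := stairP y.
  have wS : size w = j.+1 by rewrite wE size_cat size_map size_nseq addn1.
  have mS : model_size l colO = p.+1 by rewrite lE (model_size_cat n colO) nE.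
  have [ip|pi] := leqP i p.+1.
    by congr (stair y _); rewrite /lcomp_reindex /rcomp_reindex wS -/p /=; lia.
  rewrite !y1 //; rewrite mS /lcomp_reindex /rcomp_reindex ?wS /= ?subn0 -?/p; lia.
rewrite (extendE (erefl (colC :: output_tail colO)) g2 (output_pt colO) zE).
rewrite (ibimod_map_lcomp k) -/K.
have h2 : colC :: map to_c (nseq j tt) ++ output_tail colO =
    [::] ++ map to_c ([::] ++ tt :: nseq j tt) ++ output_tail colO by [].
have h4 : r = ([::] ++ [::]) ++ map to_c (nseq n tt) ++
    (map to_c (nseq j tt) ++ output_tail colO).
  by rewrite g2 f2 !map_cat -!catA.
have ax1 := @ib_seq_r _ _ M [::] (output_tail colO) [::] (map to_c (nseq j tt))
  (map to_c (nseq n tt)) _ _ _ _ _ _ _ _ (erefl (colC :: output_tail colO)) h2 erefl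
  h4 (map_splice to_c erefl) (map_splices to_c f2) g2 (output_pt colO) xh K.
apply: (etrans (esym ax1)).
have i3 : l = ([::] ++ map to_c (nseq n tt) ++ [::]) ++ colO :: [::] by rewrite cats0.
have i4 : r = ([::] ++ map to_c (nseq n tt) ++ [::]) ++ w ++ [::].
  by rewrite e2 {1}uE -nE !cats0.
have i7 : r = [::] ++ map to_c (nseq n tt) ++ ([::] ++ w ++ [::]).
  by rewrite i4 /= -!catA.
have ax2 := @ib_par_m _ _ M [::] [::] [::] (map to_c (nseq n tt)) w _ _ _ _ _ _ _
  (erefl (colC :: output_tail colO)) (act_arity_size (model_arity y)) i3 i4
  (erefl : [:: colC; colO] = ([::] ++ colC :: [::]) ++ colO :: [::]) erefl erefl
  i7 (output_pt colO) K x.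
apply: (@etrans _ _ (ib_rcomp i3 i4 (extend y) x)); last first.
  by apply: act_rcomp_irr; rewrite // cats0 uE nE.
apply: (etrans _ (esym ax2)).
by apply: act_lcomp_irr => //; rewrite wE /= cats0.
Qed.

End ColourExtension.

Section ColourRestriction.
Variables (R : realType) (M : ibimod Act_pos).
Local Notation model := (model R).
Local Notation modelc := (modelc R).
Local Notation Mapc := (Ibimod_map modelc (restr_c M)).

Lemma hat_continuous l s : continuous (@hat R l s).
Proof. by apply: model_space_continuous => j; exact: stair_continuous. Qed.

Lemma extend_eval_continuous l s :
  continuous ((fun z => extend z.1 z.2) : kprod Mapc (model l s) -> M l s).
Proof.
have [ar|nar] := pselect (act_arity l s); last first.
  by move=> z; have := nar (model_arity z.2).
set n := (model_size l s).-1.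
(* The proof of arity inside [extend] depends on the point; replacing it by the fixed [ar] makes the
   formula uniform in [z]. *)
have -> : (fun z : kprod Mapc (model l s) => extend z.1 z.2) =
    (fun z => ib_lcomp (erefl : colC :: output_tail s = [::] ++ colC :: output_tail s)
      (act_arity_size ar) (output_pt s)
      (mapf z.1 (nseq n tt, tt) (hat z.2) : M (map to_c (nseq n tt)) colC)).
  by apply/funext => z; exact: act_lcomp_irr.
have c2 : continuous ((fun z => mapf z.1 (nseq n tt, tt) (hat z.2)) :
    kprod Mapc (model l s) -> M (map to_c (nseq n tt)) colC).
  apply: (@map_apply_continuous _ _ _ _ (kprod Mapc (model l s)) (nseq n tt, tt) fst
    (fun z => hat z.2)); first exact: kfst_continuous.
  exact: (continuous_o (@ksnd_continuous Mapc (model l s)) (@hat_continuous l s)).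
exact: (continuous_o (kpair_continuous (@cts_cst _ _ (output_pt s)) c2)
  (@ib_lcontinuous _ _ M _ _ _ _ _ _ _ _ (act_arity_size ar))).
Qed.

Lemma extend_continuous (k : Mapc) l s : continuous (@extend R M k l s).
Proof.
exact: (continuous_o (@kprod_pairl_continuous Mapc (model l s) k)
  (@extend_eval_continuous l s)).
Qed.

Lemma extend_law (k : Mapc) : @ibimod_law _ _ model M (fun i => @extend R M k i.1 i.2).
Proof.
split=> [u v w l r a s e1 e2 x y|u v w l r a s e1 e2 y x].
  exact: extend_lcomp.
exact: extend_rcomp.
Qed.

Definition extend_map (k : Mapc) : Ibimod_map model M :=
  mk_map (fun i => @extend_continuous k i.1 i.2) (extend_law k).

Lemma restrict_law (f : Ibimod_map model M) :
  @ibimod_law _ _ modelc (restr_c M) (fun i => mapf f (map to_c i.1, to_c i.2)).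
Proof.
split=> [u v w l r a s e1 e2 x y|u v w l r a s e1 e2 y x].
  exact: (ibimod_map_lcomp f (map_splice to_c e1) (map_splices to_c e2) x y).
exact: (ibimod_map_rcomp f (map_splice to_c e1) (map_splices to_c e2) y x).
Qed.

Definition restrict_map (f : Ibimod_map model M) : Mapc :=
  mk_map (fun i => @mapf_continuous _ _ _ _ f (map to_c i.1, to_c i.2)) (restrict_law f).

Lemma extend_map_continuous : continuous extend_map.
Proof. by apply: map_curry_continuous => i; exact: extend_eval_continuous. Qed.

Lemma restrict_map_continuous : continuous restrict_map.
Proof.
apply: map_curry_continuous => i.
exact: (@map_eval_continuous _ _ _ (@ibimod_law _ _ model M) (map to_c i.1, to_c i.2)).
Qed.

Lemma extend_mapK : cancel extend_map restrict_map.
Proof.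
move=> k; apply: map_ext => -[l []]; rewrite -(unit_seqP l) => y.
set n := size l.
have e2 : map to_c (nseq n tt) = [::] ++ map to_c (nseq n tt) ++ output_tail colC.
  by rewrite cats0.
apply: etrans (extendE k (l := map to_c (nseq n tt)) (s := colC) (y := y) (z := y)
  (erefl : [:: colC] = [::] ++ colC :: [::]) e2 (op_unit Act_pos colC) _) _ => //.
exact: ib_unitl.
Qed.

Lemma restrict_mapK : cancel restrict_map extend_map.
Proof.
move=> f; apply: map_ext => -[l s] y; rewrite /= mk_mapE /extend /=.
(* In [model] itself, [y] is [hat y] grafted on the first input of [output_pt s], so [f] is
   determined by its values of output [c]. *)
apply: etrans (esym (ibimod_map_lcomp f _ (act_arity_size (model_arity y)) (output_pt s)
  (hat y : model (map to_c (nseq (model_size l s).-1 tt)) colC))) _.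
congr (mapf f (l, s) _); apply: stair_inj => j.
by change (stair y (j - 0) = stair y j); rewrite subn0.
Qed.

Lemma model_modelc :
  weakly_equivalent R (Ibimod_map model M) (Ibimod_map modelc (restr_c M)).
Proof.
exact: (homeo_weak_equivalence R restrict_map_continuous extend_map_continuous
  restrict_mapK extend_mapK).
Qed.

End ColourRestriction.

(** * Comparison with arbitrary cofibrant replacements *)

Lemma act_subsingleton l s (x y : Act_ib l s) : x = y.
Proof. exact: pt_if_eq. Qed.

Lemma as_subsingleton l s (x y : As_ib l s) : x = y.
Proof. exact: pt_if_eq. Qed.

(** Asphericity gives a point of the totalization by extension over simplices, and such a point is a
    bimodule map. *)
Lemma modelc_map_exists (R : realType) (N : ibimod As_pos) : ib_aspherical R N ->
  (forall l s, As_ib l s -> exists _ : N l s, True) ->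
  exists _ : Ibimod_map (modelc R) N, True.
Proof.
move=> aN neN; have [|n|t _] := @sTot_inhabited R (cosimp N); last by exists (of_tot t).
  by move=> n; exact: aN.
by apply: neN; exact: pt (modelc_arity n).
Qed.

Lemma Ibimod_h_model (R : realType) (M : ibimod Act_pos) (P : cofibrant_replacement R Act_ib) :
  weakly_equivalent R (Ibimod_h P M) (Ibimod_map (model R) M).
Proof.
have aP := replacement_aspherical P act_subsingleton.
(* A map from [model] to the replacement is determined by its part of output [c], so it is built on
   the restriction and then extended. *)
have [||g _] := @modelc_map_exists R (restr_c (cr_obj P)).
- by move=> l s; exact: aP.
- by move=> l s x; exact: (replacement_inhabited P x).
apply: (replacement_comparison M (model_map R) (extend_map g)).
- exact: act_subsingleton.
- exact: model_aspherical.
- by move=> l s x; apply: model_inhabited; exact: pt_ifP x.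
- exact: model_homotopic.
Qed.

Lemma Ibimod_h_modelc (R : realType) (N : ibimod As_pos) (Q : cofibrant_replacement R As_ib) :
  weakly_equivalent R (Ibimod_h Q N) (Ibimod_map (modelc R) N).
Proof.
have aQ := replacement_aspherical Q as_subsingleton.
have [|g _] := modelc_map_exists aQ.
  by move=> l s x; exact: (replacement_inhabited Q x).
apply: (replacement_comparison N (modelc_map R) g).
- exact: as_subsingleton.
- exact: modelc_aspherical.
- by move=> l s x; apply: model_inhabited; exact: pt_ifP x.
- exact: modelc_homotopic.
Qed.

Theorem theorem3p12 (R : realType) (M : ibimod Act_pos)
    (P : cofibrant_replacement R Act_ib) (Q : cofibrant_replacement R As_ib) :
  weakly_equivalent R (Ibimod_h P M) (Ibimod_h Q (restr_c M)) /\
  weakly_equivalent R (Ibimod_h Q (restr_c M)) (sTot R (cosimp (restr_c M))).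
Proof.
have hP := Ibimod_h_model M P; have hQ := Ibimod_h_modelc (restr_c M) Q.
have hc := model_modelc R M; have ht := modelc_sTot R (restr_c M).
split; last exact: (rst_trans _ _ _ _ _ hQ ht).
exact: (rst_trans _ _ _ _ _ (rst_trans _ _ _ _ _ hP hc) (rst_sym _ _ _ _ hQ)).
Qed.
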